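(* Let $H=(V,E,w)$ be a hypergraph as in the context, and let $f_1,\dots,f_k$ be $k$ vectors that are orthonormal with respect to $\langle\cdot,\cdot\rangle_w$ and satisfy $\max_{s\in[k]}\mathcal{D}_w(f_s)\le\xi$. Then a random set $S\subset V$ can be constructed in polynomial time such that, with probability $\Omega(1)$, $|S|\le\frac{24|V|}{k}$ and $$\phi(S)\le C\min\{\sqrt{r\log k},\ k\log k\log\log k\sqrt{\log r}\}\cdot\sqrt{\xi},$$ where $C$ is an absolute constant and $r$ is the size of the largest hyperedge in $E$.
   Context: $H=(V,E,w)$: $V$ finite, hyperedges nonempty subsets of $V$, $w_e\ge0$; vertex weights $w_v=\sum_{e\ni v}w_e>0$; $w(S)=\sum_{v\in S}w_v$; $\partial S$ the set of hyperedges meeting both $S$ and $V\setminus S$; $\phi(S)=\sum_{e\in\partial S}w_e/w(S)$. $\langle f,g\rangle_w=\sum_vw_vf_vg_v$. $\mathcal{D}_w(f)=\frac{\sum_{e\in E}w_e\max_{u,v\in e}(f_u-f_v)^2}{\sum_uw_uf_u^2}$. *)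

(* Defs.v *)
From mathcomp Require Import all_boot all_order all_algebra.
From mathcomp Require Import reals exp.

Set Implicit Arguments.
Unset Strict Implicit.
Unset Printing Implicit Defensive.
Import Order.TTheory GRing.Theory Num.Theory.
Local Open Scope ring_scope.

(* Binary logarithm, so that log2 (log2 k) >= 0 for k >= 2 (with the natural
   logarithm, ln (ln 2) < 0).  As ln does, it takes the value 0 at 0. *)
Definition log2 (R : realType) (x : R) : R := ln x / ln 2.

Section Hypergraph.
Variables (R : realType) (V : finType).

Definition edge_sum (E : {set {set V}}) (w : {set V} -> R) (v : V) : R :=
  \sum_(e in E | v \in e) w e.

Record hypergraph := Hypergraph {
  edges : {set {set V}};
  weight : {set V} -> R;
  edges_neq0 : forall e, e \in edges -> e != set0;
  weight_ge0 : forall e, e \in edges -> 0 <= weight e;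
  edge_sum_gt0 : forall v, 0 < edge_sum edges weight v
}.

Variable H : hypergraph.

Definition vweight (v : V) : R := edge_sum (edges H) (weight H) v.

Definition volume (S : {set V}) : R := \sum_(v in S) vweight v.

Definition boundary (S : {set V}) : {set {set V}} :=
  [set e in edges H | (e :&: S != set0) && (e :&: ~: S != set0)].

(* Equal to 0, as 0 / 0, on the empty set. *)
Definition expansion (S : {set V}) : R :=
  (\sum_(e in boundary S) weight H e) / volume S.

Definition inner_w (f g : V -> R) : R := \sum_v vweight v * f v * g v.

Definition orthonormal_w (k : nat) (f : 'I_k -> V -> R) : Prop :=
  forall s t, inner_w (f s) (f t) = (s == t)%:R.

Definition discrepancy (f : V -> R) : R :=
  (\sum_(e in edges H)
     weight H e *
     \big[Num.max/0]_(u in e) \big[Num.max/0]_(v in e) (f u - f v) ^+ 2)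
  / \sum_u vweight u * f u ^+ 2.

Definition max_edge_size : nat := \max_(e in edges H) #|e|.

End Hypergraph.

(* A randomized real RAM.  There are finitely many arrays per program, each
   holding either natural numbers or reals; scalar variables are arrays used
   at a constant index.  Natural numbers are used for control and addressing:
   as in the unit-cost RAM, they are only added and subtracted (truncated).
   Reals are exact, with field operations, square roots and comparisons, and
   cannot be converted to natural numbers.  Programs are finite syntax with no
   real constant other than natural numbers, so an algorithm is uniform in
   its inputs.  Randomness is a sequence of fair coin flips. *)

Inductive nexpr : Type :=
  | NCst of nat
  | NGet of nat & nexpr
  | NAdd of nexpr & nexpr
  | NSub of nexpr & nexpr.

Inductive rexpr : Type :=
  | RCst of nat
  | RGet of nat & nexpr
  | RAdd of rexpr & rexpr
  | RSub of rexpr & rexpr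
  | RMul of rexpr & rexpr
  | RDiv of rexpr & rexpr
  | RSqrt of rexpr.

Inductive test : Type :=
  | NLe of nexpr & nexpr
  | RLe of rexpr & rexpr.

Inductive cmd : Type :=
  | Skip
  | NPut of nat & nexpr & nexpr
  | RPut of nat & nexpr & rexpr
  | Flip of nat & nexpr
  | Seq of cmd & cmd
  | If of test & cmd & cmd
  | While of test & cmd.

Section Semantics.
Variable R : realType.

Record state : Type := State {
  nmem : nat -> nat -> nat;
  rmem : nat -> nat -> R;
  coins : seq bool
}.

Definition update (T : Type) (m : nat -> nat -> T) (a i : nat) (x : T) :=
  fun b j => if (b == a) && (j == i) then x else m b j.

Fixpoint neval (s : state) (e : nexpr) : nat :=
  match e with
  | NCst c => c
  | NGet a i => nmem s a (neval s i)
  | NAdd e1 e2 => (neval s e1 + neval s e2)%N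
  | NSub e1 e2 => (neval s e1 - neval s e2)%N
  end.

Fixpoint reval (s : state) (e : rexpr) : R :=
  match e with
  | RCst c => c%:R
  | RGet a i => rmem s a (neval s i)
  | RAdd e1 e2 => reval s e1 + reval s e2
  | RSub e1 e2 => reval s e1 - reval s e2
  | RMul e1 e2 => reval s e1 * reval s e2
  | RDiv e1 e2 => reval s e1 / reval s e2
  | RSqrt e1 => Num.sqrt (reval s e1)
  end.

Definition teval (s : state) (b : test) : bool :=
  match b with
  | NLe e1 e2 => (neval s e1 <= neval s e2)%N
  | RLe e1 e2 => reval s e1 <= reval s e2
  end.

Definition nput (s : state) (a i x : nat) : state :=
  State (update (nmem s) a i x) (rmem s) (coins s).

Definition rput (s : state) (a i : nat) (x : R) : state :=
  State (nmem s) (update (rmem s) a i x) (coins s).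

(* [exec c s t s'] : started in s, the program c halts in s' after t steps.
   A step is an atomic command or a test; its expressions have a size fixed by
   the program.  A coin flip is stuck once the coins are exhausted. *)
Inductive exec : cmd -> state -> nat -> state -> Prop :=
  | ExecSkip s :
      exec Skip s 1 s
  | ExecNPut a i e s :
      exec (NPut a i e) s 1 (nput s a (neval s i) (neval s e))
  | ExecRPut a i e s :
      exec (RPut a i e) s 1 (rput s a (neval s i) (reval s e))
  | ExecFlip a i (b : bool) l s :
      coins s = b :: l ->
      exec (Flip a i) s 1
        (State (update (nmem s) a (neval s i) (b : nat)) (rmem s) l)
  | ExecSeq c1 c2 s1 s2 s3 t1 t2 :
      exec c1 s1 t1 s2 -> exec c2 s2 t2 s3 ->
      exec (Seq c1 c2) s1 (t1 + t2)%N s3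
  | ExecIf b c1 c2 s t s' :
      exec (if teval s b then c1 else c2) s t s' ->
      exec (If b c1 c2) s t.+1 s'
  | ExecWhileStop b c s :
      ~~ teval s b -> exec (While b c) s 1 s
  | ExecWhileStep b c s1 s2 s3 t1 t2 :
      teval s1 b -> exec c s1 t1 s2 -> exec (While b c) s2 t2 s3 ->
      exec (While b c) s1 (t1 + t2).+1 s3.

(* Probability of an event depending on T independent fair coin flips. *)
Definition coin_prob (T : nat) (A : pred (T.-tuple bool)) : R :=
  #|A|%:R / 2 ^+ T.

End Semantics.

Section Encoding.
Variables (R : realType) (V : finType) (H : hypergraph R V).
Variables (k : nat) (f : 'I_k -> V -> R).

(* Vertices and hyperedges are numbered by the enumerations of V and of the
   set of hyperedges.  Natural-number array 0 holds |V|, |E|, k, array 1 the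
   incidence matrix, one row per hyperedge; real array 0 holds the hyperedge
   weights, array 1 the vectors f_s, one row per s.  All other cells are 0. *)
Definition input_nmem (a i : nat) : nat :=
  match a with
  | 0 => nth 0%N [:: #|V|; #|edges H|; k] i
  | 1 => nth 0%N [seq ((v \in e) : nat) | e : {set V} <- enum (edges H),
                                          v : V <- enum V] i
  | _ => 0%N
  end.

Definition input_rmem (a i : nat) : R :=
  match a with
  | 0 => nth 0 [seq weight H e | e <- enum (edges H)] i
  | 1 => nth 0 [seq f s v | s <- enum 'I_k, v <- enum V] i
  | _ => 0
  end.

Definition input (omega : seq bool) : state R :=
  State input_nmem input_rmem omega.

Definition input_size : nat :=
  (3 + #|edges H| * #|V| + #|edges H| + k * #|V|)%N.

(* The output set is read off natural-number array 2, as a 0/1 vector. *)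
Definition outputs (s : state R) (S : {set V}) : Prop :=
  forall v : V, nmem s 2 (enum_rank v) = (v \in S).

(* With coins omega, the program halts in at most T steps and returns S. *)
Definition computes (prog : cmd) (T : nat) (omega : seq bool) (S : {set V}) :
    Prop :=
  exists t s, [/\ exec prog (input omega) t s, (t <= T)%N & outputs s S].

End Encoding.

(* Main.v *)
Require Import Defs.
From mathcomp Require Import all_boot all_order all_algebra.
From mathcomp Require Import reals exp.
From mathcomp Require Import ring lra zify.
Set Implicit Arguments.
Unset Strict Implicit.
Unset Printing Implicit Defensive.
Import Order.TTheory GRing.Theory Num.Theory.
Local Open Scope ring_scope.

(** Write F(v) = (f_1(v), ..., f_k(v)), nu(v) = |F(v)| and F'(v) = F(v)/nu(v).
    The only randomness is a k x m sign matrix with m = O(log k); it projects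
    F'(v) to m coordinates.  Cutting every coordinate axis into intervals of
    constant length partitions V into cells.  By orthonormality, all but a
    constant amount of the total mass k = sum_v w_v nu(v)^2 lies at constant
    distance from a given F'(v), and such points are separated by some
    coordinate with probability 1 - O(1/k).  So for a constant fraction of the
    sign matrices, most of the mass lies in cells with O(|V|/k) vertices, and
    it remains to find among shifted partitions a sweep cut of nu times a cell
    bump of small conductance; the search is deterministic.

    For the bound sqrt(r log k), each coordinate is shifted independently by 0
    or half a period and the bumps are normalised tents, whose squares sum to 1
    over the 2^m shifts.  The energy summed over shifts and cells is O(m) times
    the energy of F on pairs of vertices; a hyperedge is a union of at most r
    pairs through a fixed centre.

    For the other bound, all coordinates are shifted by the same j/2^m, the
    bumps are trapezoids with margin 1/(32 m), and cells are packed into at most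
    k groups.  A short hyperedge rarely meets two cells and the bumps are
    Lipschitz; a long one pays at most k.  This gives k (log k)^(3/2), which is
    only needed when r >= k, where log r >= log k. *)

(** * Programs: total correctness with running time *)

Fixpoint nmods (c : cmd) : seq nat :=
  match c with
  | NPut a _ _ | Flip a _ => [:: a]
  | Seq c1 c2 | If _ c1 c2 => nmods c1 ++ nmods c2
  | While _ c1 => nmods c1
  | _ => [::]
  end.

Fixpoint rmods (c : cmd) : seq nat :=
  match c with
  | RPut a _ _ => [:: a]
  | Seq c1 c2 | If _ c1 c2 => rmods c1 ++ rmods c2
  | While _ c1 => rmods c1
  | _ => [::]
  end.

Fixpoint flipless (c : cmd) : bool :=
  match c with
  | Flip _ _ => false
  | Seq c1 c2 | If _ c1 c2 => flipless c1 && flipless c2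
  | While _ c1 => flipless c1
  | _ => true
  end.

(* Running time when every loop makes at most Y iterations. *)
Fixpoint cost (Y : nat) (c : cmd) : nat :=
  match c with
  | Seq c1 c2 => (cost Y c1 + cost Y c2)%N
  | If _ c1 c2 => (cost Y c1 + cost Y c2).+1
  | While _ c1 => (Y * (cost Y c1).+1).+1
  | _ => 1%N
  end.

Fixpoint cost_poly (c : cmd) : {poly nat} :=
  match c with
  | Seq c1 c2 => cost_poly c1 + cost_poly c2
  | If _ c1 c2 => cost_poly c1 + cost_poly c2 + 1
  | While _ c1 => 'X * (cost_poly c1 + 1) + 1
  | _ => 1
  end.

Lemma cost_polyE (Y : nat) (c : cmd) : (cost_poly c).[Y] = cost Y c.
Proof.
elim: c => //= [*|*|*|*|c1 E1 c2 E2|_ c1 E1 c2 E2|_ c1 E1];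
  rewrite ?hornerE ?hornerM ?E1 ?E2 ?addn1 //.
- by rewrite /GRing.add /= !/GRing.one /= addn1.
- by rewrite /GRing.add /GRing.mul /= !/GRing.one /= !addn1.
Qed.

Definition For (x : nat) (N : nat * nat) (body : cmd) : cmd :=
  Seq (NPut x (NCst 0) (NCst 0))
    (While (NLe (NAdd (NGet x (NCst 0)) (NCst 1)) (NGet N.1 (NCst N.2)))
       (Seq body (NPut x (NCst 0) (NAdd (NGet x (NCst 0)) (NCst 1))))).

Section WeakestPrecondition.
Variables (R : realType) (Y : nat).
Implicit Types (c : cmd) (s : state R).

Definition same c s s' : Prop :=
  [/\ forall a i, a \notin nmods c -> nmem s' a i = nmem s a i,
      forall a i, a \notin rmods c -> rmem s' a i = rmem s a i
    & flipless c -> coins s' = coins s].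

Definition wp c s (Q : state R -> Prop) : Prop :=
  exists t s', [/\ exec c s t s', (t <= cost Y c)%N & Q s'].

Lemma update_other T (m : nat -> nat -> T) a i x b j :
  b != a -> update m a i x b j = m b j.
Proof. by rewrite /update => /negPf->. Qed.

Lemma updateE T (m : nat -> nat -> T) a i x j :
  update m a i x a j = if j == i then x else m a j.
Proof. by rewrite /update eqxx. Qed.

Lemma same_refl c s : same c s s. Proof. by split. Qed.

Lemma same_trans c s1 s2 s3 : same c s1 s2 -> same c s2 s3 -> same c s1 s3.
Proof.
move=> [n1 r1 f1] [n2 r2 f2]; split=> [a i h|a i h|h].
- by rewrite n2 ?n1.
- by rewrite r2 ?r1.
- by rewrite f2 ?f1.
Qed.

Lemma same_sub c c' s s' : {subset nmods c <= nmods c'} ->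
  {subset rmods c <= rmods c'} -> (flipless c' -> flipless c) ->
  same c s s' -> same c' s s'.
Proof.
move=> hn hr hf [n1 r1 f1]; split=> [a i h|a i h|h].
- by apply: n1; apply: contra h; apply: hn.
- by apply: r1; apply: contra h; apply: hr.
- by apply: f1; apply: hf.
Qed.

Lemma exec_same c s t s' : exec c s t s' -> same c s s'.
Proof.
elim=> {c s t s'} [s|a i e s|a i e s|a i b l s _|c1 c2 s1 s2 s3 t1 t2 _ h1 _ h2
  |b c1 c2 s t s' _ h|b c s _|b c s1 s2 s3 t1 t2 _ _ h1 _ h2].
- by split.
- split=> //= b j; rewrite inE => h; exact: update_other.
- split=> //= b j; rewrite inE => h; exact: update_other.
- split=> //= c j; rewrite inE => h; exact: update_other.
- apply: (@same_trans _ _ s2).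
    by apply: same_sub h1 => /= [a|a|]; rewrite ?mem_cat;
      first [by move=> -> | by case/andP].
  by apply: same_sub h2 => /= [a|a|]; rewrite ?mem_cat;
    first [by move=> ->; rewrite orbT | by case/andP].
- case: (teval s b) h => h.
    by apply: same_sub h => /= [a|a|]; rewrite ?mem_cat;
      first [by move=> -> | by case/andP].
  by apply: same_sub h => /= [a|a|]; rewrite ?mem_cat;
    first [by move=> ->; rewrite orbT | by case/andP].
- by split.
- exact: same_trans h1 h2.
Qed.

Lemma wp_impl c s (Q Q' : state R -> Prop) :
  wp c s Q -> (forall s', same c s s' -> Q s' -> Q' s') -> wp c s Q'.
Proof.
move=> [t [s' [h1 h2 h3]]] h; exists t, s'; split=> //.
apply: h => //; exact: exec_same h1.
Qed.

Lemma wp_skip s (Q : state R -> Prop) : Q s -> wp Skip s Q.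
Proof. by move=> h; exists 1%N, s; split=> //; constructor. Qed.

Lemma wp_nput a i e s (Q : state R -> Prop) :
  Q (nput s a (neval s i) (neval s e)) -> wp (NPut a i e) s Q.
Proof. by move=> h; eexists 1%N, _; split; [constructor| |exact: h]. Qed.

Lemma wp_rput a i e s (Q : state R -> Prop) :
  Q (rput s a (neval s i) (reval s e)) -> wp (RPut a i e) s Q.
Proof. by move=> h; eexists 1%N, _; split; [constructor| |exact: h]. Qed.

Lemma wp_flip a i b l s (Q : state R -> Prop) : coins s = b :: l ->
  Q (State (update (nmem s) a (neval s i) (b : nat)) (rmem s) l) ->
  wp (Flip a i) s Q.
Proof.
by move=> hl h; eexists 1%N, _; split; [apply: ExecFlip hl| |exact: h].
Qed.

Lemma wp_seq c1 c2 s (Q : state R -> Prop) :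
  wp c1 s (fun s' => wp c2 s' Q) -> wp (Seq c1 c2) s Q.
Proof.
move=> [t1 [s1 [e1 l1 [t2 [s2 [e2 l2 h]]]]]].
by exists (t1 + t2)%N, s2; split=> //=; [apply: ExecSeq e1 e2|apply: leq_add].
Qed.

Lemma wp_if b c1 c2 s (Q : state R -> Prop) :
  wp (if teval s b then c1 else c2) s Q -> wp (If b c1 c2) s Q.
Proof.
move=> [t [s1 [e1 l1 h]]]; exists t.+1, s1; split=> //; first exact: ExecIf.
rewrite /= ltnS; apply: leq_trans l1 _.
by case: ifP => _; rewrite ?leq_addr ?leq_addl.
Qed.

Lemma wp_while b c s N (I : nat -> state R -> Prop) :
  (N <= Y)%N -> I 0%N s ->
  (forall j s1, (j < N)%N -> I j s1 -> same c s s1 ->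
     teval s1 b /\ wp c s1 (I j.+1)) ->
  (forall s1, I N s1 -> same c s s1 -> ~~ teval s1 b) ->
  wp (While b c) s (I N).
Proof.
move=> hN I0 hstep hstop.
suff H M j s1 : (j + M = N)%N -> I j s1 -> same c s s1 ->
    exists t s', [/\ exec (While b c) s1 t s', (t <= M * (cost Y c).+1 + 1)%N
                   & I N s'].
  have [t [s' [h1 h2 h3]]] := H N 0%N s erefl I0 (same_refl c s).
  exists t, s'; split=> //=; apply: leq_trans h2 _.
  by rewrite addn1 ltnS leq_mul2r hN orbT.
elim: M j s1 => [|M IH] j s1.
  rewrite addn0 => -> hI hs; exists 1%N, s1; split=> //.
  by apply: ExecWhileStop; apply: hstop.
move=> hj hI hs.
have [|ht [t1 [s2 [e2 l2 I2]]]] := hstep j s1 _ hI hs; first by lia.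
have [|t3 [s3 [e3 l3 I3]]] := IH j.+1 s2 _ I2 (same_trans hs (exec_same e2)).
  by lia.
exists (t1 + t3).+1, s3; split=> //; first exact: ExecWhileStep e2 e3.
by rewrite mulSn; lia.
Qed.

Lemma wp_for x a i body s n (I : nat -> state R -> Prop) :
  (n <= Y)%N -> nmem s a i = n -> a \notin x :: nmods body ->
  x \notin nmods body -> I 0%N (nput s x 0 0) ->
  (forall j s1, (j < n)%N -> I j s1 -> same (For x (a, i) body) s s1 ->
     nmem s1 x 0 = j ->
     wp body s1 (fun s2 => I j.+1 (nput s2 x 0 j.+1))) ->
  wp (For x (a, i) body) s (I n).
Proof.
move=> hn hs ha hx I0 hstep; apply: wp_seq; apply: wp_nput => /=.
set c := Seq body _.
have sub (s1 : state R) : same c (nput s x 0 0) s1 ->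
    same (For x (a, i) body) s s1.
  move=> h; apply: (@same_trans _ _ (nput s x 0 0)).
    by split=> //= b j; rewrite inE negb_or => /andP[h1 _]; apply: update_other.
  apply: same_sub h => [b hb|b|] //.
  by rewrite /= inE; apply/orP; right.
have bnd (s1 : state R) : same (For x (a, i) body) s s1 -> nmem s1 a i = n.
  move=> [h _ _]; rewrite h //= ; move: ha.
  move=> ha1; rewrite -cat_cons mem_cat negb_or ha1 /=.
  by move: ha1; rewrite !inE !negb_or => /andP[->].
apply: (@wp_impl _ _ (fun s1 => I n s1 /\ nmem s1 x 0 = n)); last by move=> ? _ [].
apply: (@wp_while _ _ _ _ (fun j s1 => I j s1 /\ nmem s1 x 0 = j)) => //.
- by split=> //=; rewrite updateE eqxx.
- move=> j s1 hj [hI hxj] /sub hs1; split.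
    by rewrite /= (bnd _ hs1) hxj addn1.
  apply: wp_seq; apply: wp_impl (hstep _ _ hj hI hs1 hxj) _ => s2 [h2 _ _] hI2.
  by apply: wp_nput; rewrite /= h2 // hxj addn1; split=> //=; rewrite updateE eqxx.
- by move=> s1 [_ hxn] /sub hs1; rewrite /= (bnd _ hs1) hxn addn1 ltnn.
Qed.

End WeakestPrecondition.

(** * The algorithm *)

Local Notation nzero := (NCst 0).
Local Notation nv a := (NGet a (NCst 0)).
Local Notation rv a := (RGet a (NCst 0)).
Local Notation cell r c := (NAdd (NGet 19 (NGet r (NCst 0))) (NGet c (NCst 0))).

Local Arguments update T m a i x b j /.

(* Array layout beyond the input and output arrays.
   Naturals: 3 coordinate, 4 and 5 vertices, 6 hyperedge, 7 vector, 8 shift,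
   9 and 10 end points of an interval of cell representatives, 11 threshold
   vertex; 12 candidate set, 13 its size, 14 and 15 sizes of e :&: S and e;
   16 m, 17 2^m, 18 length of the tables; tables 19 of multiples of |V| (row
   addresses), 20 of parities, 21 of halves; 22 coins, 23 bits of the shift,
   24 cell coordinates, 25 cell representatives, 26-29 scratch.
   Reals: 2 table of the naturals as reals, 3 norms nu, 4 projections,
   5 accumulator, 6 heights, 7 position, 8 volume, 9 cut, 10 best expansion,
   11 product of bumps. *)
Definition size_cmd : cmd :=
  Seq (NPut 13 nzero nzero)
      (For 4 (0%N, 0%N) (NPut 13 nzero (NAdd (nv 13) (NGet 12 (nv 4))))).

Definition edge_count_cmd : cmd :=
  For 4 (0%N, 0%N)
    (Seq (NPut 14 nzero (NAdd (nv 14)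
            (NSub (NAdd (NGet 1 (cell 6 4)) (NGet 12 (nv 4))) (NCst 1))))
         (NPut 15 nzero (NAdd (nv 15) (NGet 1 (cell 6 4))))).

Definition edge_cmd : cmd :=
  Seq (NPut 14 nzero nzero) (Seq (NPut 15 nzero nzero) (Seq edge_count_cmd
    (Seq (RPut 8 nzero (RAdd (rv 8) (RMul (RGet 0 (nv 6)) (RGet 2 (nv 14)))))
         (If (NLe (NCst 1) (nv 14))
            (If (NLe (NAdd (nv 14) (NCst 1)) (nv 15))
               (RPut 9 nzero (RAdd (rv 9) (RGet 0 (nv 6)))) Skip) Skip)))).

Definition cut_cmd : cmd :=
  Seq (RPut 8 nzero (RCst 0)) (Seq (RPut 9 nzero (RCst 0))
    (For 6 (0%N, 1%N) edge_cmd)).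

Definition record_cmd : cmd :=
  Seq (RPut 10 nzero (RDiv (rv 9) (rv 8)))
      (For 4 (0%N, 0%N) (NPut 2 (nv 4) (NGet 12 (nv 4)))).

Definition eval_cmd : cmd :=
  Seq size_cmd (Seq cut_cmd
    (If (NLe (NCst 1) (nv 13))
      (If (RLe (RMul (RGet 2 (nv 13)) (RGet 2 (NGet 0 (NCst 2))))
               (RMul (RCst 24) (RGet 2 (nv 0))))
        (If (RLe (RDiv (rv 9) (rv 8)) (rv 10)) record_cmd Skip)
        Skip) Skip)).

Section Spec.
Variables (R : realType) (n E k : nat).
Variables (inc : nat -> nat -> bool) (wt : nat -> R) (F : nat -> nat -> R).

Let q := up_log 2 (16 * k).
Let m := (4 * q)%N.
Let P := (2 ^ m)%N.
Let L := (n + E + P)%N.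

Record env (s : state R) : Prop := Env {
  env_n : nmem s 0 0 = n;
  env_E : nmem s 0 1 = E;
  env_k : nmem s 0 2 = k;
  env_inc : forall e v, (e < E)%N -> (v < n)%N ->
    nmem s 1 (e * n + v) = inc e v;
  env_wt : forall e, (e < E)%N -> rmem s 0 e = wt e;
  env_F : forall i v, (i < k)%N -> (v < n)%N -> rmem s 1 (i * n + v) = F i v;
  env_m : nmem s 16 0 = m;
  env_P : nmem s 17 0 = P;
  env_real : forall j, (j <= L)%N -> rmem s 2 j = j%:R;
  env_row : forall j, (j <= L)%N -> nmem s 19 j = (j * n)%N;
  env_odd : forall j, (j <= L)%N -> nmem s 20 j = odd j;
  env_half : forall j, (j <= L)%N -> nmem s 21 j = j./2 }.

Definition stat_n := [:: 0; 1; 16; 17; 19; 20; 21]%N.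
Definition stat_r := [:: 0; 1; 2]%N.

Lemma env_ext s s' :
  (forall a i, a \in stat_n -> nmem s' a i = nmem s a i) ->
  (forall a i, a \in stat_r -> rmem s' a i = rmem s a i) ->
  env s -> env s'.
Proof.
move=> hn hr [e1 e2 e3 e4 e5 e6 e7 e8 e9 e10 e11 e12].
by split=> *; rewrite ?hn ?hr //; eauto.
Qed.

Lemma env_same c s s' : same c s s' ->
  all (fun a => a \notin nmods c) stat_n && all (fun a => a \notin rmods c) stat_r ->
  env s -> env s'.
Proof.
move=> [hn hr _] /andP[/allP an /allP ar]; apply: env_ext => a i ha.
  by rewrite hn ?an.
by rewrite hr ?ar.
Qed.

Lemma env_nput s a i x : a \notin stat_n -> env s -> env (nput s a i x).
Proof.
move=> ha; apply: env_ext => // b j hb /=; apply: update_other.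
by apply: contraNneq ha => <-.
Qed.

Lemma env_rput s a i x : a \notin stat_r -> env s -> env (rput s a i x).
Proof.
move=> ha; apply: env_ext => // b j hb /=; apply: update_other.
by apply: contraNneq ha => <-.
Qed.

Definition sizef (S : nat -> bool) : nat := (\sum_(0 <= v < n) S v)%N.
Definition degf (e : nat) : nat := (\sum_(0 <= v < n) inc e v)%N.
Definition hitf (S : nat -> bool) (e : nat) : nat :=
  (\sum_(0 <= v < n) (inc e v && S v))%N.
Definition volf (S : nat -> bool) : R :=
  \sum_(0 <= e < E) wt e * (hitf S e)%:R.
Definition cutf (S : nat -> bool) : R :=
  \sum_(0 <= e < E) if (0 < hitf S e < degf e)%N then wt e else 0.
Definition phif (S : nat -> bool) : R := cutf S / volf S.
Definition validf (S : nat -> bool) : bool :=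
  (0 < sizef S)%N && ((sizef S)%:R * k%:R <= 24 * n%:R :> R).

Definition best (s : state R) : R := rmem s 10 0.

Definition out (s : state R) : Prop :=
  (exists S : nat -> bool, [/\ forall v, (v < n)%N -> nmem s 2 v = S v,
     validf S & best s = phif S])
  \/ ((forall v, (v < n)%N -> nmem s 2 v = 0%N) /\ best s = 2).

Lemma out_same c s s' : same c s s' -> (2 \notin nmods c)%N ->
  (10 \notin rmods c)%N -> out s -> out s' /\ best s' = best s.
Proof.
move=> [hn hr _] h2 h10.
have hb : best s' = best s by rewrite /best hr.
move=> [[S [h1 h3 h4]]|[h1 h3]]; split=> //; [left; exists S|right];
  split=> //; rewrite ?hb // => v hv; by rewrite hn // h1.
Qed.

Variable Y : nat.
Hypothesis hY : (L <= Y)%N.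

Lemma leqLn : (n <= L)%N. Proof. by rewrite /L -addnA leq_addr. Qed.
Lemma leqLE : (E <= L)%N. Proof. by rewrite /L addnAC leq_addl. Qed.
Lemma leqLP : (P <= L)%N. Proof. by rewrite /L leq_addl. Qed.
Lemma leqPm : (m < P)%N. Proof. exact: ltn_expl. Qed.
Lemma leqPk : (k <= P)%N.
Proof.
apply: (@leq_trans (2 ^ q)); last by rewrite leq_exp2l // /m leq_pmull.
by apply: leq_trans (up_logP _ _) => //; rewrite leq_pmull.
Qed.

Lemma size_spec s (S : nat -> bool) : env s -> (forall v, (v < n)%N -> nmem s 12 v = S v) ->
  wp Y size_cmd s (fun s' => nmem s' 13 0 = sizef S).
Proof.
move=> es hS; apply: wp_seq; apply: wp_nput => /=.
have es0 := @env_nput s 13 0 0 erefl es.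
apply: (@wp_for R Y 4 0 0 _ _ n
  (fun j s1 => nmem s1 13 0 = (\sum_(0 <= v < j) S v)%N)) => //=.
- exact: leq_trans leqLn hY.
- exact: env_n es0.
- by rewrite big_geq.
- move=> j s1 hj hI hs hx; apply: wp_nput => /=.
  have hS1 : nmem s1 12 j = S j by case: hs => [-> // _ _]; exact: hS.
  by rewrite ?updateE ?eqxx hx hS1 hI big_nat_recr.
Qed.

Lemma row_lt e : (e < E)%N -> (e <= L)%N.
Proof. by move=> he; apply: leq_trans leqLE; apply: ltnW. Qed.

Lemma edge_count_spec s (S : nat -> bool) e : env s ->
  (forall v, (v < n)%N -> nmem s 12 v = S v) -> (e < E)%N -> nmem s 6 0 = e ->
  nmem s 14 0 = 0%N -> nmem s 15 0 = 0%N ->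
  wp Y edge_count_cmd s
    (fun s' => nmem s' 14 0 = hitf S e /\ nmem s' 15 0 = degf e).
Proof.
move=> es hS he h6 h14 h15.
apply: (@wp_for R Y 4 0 0 _ _ n
  (fun j s1 => nmem s1 14 0 = (\sum_(0 <= v < j) (inc e v && S v))%N /\
               nmem s1 15 0 = (\sum_(0 <= v < j) inc e v)%N)) => //=.
- exact: leq_trans leqLn hY.
- exact: env_n es.
- by rewrite !big_geq.
- move=> j s1 hj [hI1 hI2] hs hx.
  have es1 := env_same hs erefl es.
  have hS1 : nmem s1 12 j = S j by case: hs => [-> // _ _]; exact: hS.
  have h61 : nmem s1 6 0 = e by case: hs => [-> //= _ _].
  have hc : nmem s1 1 (nmem s1 19 (nmem s1 6 0) + nmem s1 4 0) = inc e j.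
    by rewrite h61 hx (env_row es1) ?(row_lt he) // (env_inc es1).
  apply: wp_seq; apply: wp_nput; apply: wp_nput => /=.
  rewrite hc hx hS1 hI1 hI2 !big_nat_recr //=.
  by case: (inc e j); case: (S j).
Qed.

Lemma hitf_le (S : nat -> bool) e : (hitf S e <= n)%N.
Proof.
rewrite /hitf -[X in (_ <= X)%N]subn0 -[X in (_ <= X)%N]muln1 -sum_nat_const_nat.
by apply: leq_sum => v _; case: (_ && _).
Qed.

Lemma sizef_le (S : nat -> bool) : (sizef S <= n)%N.
Proof.
rewrite /sizef -[X in (_ <= X)%N]subn0 -[X in (_ <= X)%N]muln1 -sum_nat_const_nat.
by apply: leq_sum => v _; case: (S v).
Qed.

Lemma cut_spec s (S : nat -> bool) : env s ->
  (forall v, (v < n)%N -> nmem s 12 v = S v) ->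
  wp Y cut_cmd s (fun s' => rmem s' 8 0 = volf S /\ rmem s' 9 0 = cutf S).
Proof.
move=> es hS; do 2!(apply: wp_seq; apply: wp_rput => /=).
have es0 : env (rput (rput s 8 0 0) 9 0 0) by apply: env_rput => //; apply: env_rput.
apply: (@wp_for R Y 6 0 1 _ _ E
  (fun j s1 => rmem s1 8 0 = \sum_(0 <= e < j) wt e * (hitf S e)%:R /\
     rmem s1 9 0 = \sum_(0 <= e < j)
       if (0 < hitf S e < degf e)%N then wt e else 0)) => //=.
- exact: leq_trans leqLE hY.
- exact: env_E es0.
- by rewrite !big_geq.
- move=> j s1 hj [hI1 hI2] hs hx.
  have es1 := env_same hs erefl es0.
  have hS1 v : (v < n)%N -> nmem s1 12 v = S v.
    by case: hs => [-> // _ _]; exact: hS.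
  do 2!(apply: wp_seq; apply: wp_nput => /=).
  set s2 := nput _ 15 0 0.
  have es2 : env s2 by apply: env_nput => //; apply: env_nput.
  apply: wp_seq; apply: wp_impl (@edge_count_spec s2 S j es2 _ hj _ _ _) _ => //.
  move=> s3 hs3 [h14 h15].
  have es3 := env_same hs3 erefl es2.
  have [n3 r3 _] := hs3.
  have h6 : nmem s3 6 0 = j by rewrite n3.
  have h8 : rmem s3 8 0 = \sum_(0 <= e < j) wt e * (hitf S e)%:R by rewrite r3.
  have h9 : rmem s3 9 0 = \sum_(0 <= e < j)
      if (0 < hitf S e < degf e)%N then wt e else 0 by rewrite r3.
  have hw : rmem s3 0 j = wt j by rewrite (env_wt es3).
  have hr : rmem s3 2 (hitf S j) = (hitf S j)%:R.
    by rewrite (env_real es3) // (leq_trans (hitf_le _ _) leqLn).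
  apply: wp_seq; apply: wp_rput => /=.
  apply: wp_if; rewrite /= h14; case: ifP => hh; last first.
    by apply: wp_skip => /=; rewrite !big_nat_recr //= h8 h9 h6 hw hr hh addr0.
  apply: wp_if; rewrite /= h14 h15 addn1; case: ifP => hh2.
    by apply: wp_rput => /=; rewrite !big_nat_recr //= h8 h9 h6 hw hr hh hh2.
  by apply: wp_skip => /=; rewrite !big_nat_recr //= h8 h9 h6 hw hr hh hh2 addr0.
Qed.

Lemma record_spec s (S : nat -> bool) : env s ->
  (forall v, (v < n)%N -> nmem s 12 v = S v) ->
  rmem s 8 0 = volf S -> rmem s 9 0 = cutf S -> validf S ->
  wp Y record_cmd s (fun s' => out s' /\ best s' = phif S).
Proof.
move=> es hS h8 h9 hv; apply: wp_seq; apply: wp_rput => /=.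
have es0 : env (rput s 10 0 (rmem s 9 0 / rmem s 8 0)) by apply: env_rput.
apply: (@wp_impl _ _ _ _ (fun s1 =>
   (forall v, (v < n)%N -> nmem s1 2 v = S v) /\ best s1 = phif S)); last first.
  by move=> s' _ [h1 h2]; split=> //; left; exists S.
apply: (@wp_for R Y 4 0 0 _ _ n
  (fun j s1 => (forall v, (v < j)%N -> nmem s1 2 v = S v) /\ best s1 = phif S))
  => //=.
- exact: leq_trans leqLn hY.
- exact: env_n es0.
- by split=> //; rewrite /best /= ?updateE ?eqxx h8 h9.
- move=> j s1 hj [hI1 hI2] hs hx; apply: wp_nput => /=; split=> // v.
  have hS1 : nmem s1 12 j = S j by case: hs => [-> // _ _]; exact: hS.
  rewrite ltnS leq_eqVlt hx hS1 ?update_other // ?updateE.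
  by case: eqP => [-> //|_ /= /hI1].
Qed.

Lemma eval_spec s (S : nat -> bool) : env s ->
  (forall v, (v < n)%N -> nmem s 12 v = S v) -> out s ->
  wp Y eval_cmd s (fun s' => [/\ out s', best s' <= best s &
    validf S -> best s' <= phif S]).
Proof.
move=> es hS os.
apply: wp_seq; apply: wp_impl (size_spec es hS) _ => s1 hs1 h13.
have es1 := env_same hs1 erefl es.
have hS1 v : (v < n)%N -> nmem s1 12 v = S v.
  by case: hs1 => [-> //= _ _]; apply: hS.
have [os1 b1] := out_same hs1 erefl erefl os.
apply: wp_seq; apply: wp_impl (cut_spec es1 hS1) _ => s2 hs2 [h8 h9].
have es2 := env_same hs2 erefl es1.
have hS2 v : (v < n)%N -> nmem s2 12 v = S v.
  by case: hs2 => [-> //= _ _]; apply: hS1.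
have [os2 b2] := out_same hs2 erefl erefl os1.
have h132 : nmem s2 13 0 = sizef S by case: hs2 => [-> //= _ _].
apply: wp_if; rewrite /= h132; case: ifP => c1; last first.
  by apply: wp_skip; split=> //; rewrite ?b2 ?b1 // /validf c1.
apply: wp_if; rewrite /= h132 (env_k es2) (env_n es2) !(env_real es2) ?leqLn //;
  try by rewrite ?(leq_trans leqPk leqLP) ?(leq_trans (sizef_le _) leqLn).
case: ifP => c2; last first.
  by apply: wp_skip; split=> //; rewrite ?b2 ?b1 // /validf c2 andbF.
have hv : validf S by rewrite /validf c1 c2.
apply: wp_if; rewrite /= h8 h9 -/(best s2) -/(phif S); case: ifP => c3; last first.
  apply: wp_skip; split=> //; rewrite ?b2 ?b1 //= => _.
  by move/negbT: c3; rewrite -ltNge b2 b1 => /ltW.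
apply: wp_impl (record_spec es2 hS2 h8 h9 hv) _ => s3 _ [o3 b3].
by split=> //; rewrite b3 // -b1 -b2.
Qed.

End Spec.

Definition floor_cmd : cmd :=
  While (RLe (RCst 1) (rv 7))
    (Seq (RPut 7 nzero (RSub (rv 7) (RCst 1))) (NPut 27 nzero (NAdd (nv 27) (NCst 1)))).

Definition coord_cmd (be ee : rexpr) : cmd :=
  Seq (RPut 7 nzero (RAdd (RAdd (RAdd (RMul (RCst 2) (RGet 4 (cell 3 4)))
          (RMul (RCst 2) (RGet 2 (NGet 0 (NCst 2))))) (RCst 1)) be))
  (Seq (NPut 27 nzero nzero) (Seq floor_cmd
  (Seq (NPut 24 (cell 3 4) (nv 27)) (RPut 11 nzero (RMul (rv 11) ee))))).

Definition bump_cmd (be ee : rexpr) : cmd :=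
  For 4 (0%N, 0%N)
    (Seq (RPut 11 nzero (RCst 1)) (Seq (For 3 (16, 0)%N (coord_cmd be ee))
      (RPut 6 (nv 4) (RMul (RGet 3 (nv 4)) (rv 11))))).

Definition mismatch_cmd : cmd :=
  For 3 (16, 0)%N (NPut 26 nzero (NAdd (nv 26)
     (NAdd (NSub (NGet 24 (cell 3 5)) (NGet 24 (cell 3 4)))
           (NSub (NGet 24 (cell 3 4)) (NGet 24 (cell 3 5)))))).

Definition rep_cmd : cmd :=
  For 4 (0%N, 0%N)
    (Seq (NPut 25 (nv 4) (nv 4)) (For 5 (0%N, 0%N)
      (Seq (NPut 26 nzero nzero) (Seq mismatch_cmd
        (If (NLe (nv 26) nzero)
           (NPut 25 (nv 4)
              (NSub (NGet 25 (nv 4)) (NSub (NGet 25 (nv 4)) (nv 5)))) Skip))))).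

Definition member_cmd : cmd :=
  For 4 (0%N, 0%N)
    (If (NLe (nv 9) (NGet 25 (nv 4)))
      (If (NLe (NGet 25 (nv 4)) (nv 10))
        (If (RLe (RGet 6 (nv 11)) (RGet 6 (nv 4)))
           (NPut 12 (nv 4) (NCst 1)) (NPut 12 (nv 4) nzero))
        (NPut 12 (nv 4) nzero)) (NPut 12 (nv 4) nzero)).

Definition sweep_cmd : cmd :=
  For 9 (0%N, 0%N) (For 10 (0%N, 0%N) (For 11 (0%N, 0%N)
    (Seq member_cmd eval_cmd))).

Definition round_cmd (be ee : rexpr) : cmd :=
  Seq (bump_cmd be ee) (Seq rep_cmd sweep_cmd).

Lemma addnM_inj n i i' v v' : (v < n)%N -> (v' < n)%N ->
  (i * n + v == i' * n + v')%N = (i == i') && (v == v').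
Proof.
move=> hv hv'; apply/eqP/andP => [h|[/eqP-> /eqP->]] //.
have hn : (0 < n)%N by apply: leq_ltn_trans hv.
have := congr1 (modn^~ n) h; rewrite /= !modnMDl !modn_small // => hvv.
by move: h; rewrite hvv => /addIn /eqP; rewrite eqn_pmul2r.
Qed.

Section Round.
Variables (R : realType) (n E k : nat).
Variables (inc : nat -> nat -> bool) (wt : nat -> R) (F : nat -> nat -> R).
Let q := up_log 2 (16 * k).
Let m := (4 * q)%N.
Let P := (2 ^ m)%N.
Let L := (n + E + P)%N.
Variables (nf : nat -> R) (X : nat -> nat -> R).
Hypothesis k_gt0 : (0 < k)%N.
Hypothesis X_le : forall i v, (i < m)%N -> (v < n)%N -> `|X i v| <= k%:R.
Variable Y : nat.
Hypothesis hY : (L <= Y)%N.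

Local Notation env := (env n E k inc wt F).
Local Notation out := (out n E k inc wt).

Record env2 (s : state R) : Prop := Env2 {
  env2_env : env s;
  env2_nf : forall v, (v < n)%N -> rmem s 3 v = nf v;
  env2_X : forall i v, (i < m)%N -> (v < n)%N -> rmem s 4 (i * n + v) = X i v }.

Definition stat2_r := 3%N :: 4%N :: stat_r.

Lemma env2_same c s s' : same c s s' ->
  all (fun a => a \notin nmods c) stat_n && all (fun a => a \notin rmods c) stat2_r ->
  env2 s -> env2 s'.
Proof.
move=> hs /andP[hn] /= /and3P[h3 h4 hr] [e1 e2 e3].
have [_ r1 _] := hs; split.
- by apply: env_same hs _ e1; apply/andP; split; [exact: hn|exact: hr].
- by move=> v hv; rewrite r1 // e2.
- by move=> i v hi hv; rewrite r1 // e3.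
Qed.

Variables (bt : nat -> bool) (j0 : nat).

Record env3 (s : state R) : Prop := Env3 {
  env3_env2 : env2 s;
  env3_bit : forall i, (i < m)%N -> nmem s 23 i = bt i;
  env3_j : nmem s 8 0 = j0 }.

Definition stat3_n := 8%N :: 23%N :: stat_n.

Lemma env3_same c s s' : same c s s' ->
  all (fun a => a \notin nmods c) stat3_n && all (fun a => a \notin rmods c) stat2_r ->
  env3 s -> env3 s'.
Proof.
move=> hs /andP[] /= /and3P[h8 h23 hn] hr [e1 e2 e3].
have [n1 _ _] := hs; split.
- by apply: env2_same hs _ e1; apply/andP; split; [exact: hn|exact: hr].
- by move=> i hi; rewrite n1 // e2.
- by rewrite n1.
Qed.

Lemma env3_nput s a i x : a \notin stat3_n -> env3 s -> env3 (nput s a i x).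
Proof.
move=> ha; apply: (@env3_same (NPut a nzero nzero)).
  split=> //= b j; rewrite inE => hb; exact: update_other.
by apply/andP; split=> //; apply/allP => b hb; rewrite /= inE;
  apply: contraNneq ha => <-.
Qed.

Lemma env3_rput s a i x : a \notin stat2_r -> env3 s -> env3 (rput s a i x).
Proof.
move=> ha; apply: (@env3_same (RPut a nzero (RCst 0))).
  split=> //= b j; rewrite inE => hb; exact: update_other.
by apply/andP; split=> //; apply/allP => b hb; rewrite /= inE;
  apply: contraNneq ha => <-.
Qed.

Variables (be ee : rexpr) (b : nat -> R) (eta : R -> R).
Hypothesis beE : forall s i, env3 s -> (i < m)%N -> nmem s 3 0 = i ->
  reval s be = b i.
Hypothesis b01 : forall i, 0 <= b i <= 1.
Hypothesis eeE : forall s, env3 s -> reval s ee = eta (rmem s 7 0).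

Definition pos i v : R := 2 * X i v + 2 * k%:R + 1 + b i.
Definition fpart (x : R) : R := x - (Num.truncn x)%:R.
Definition idx i v : nat := Num.truncn (pos i v).
Definition hval v : R := nf v * \prod_(0 <= i < m) eta (fpart (pos i v)).

Lemma leq_mP : (m <= L)%N.
Proof. by apply: leq_trans (leqLP _ _ _); apply: ltnW; apply: leqPm. Qed.

Lemma pos_ge0 i v : (i < m)%N -> (v < n)%N -> 1 <= pos i v.
Proof.
move=> hi hv; have := X_le hi hv; have := b01 i; rewrite ler_norml /pos.
by move=> /andP[h1 h2] /andP[h3 h4]; lra.
Qed.

Lemma idx_le i v : (i < m)%N -> (v < n)%N -> (idx i v <= Y)%N.
Proof.
move=> hi hv; apply: (@leq_trans (4 * k + 2)).
  rewrite /idx truncn_le_nat /pos.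
  have := X_le hi hv; have := b01 i; rewrite ler_norml.
  move=> /andP[h1 h2] /andP[h3 h4].
  by rewrite -addnS natrD natrM; lra.
apply: leq_trans hY; apply: leq_trans (leqLP _ _ _).
apply: (@leq_trans (16 * k)); first by lia.
apply: (@leq_trans (2 ^ q)); first exact: up_logP.
by rewrite /P leq_exp2l // /m leq_pmull.
Qed.

Lemma floor_spec s x : 0 <= x -> (Num.truncn x <= Y)%N ->
  rmem s 7 0 = x -> nmem s 27 0 = 0%N ->
  wp Y floor_cmd s
    (fun s' => rmem s' 7 0 = fpart x /\ nmem s' 27 0 = Num.truncn x).
Proof.
move=> x0 hx h7 h27; have /andP[t1 t2] := truncn_itv x0.
apply: (@wp_while R Y _ _ _ _
  (fun j s1 => rmem s1 7 0 = x - j%:R /\ nmem s1 27 0 = j)) => //.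
- by rewrite subr0.
- move=> j s1 hj [h1 h2] hs; split.
    rewrite /= h1 lerBrDl.
    by apply: le_trans t1; rewrite -natrD addn1 ler_nat.
  apply: wp_seq; apply: wp_rput; apply: wp_nput => /=.
  by rewrite h1 h2 -[j.+1]addn1 natrD opprD addrA.
- move=> s1 [h1 h2] hs; rewrite /= h1 -ltNge ltrBlDl.
  by rewrite -natrD addn1.
Qed.

Definition bumped (M : nat) (s : state R) : Prop :=
  (forall v, (v < M)%N -> rmem s 6 v = hval v) /\
  (forall i v, (i < m)%N -> (v < M)%N -> nmem s 24 (i * n + v) = idx i v).

Lemma bump_spec s : env3 s -> wp Y (bump_cmd be ee) s (bumped n).
Proof.
move=> es; apply: (@wp_for R Y 4 0 0 _ _ n bumped) => //=.
- exact: leq_trans (leqLn _ _ _) hY.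
- exact: env_n (env2_env (env3_env2 es)).
move=> v s1 hv [hI1 hI2] hs hx.
have es1 := env3_same hs erefl es.
apply: wp_seq; apply: wp_rput => /=.
have es2 : env3 (rput s1 11 0 1) by apply: env3_rput.
move: es2; set s2 := rput _ _ _ _ => es2.
apply: wp_seq; apply: (@wp_impl _ _ _ _ (fun s3 =>
  [/\ rmem s3 11 0 = \prod_(0 <= i < m) eta (fpart (pos i v)),
      forall v', (v' < v)%N -> rmem s3 6 v' = hval v'
    & forall i v', (i < m)%N -> (v' <= v)%N ->
        nmem s3 24 (i * n + v') = idx i v'])); last first.
  move=> s3 hs3 [h1 h2 h3].
  have es3 := env3_same hs3 erefl es2.
  have h4 : nmem s3 4 0 = v by case: hs3 => [-> // _ _].
  apply: wp_rput => /=; split=> [v'|i v' hi hv'] /=; last exact: h3.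
  rewrite ltnS leq_eqVlt h4; case: eqP => [-> _|_ /= /h2 //].
  by rewrite /= h1 (env2_nf (env3_env2 es3)).
apply: (@wp_impl _ _ _ _ (fun s3 =>
  [/\ rmem s3 11 0 = \prod_(0 <= i < m) eta (fpart (pos i v)),
      forall v', (v' < v)%N -> rmem s3 6 v' = hval v'
    & forall i v', (i < m)%N -> (v' < v)%N || (i < m)%N && (v' == v) ->
        nmem s3 24 (i * n + v') = idx i v'])); last first.
  move=> s3 _ [h1 h2 h3]; split=> // i v' hi hv'; apply: h3 => //.
  by rewrite hi orbC -leq_eqVlt.
apply: (@wp_for R Y 3 16 0 _ _ m (fun i0 s3 =>
  [/\ rmem s3 11 0 = \prod_(0 <= i < i0) eta (fpart (pos i v)),
      forall v', (v' < v)%N -> rmem s3 6 v' = hval v'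
    & forall i v', (i < m)%N -> (v' < v)%N || (i < i0)%N && (v' == v) ->
        nmem s3 24 (i * n + v') = idx i v'])) => //=.
- exact: leq_trans leq_mP hY.
- exact: env_m (env2_env (env3_env2 es2)).
- split=> //=; first by rewrite big_geq.
  by move=> i v' hi; rewrite orbF => hv'; apply: hI2.
move=> i s3 hi [hJ1 hJ2 hJ3] hs3 h3i.
have es3 := env3_same hs3 erefl es2.
have h4 : nmem s3 4 0 = v by case: hs3 => [-> // _ _].
have ev := env2_env (env3_env2 es3).
have row : nmem s3 19 i = (i * n)%N.
  by rewrite (env_row ev) //; apply: leq_trans leq_mP; apply: ltnW.
have hX : rmem s3 4 (i * n + v) = X i v by rewrite (env2_X (env3_env2 es3)).
apply: wp_seq; apply: wp_rput => /=.
rewrite h3i h4 row hX (env_k ev) (env_real ev); last first.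
  exact: leq_trans (leqPk _) (leqLP _ _ _).
rewrite (beE es3 hi h3i) -/(pos i v).
apply: wp_seq; apply: wp_nput => /=.
have h1 := pos_ge0 hi hv.
apply: wp_seq; set s4 := nput _ 27 _ _.
have es4 : env3 s4 by apply: env3_nput => //; apply: env3_rput.
apply: wp_impl (@floor_spec s4 (pos i v) _ (idx_le hi hv) erefl erefl) _.
  by apply: le_trans h1.
move=> s5 hs5 [h7 h27].
have es5 := env3_same hs5 erefl es4.
have h45 : nmem s5 4 0 = v by case: hs5 => [-> // _ _].
have h35 : nmem s5 3 0 = i by case: hs5 => [-> // _ _].
have row5 : nmem s5 19 i = (i * n)%N by case: hs5 => [-> // _ _].
apply: wp_seq; apply: wp_nput => /=.
rewrite h35 row5 h45 h27.
set s6 := nput _ _ _ _.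
have es6 : env3 s6 by apply: env3_nput.
apply: wp_rput => /=; rewrite (eeE es6) /= h7; split=> /=.
- by case: (hs5) => [_ -> // _]; rewrite big_nat_recr //=; congr (_ * _).
- by move=> v' hv'; case: (hs5) => [_ -> // _]; apply: hJ2.
- move=> i' v' hi' hh.
  have hv' : (v' < n)%N.
    by case/orP: hh => [h|/andP[_ /eqP->] //]; apply: ltn_trans hv.
  rewrite addnM_inj //; case: eqP => [->|ne] /=; first case: eqP => [-> //|ne'] /=.
    case: (hs5) => [-> // _ _]; apply: hJ3 => //.
    by move: hh => /orP[->//|/andP[_ /eqP]].
  case: (hs5) => [-> // _ _]; apply: hJ3 => //.
  move: hh => /orP[->//|/andP[h ->]]; rewrite andbT.
  by move: h; rewrite ltnS leq_eqVlt => /orP[/eqP|->]; rewrite ?orbT.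
Qed.

Definition eqv u v : bool := all (fun i => idx i u == idx i v) (iota 0 m).
Definition repf v : nat := find (fun u => eqv u v) (iota 0 n).
Definition isrep M r v : Prop :=
  [/\ (r < n)%N, eqv r v & forall u, (u < M)%N -> eqv u v -> (r <= u)%N].

Lemma eqvP u v : reflect (forall i, (i < m)%N -> idx i u = idx i v) (eqv u v).
Proof.
apply: (iffP allP) => h i; first by move=> hi; apply/eqP/h; rewrite mem_iota.
by rewrite mem_iota => /andP[_]; rewrite add0n => hi; apply/eqP/h.
Qed.

Lemma eqv_refl v : eqv v v. Proof. by apply/eqvP. Qed.

Lemma isrepE r v : isrep n r v -> r = repf v.
Proof.
move=> [hr hrv hmin].
have hh : has (fun u => eqv u v) (iota 0 n).
  by apply/hasP; exists r; rewrite ?mem_iota.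
have hf : (repf v < n)%N by rewrite -[X in (_ < X)%N](size_iota 0) -has_find.
have h2 := nth_find 0%N hh; rewrite nth_iota // add0n in h2.
apply/eqP; rewrite eqn_leq hmin //= leqNgt; apply/negP => hlt.
by have := before_find 0%N hlt; rewrite nth_iota // add0n hrv.
Qed.

Lemma repfP v : (v < n)%N -> isrep n (repf v) v.
Proof.
move=> hv.
have hh : has (fun u => eqv u v) (iota 0 n).
  by apply/hasP; exists v; rewrite ?mem_iota ?eqv_refl.
have hf : (repf v < n)%N by rewrite -[X in (_ < X)%N](size_iota 0) -has_find.
have h2 := nth_find 0%N hh; rewrite nth_iota // add0n in h2.
split=> // u hu huv; rewrite leqNgt; apply/negP => hlt.
by have := before_find 0%N hlt; rewrite nth_iota // add0n huv.
Qed.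

Lemma mismatch_spec s u v : env3 s -> bumped n s -> (u < n)%N -> (v < n)%N ->
  nmem s 5 0 = u -> nmem s 4 0 = v -> nmem s 26 0 = 0%N ->
  wp Y mismatch_cmd s (fun s' => (nmem s' 26 0 == 0%N) = eqv u v).
Proof.
move=> es [_ hI] hu hv h5 h4 h26.
apply: (@wp_for R Y 3 16 0 _ _ m (fun i0 s1 =>
  (nmem s1 26 0 == 0%N) = all (fun i => idx i u == idx i v) (iota 0 i0))) => //.
- exact: leq_trans leq_mP hY.
- exact: env_m (env2_env (env3_env2 es)).
- by rewrite /= h26.
move=> i s1 hi hJ hs h3.
have es1 := env3_same hs erefl es.
have ev := env2_env (env3_env2 es1).
have row : nmem s1 19 i = (i * n)%N.
  by rewrite (env_row ev) //; apply: leq_trans leq_mP; apply: ltnW.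
have h51 : nmem s1 5 0 = u by case: hs => [-> // _ _].
have h41 : nmem s1 4 0 = v by case: hs => [-> // _ _].
have iu : nmem s1 24 (i * n + u) = idx i u by case: hs => [-> // _ _]; rewrite hI.
have iv : nmem s1 24 (i * n + v) = idx i v by case: hs => [-> // _ _]; rewrite hI.
have hE : all (fun i => idx i u == idx i v) (iota 0 i.+1) =
    (nmem s1 26 0 == 0%N) && (idx i u == idx i v).
  by rewrite -[i.+1]addn1 iotaD all_cat -hJ /= andbT add0n.
apply: wp_nput; cbv beta; rewrite hE /= h3 row h51 h41 iu iv.
by lia.
Qed.

Lemma rep_spec s : env3 s -> bumped n s ->
  wp Y rep_cmd s (fun s' => forall v, (v < n)%N -> nmem s' 25 v = repf v).
Proof.
move=> es bs; apply: (@wp_for R Y 4 0 0 _ _ n (fun j s1 =>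
   forall v, (v < j)%N -> nmem s1 25 v = repf v)) => //=.
- exact: leq_trans (leqLn _ _ _) hY.
- exact: env_n (env2_env (env3_env2 es)).
move=> v s1 hv hI hs h4; have es1 := env3_same hs erefl es.
have bs1 : bumped n s1.
  have [b1 b2] := bs; case: hs => [n1 r1 _]; split=> [u hu|i u hi hu].
    by rewrite r1 //; exact: b1.
  by rewrite n1 //; exact: b2.
apply: wp_seq; apply: wp_nput => /=; rewrite h4.
set s2 := nput _ _ _ _; have es2 : env3 s2 by apply: env3_nput.
apply: (@wp_impl _ _ _ _ (fun s3 => isrep n (nmem s3 25 v) v /\
    forall v', (v' < v)%N -> nmem s3 25 v' = repf v')); last first.
  move=> s3 _ [h1 h2] v' /=; rewrite ltnS leq_eqVlt.
  by case: eqP => [-> _|_ /= /h2 //]; apply: isrepE.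
apply: (@wp_for R Y 5 0 0 _ _ n (fun j s3 => isrep j (nmem s3 25 v) v /\
    forall v', (v' < v)%N -> nmem s3 25 v' = repf v')) => //=.
- exact: leq_trans (leqLn _ _ _) hY.
- exact: env_n (env2_env (env3_env2 es2)).
- rewrite eqxx; split; first by split=> //; apply: eqv_refl.
  by move=> v' hv'; rewrite (ltn_eqF hv') hI.
move=> u s3 hu [hJ1 hJ2] hs3 h5; have es3 := env3_same hs3 erefl es2.
have h43 : nmem s3 4 0 = v by case: hs3 => [-> // _ _].
have bs3 : bumped n s3.
  have [b1 b2] := bs1; case: hs3 => [n1 r1 _]; split=> [u' hu'|i u' hi hu'].
    by rewrite r1 //; exact: b1.
  by rewrite n1 //; exact: b2.
apply: wp_seq; apply: wp_nput => /=.
set s4 := nput s3 26 0 0; have es4 : env3 s4 by apply: env3_nput.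
apply: wp_seq; apply: wp_impl (@mismatch_spec s4 u v es4 bs3 hu hv h5 h43 erefl) _.
move=> s5 hs5 h26.
have h25 w : nmem s5 25 w = nmem s3 25 w by case: hs5 => [-> // _ _].
have h45 : nmem s5 4 0 = v by case: hs5 => [-> // _ _].
have h55 : nmem s5 5 0 = u by case: hs5 => [-> // _ _].
have [r1 r2 r3] := hJ1.
apply: wp_if; rewrite /= leqn0 h26; case: ifP => huv.
  apply: wp_nput => /=; rewrite h45 h55 eqxx !h25; split; last first.
    by move=> v' hv'; rewrite (ltn_eqF hv') h25 hJ2.
  set r := nmem s3 25 v; have -> : (r - (r - u) = minn r u)%N by lia.
  split; first by rewrite gtn_min hu orbT.
    by rewrite /minn; case: ifP.
  move=> w; rewrite ltnS leq_eqVlt geq_min; case: eqP => [-> _ _|_ /= hw /r3 -> //].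
  by rewrite leqnn orbT.
apply: wp_skip => /=; rewrite h25; split; last by move=> v' hv'; rewrite h25 hJ2.
split=> // w; rewrite ltnS leq_eqVlt; case: eqP => [->|_ /= hw]; last exact: r3.
by rewrite huv.
Qed.

Definition cand (p q' c v : nat) : bool :=
  [&& (p <= repf v)%N, (repf v <= q')%N & hval c <= hval v].

Definition swept (s : state R) : Prop :=
  (forall v, (v < n)%N -> rmem s 6 v = hval v) /\
  (forall v, (v < n)%N -> nmem s 25 v = repf v).

Lemma member_spec s p q' c : env3 s -> swept s -> (c < n)%N ->
  nmem s 9 0 = p -> nmem s 10 0 = q' -> nmem s 11 0 = c ->
  wp Y member_cmd s (fun s' => forall v, (v < n)%N -> nmem s' 12 v = cand p q' c v).
Proof.
move=> es [w1 w2] hc h9 h10 h11.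
apply: (@wp_for R Y 4 0 0 _ _ n (fun j s1 =>
   forall v, (v < j)%N -> nmem s1 12 v = cand p q' c v)) => //=.
- exact: leq_trans (leqLn _ _ _) hY.
- exact: env_n (env2_env (env3_env2 es)).
move=> v s1 hv hI [n1 r1 _] h4.
have e9 : nmem s1 9 0 = p by rewrite n1.
have e10 : nmem s1 10 0 = q' by rewrite n1.
have e11 : nmem s1 11 0 = c by rewrite n1.
have ev : nmem s1 25 v = repf v by rewrite n1 // w2.
have hh u : (u < n)%N -> rmem s1 6 u = hval u by move=> hu; rewrite r1 // w1.
have key (x : nat) : x = cand p q' c v ->
    forall v', (v' < v.+1)%N ->
    (if v' == v then x else nmem s1 12 v') = cand p q' c v'.
  move=> hx v'; rewrite ltnS leq_eqVlt.
  by case: eqP => [-> _|_ /= /hI //]; rewrite hx.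
apply: wp_if; rewrite /= e9 h4 ev; case: ifP => c1; last first.
  by apply: wp_nput => /=; rewrite h4; apply: key; rewrite /cand c1.
apply: wp_if; rewrite /= h4 ev e10; case: ifP => c2; last first.
  by apply: wp_nput => /=; rewrite h4; apply: key; rewrite /cand c1 c2.
apply: wp_if; rewrite /= h4 e11 !hh //; case: ifP => c3;
  by apply: wp_nput => /=; rewrite h4; apply: key; rewrite /cand c1 c2 c3.
Qed.

Lemma sweep_spec s : env3 s -> swept s -> out s ->
  wp Y sweep_cmd s (fun s' => [/\ out s', best s' <= best s &
    forall p q' c, (p < n)%N -> (q' < n)%N -> (c < n)%N ->
      validf R n k (cand p q' c) -> best s' <= phif n E inc wt (cand p q' c)]).
Proof.
move=> es ws os.
have hn : (n <= Y)%N by exact: leq_trans (leqLn _ _ _) hY.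
have sw (c : cmd) s1 s2 : same c s1 s2 -> (25 \notin nmods c)%N ->
    (6 \notin rmods c)%N -> swept s1 -> swept s2.
  by move=> [n1 r1 _] h1 h2 [w1 w2]; split=> v hv; rewrite ?n1 ?r1 ?w1 ?w2.
apply: (@wp_for R Y 9 0 0 _ _ n (fun p0 s1 => [/\ out s1, best s1 <= best s &
    forall p q' c, (p < p0)%N -> (q' < n)%N -> (c < n)%N ->
      validf R n k (cand p q' c) -> best s1 <= phif n E inc wt (cand p q' c)])) => //.
  exact: env_n (env2_env (env3_env2 es)).
move=> p s1 hp [o1 b1 I1] hs1 h9.
have es1 := env3_same hs1 erefl es; have ws1 := sw _ _ _ hs1 erefl erefl ws.
apply: wp_impl (_ : wp _ _ _ (fun s2 => [/\ out s2, best s2 <= best s1 &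
    forall q' c, (q' < n)%N -> (c < n)%N ->
      validf R n k (cand p q' c) -> best s2 <= phif n E inc wt (cand p q' c)])) _;
  last first.
  move=> s2 _ [o2 b2 I2]; split=> //; first exact: le_trans b1.
  move=> p' q' c; rewrite ltnS leq_eqVlt; case: eqP => [-> _|_ /= hp'].
    exact: I2.
  by move=> hq hc hv; apply: le_trans b2 _; apply: I1.
apply: (@wp_for R Y 10 0 0 _ _ n (fun q0 s2 => [/\ out s2, best s2 <= best s1 &
    forall q' c, (q' < q0)%N -> (c < n)%N ->
      validf R n k (cand p q' c) -> best s2 <= phif n E inc wt (cand p q' c)])) => //.
  exact: env_n (env2_env (env3_env2 es1)).
move=> q' s2 hq [o2 b2 I2] hs2 h10.
have es2 := env3_same hs2 erefl es1; have ws2 := sw _ _ _ hs2 erefl erefl ws1.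
have h92 : nmem s2 9 0 = p by case: hs2 => [-> // _ _].
apply: wp_impl (_ : wp _ _ _ (fun s3 => [/\ out s3, best s3 <= best s2 &
    forall c, (c < n)%N ->
      validf R n k (cand p q' c) -> best s3 <= phif n E inc wt (cand p q' c)])) _;
  last first.
  move=> s3 _ [o3 b3 I3]; split=> //; first exact: le_trans b2.
  move=> q'' c; rewrite ltnS leq_eqVlt; case: eqP => [-> _|_ /= hq'].
    exact: I3.
  by move=> hc hv; apply: le_trans b3 _; apply: I2.
apply: (@wp_for R Y 11 0 0 _ _ n (fun c0 s3 => [/\ out s3, best s3 <= best s2 &
    forall c, (c < c0)%N ->
      validf R n k (cand p q' c) -> best s3 <= phif n E inc wt (cand p q' c)])) => //.
  exact: env_n (env2_env (env3_env2 es2)).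
move=> c s3 hc [o3 b3 I3] hs3 h11.
have es3 := env3_same hs3 erefl es2; have ws3 := sw _ _ _ hs3 erefl erefl ws2.
have h93 : nmem s3 9 0 = p by case: hs3 => [-> // _ _].
have h103 : nmem s3 10 0 = q' by case: hs3 => [-> // _ _].
apply: wp_seq; apply: wp_impl (member_spec es3 ws3 hc h93 h103 h11) _.
move=> s4 hs4 hm.
have es4 := env3_same hs4 erefl es3.
have [o4 b4] := out_same hs4 erefl erefl o3.
apply: wp_impl (eval_spec hY (env2_env (env3_env2 es4)) hm o4) _.
move=> s5 _ [o5 b5 I5]; split=> //; first by rewrite (le_trans b5) // b4.
move=> c' ; rewrite ltnS leq_eqVlt; case: eqP => [-> _|_ /= hc']; first exact: I5.
by move=> hv; apply: le_trans b5 _; rewrite b4; apply: I3.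
Qed.

Lemma round_spec s : env3 s -> out s ->
  wp Y (round_cmd be ee) s (fun s' => [/\ out s', best s' <= best s &
    forall p q' c, (p < n)%N -> (q' < n)%N -> (c < n)%N ->
      validf R n k (cand p q' c) -> best s' <= phif n E inc wt (cand p q' c)]).
Proof.
move=> es os.
apply: wp_seq; apply: wp_impl (bump_spec es) _ => s1 hs1 b1.
have es1 := env3_same hs1 erefl es.
have [o1 c1] := out_same hs1 erefl erefl os.
apply: wp_seq; apply: wp_impl (rep_spec es1 b1) _ => s2 hs2 r2.
have es2 := env3_same hs2 erefl es1.
have [o2 c2] := out_same hs2 erefl erefl o1.
have ws2 : swept s2.
  split=> // v hv; case: hs2 => [_ -> // _]; exact: b1.1.
apply: wp_impl (sweep_spec es2 ws2 o2) _ => s3 _ [o3 c3 I3].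
by split=> //; rewrite (le_trans c3) // c2 c1.
Qed.

End Round.

Local Notation dbl e := (NAdd e e).

Definition width_cmd : cmd :=
  Seq (NPut 28 nzero (NCst 1)) (Seq (NPut 16 nzero nzero) (Seq (NPut 17 nzero (NCst 1))
    (While (NLe (NAdd (nv 28) (NCst 1)) (dbl (dbl (dbl (dbl (NGet 0 (NCst 2)))))))
       (Seq (NPut 28 nzero (dbl (nv 28)))
       (Seq (NPut 16 nzero (NAdd (nv 16) (NCst 4)))
            (NPut 17 nzero (dbl (dbl (dbl (dbl (nv 17))))))))))).

Definition table_cmd : cmd :=
  Seq (NPut 18 nzero (NAdd (NAdd (nv 0) (NGet 0 (NCst 1))) (nv 17)))
    (For 4 (18, 0)%N
      (Seq (RPut 2 (NAdd (nv 4) (NCst 1)) (RAdd (RGet 2 (nv 4)) (RCst 1)))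
      (Seq (NPut 19 (NAdd (nv 4) (NCst 1)) (NAdd (NGet 19 (nv 4)) (nv 0)))
      (Seq (NPut 21 (NAdd (nv 4) (NCst 1))
              (NAdd (NGet 21 (nv 4)) (NGet 20 (nv 4))))
           (NPut 20 (NAdd (nv 4) (NCst 1)) (NSub (NCst 1) (NGet 20 (nv 4)))))))).

Definition norm_cmd : cmd :=
  For 4 (0%N, 0%N) (Seq (RPut 5 nzero (RCst 0))
   (Seq (For 7 (0, 2)%N (RPut 5 nzero (RAdd (rv 5)
            (RMul (RGet 1 (cell 7 4)) (RGet 1 (cell 7 4))))))
        (RPut 3 (nv 4) (RSqrt (rv 5))))).

Definition flip_cmd : cmd := For 7 (0, 2)%N (Flip 22 (nv 7)).

Definition dot_cmd : cmd :=
  For 7 (0, 2)%N (RPut 5 nzero (RAdd (rv 5)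
     (RMul (RSub (RMul (RCst 2) (RGet 2 (NGet 22 (nv 7)))) (RCst 1))
           (RGet 1 (cell 7 4))))).

Definition project_cmd : cmd :=
  For 3 (16, 0)%N (Seq flip_cmd (For 4 (0%N, 0%N)
    (Seq (RPut 5 nzero (RCst 0)) (Seq dot_cmd
       (RPut 4 (cell 3 4) (RDiv (rv 5) (RGet 3 (nv 4)))))))).

Definition ones_cmd : cmd := For 4 (0%N, 0%N) (NPut 12 (nv 4) (NCst 1)).

Definition bits_cmd : cmd :=
  Seq (NPut 29 nzero (nv 8)) (For 3 (16, 0)%N
    (Seq (NPut 23 (nv 3) (NGet 20 (nv 29))) (NPut 29 nzero (NGet 21 (nv 29))))).

Definition tri_expr : rexpr :=
  let e := RSub (RMul (RCst 2) (rv 7)) (RCst 1) in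
  RSub (RCst 1) (RSqrt (RMul e e)).

Definition shift1_expr : rexpr := RDiv (RGet 2 (NGet 23 (nv 3))) (RCst 2).
Definition shift2_expr : rexpr := RDiv (RGet 2 (nv 8)) (RGet 2 (nv 17)).

Definition bump1_expr : rexpr :=
  let t := tri_expr in
  let u := RSub (RCst 1) t in
  RDiv t (RSqrt (RAdd (RMul t t) (RMul u u))).

Definition bump2_expr : rexpr :=
  let z := RMul (RMul (RCst 16) (RGet 2 (nv 16))) tri_expr in
  let u := RSub (RCst 1) z in
  RDiv (RSub (RAdd (RCst 1) z) (RSqrt (RMul u u))) (RCst 2).

Definition search_cmd : cmd :=
  For 8 (17, 0)%N (Seq bits_cmd (Seq (round_cmd shift1_expr bump1_expr)
     (round_cmd shift2_expr bump2_expr))).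

Definition main_cmd : cmd :=
  Seq width_cmd (Seq table_cmd (Seq norm_cmd (Seq project_cmd
    (Seq (RPut 10 nzero (RCst 2)) (Seq ones_cmd (Seq eval_cmd search_cmd)))))).

Section Main.
Variable R : realType.

(* 2 dist(x, Z) for y the fractional part of x *)
Definition tri (y : R) : R := 1 - Num.sqrt ((2 * y - 1) * (2 * y - 1)).

Definition bump1 (y : R) : R :=
  tri y / Num.sqrt (tri y * tri y + (1 - tri y) * (1 - tri y)).

(* min(1, 16 m tri y) *)
Definition bump2 (m : nat) (y : R) : R :=
  (1 + 16 * m%:R * tri y
   - Num.sqrt ((1 - 16 * m%:R * tri y) * (1 - 16 * m%:R * tri y))) / 2.

Variables (n E k : nat).
Variables (inc : nat -> nat -> bool) (wt : nat -> R) (F : nat -> nat -> R).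
Variable om : seq bool.
Let q := up_log 2 (16 * k).
Let m := (4 * q)%N.
Let P := (2 ^ m)%N.
Let L := (n + E + P)%N.
Hypothesis k_gt0 : (0 < k)%N.
Hypothesis om_size : (m * k <= size om)%N.
Variable Y : nat.
Hypothesis hY : (L <= Y)%N.

Definition normf (v : nat) : R := Num.sqrt (\sum_(0 <= s < k) F s v * F s v).
Definition projf (i v : nat) : R :=
  (\sum_(0 <= s < k) (2 * (nth false om (i * k + s) : nat)%:R - 1) * F s v)
  / normf v.

Local Notation env := (env n E k inc wt F).
Local Notation env2 := (env2 n E k inc wt F normf projf).
Local Notation env3 := (env3 n E k inc wt F normf projf).
Local Notation out := (out n E k inc wt).

Lemma projf_le i v : `|projf i v| <= k%:R.
Proof.
have n0 : 0 <= normf v by exact: sqrtr_ge0.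
have le1 s : (s < k)%N -> `|F s v| <= normf v.
  move=> hs; rewrite -sqrtr_sqr; apply: ler_wsqrtr.
  rewrite big_mkord (bigD1 (Ordinal hs)) //= expr2 lerDl.
  by apply: sumr_ge0 => i0 _; rewrite -expr2 sqr_ge0.
rewrite /projf normrM normfV (ger0_norm n0).
have [->|nz] := eqVneq (normf v) 0; first by rewrite invr0 mulr0.
rewrite ler_pdivrMr ?lt0r ?nz //.
apply: le_trans (ler_norm_sum _ _ _) _.
have -> : k%:R * normf v = \sum_(0 <= s < k) normf v.
  by rewrite sumr_const_nat subn0 mulr_natl.
rewrite big_nat [leRHS]big_nat.
apply: ler_sum => s /andP[_ hs]; rewrite normrM.
apply: le_trans (le1 s hs); rewrite ler_piMl //.
by case: (nth _ _ _); rewrite /= ?mulr1 ?mulr0 ?sub0r ?normrN1 // ler_norml;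
  apply/andP; split; lra.
Qed.

Record start (s : state R) : Prop := Start {
  start_n : nmem s 0 0 = n;
  start_E : nmem s 0 1 = E;
  start_k : nmem s 0 2 = k;
  start_inc : forall e v, (e < E)%N -> (v < n)%N ->
    nmem s 1 (e * n + v) = inc e v;
  start_wt : forall e, (e < E)%N -> rmem s 0 e = wt e;
  start_F : forall i v, (i < k)%N -> (v < n)%N -> rmem s 1 (i * n + v) = F i v;
  start_coins : coins s = om;
  start_n0 : forall a i, (2 <= a)%N -> nmem s a i = 0%N;
  start_r0 : forall a i, (2 <= a)%N -> rmem s a i = 0 }.

Lemma width_spec s : start s -> wp Y width_cmd s
  (fun s' => nmem s' 16 0 = m /\ nmem s' 17 0 = P).
Proof.
move=> ss; do 3!(apply: wp_seq; apply: wp_nput => /=).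
set s0 := nput _ 17 _ _.
apply: (@wp_impl _ _ _ _ (fun s1 => [/\ nmem s1 28 0 = (2 ^ q)%N,
  nmem s1 16 0 = (4 * q)%N & nmem s1 17 0 = (2 ^ (4 * q))%N]));
  last by move=> s' _ [].
apply: (@wp_while R Y _ _ _ _ (fun j s1 => [/\ nmem s1 28 0 = (2 ^ j)%N,
  nmem s1 16 0 = (4 * j)%N & nmem s1 17 0 = (2 ^ (4 * j))%N])) => //.
- apply: leq_trans hY; apply: leq_trans (leqLP _ _ _); apply: ltnW.
  by apply: leq_ltn_trans (leqPm _); rewrite leq_pmull.
- move=> j s1 hj [h1 h2 h3] [n1 _ _].
  have hk : nmem s1 0 2 = k by rewrite n1 //; exact: start_k ss.
  split.
    rewrite /= hk h1 addn1; have -> : (k + k + (k + k) + (k + k + (k + k)) +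
      (k + k + (k + k) + (k + k + (k + k))) = 16 * k)%N by lia.
    rewrite ltnNge; apply/negP => hle.
    by have := up_log_min (isT : 1 < 2)%N hle; rewrite leqNgt hj.
  apply: wp_seq; apply: wp_nput; apply: wp_seq; apply: wp_nput; apply: wp_nput.
  rewrite /= h1 h2 h3 mulnS expnD expnS; split; lia.
- move=> s1 [h1 h2 h3] [n1 _ _].
  have hk : nmem s1 0 2 = k by rewrite n1 //; exact: start_k ss.
  rewrite /= hk h1 addn1 -leqNgt.
  apply: (@leq_trans (16 * k)); last exact: up_logP.
  by lia.
Qed.

Lemma table_spec s : start s -> forall s1, same width_cmd s s1 ->
  nmem s1 16 0 = m -> nmem s1 17 0 = P -> wp Y table_cmd s1 env.
Proof.
move=> ss s1 [n1 r1 _] h16 h17; apply: wp_seq; apply: wp_nput => /=.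
rewrite h17 !n1 // (start_n ss) (start_E ss) -/L.
set s2 := nput _ _ _ _.
apply: (@wp_impl _ _ _ _ (fun s3 => [/\
  forall j, (j <= L)%N -> rmem s3 2 j = j%:R,
  forall j, (j <= L)%N -> nmem s3 19 j = (j * n)%N,
  forall j, (j <= L)%N -> nmem s3 20 j = odd j &
  forall j, (j <= L)%N -> nmem s3 21 j = j./2])); last first.
  move=> s3 [n3 r3 _] [t1 t2 t3 t4].
  have k1 a i : (a < 2)%N -> nmem s3 a i = nmem s a i.
    by case: a => [|[|//]] _; rewrite n3 // /s2 /= n1.
  split=> //.
  - by rewrite k1 //; exact: start_n ss.
  - by rewrite k1 //; exact: start_E ss.
  - by rewrite k1 //; exact: start_k ss.
  - by move=> e v he hv; rewrite k1 //; exact: start_inc ss _ _ he hv.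
  - by move=> e he; rewrite r3 // /s2 /= r1 //; exact: start_wt ss _ he.
  - by move=> i v hi hv; rewrite r3 // /s2 /= r1 //; exact: start_F ss _ _ hi hv.
  - by rewrite n3.
  - by rewrite n3.
apply: (@wp_for R Y 4 18 0 _ _ L (fun j0 s3 => [/\
  forall j, (j <= j0)%N -> rmem s3 2 j = j%:R,
  forall j, (j <= j0)%N -> nmem s3 19 j = (j * n)%N,
  forall j, (j <= j0)%N -> nmem s3 20 j = odd j &
  forall j, (j <= j0)%N -> nmem s3 21 j = j./2])) => //=.
- by split=> j; rewrite leqn0 => /eqP->; rewrite ?n1 ?r1 ?(start_n0 ss) ?(start_r0 ss).
move=> j s3 hj [t1 t2 t3 t4] [n3 r3 _] h4.
have hn : nmem s3 0 0 = n by rewrite n3 // /s2 /= n1 //; exact: start_n ss.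
apply: wp_seq; apply: wp_rput; apply: wp_seq; apply: wp_nput.
apply: wp_seq; apply: wp_nput; apply: wp_nput => /=.
rewrite h4 hn addn1 t1 // t2 // t3 // t4 //.
split=> j'; rewrite leq_eqVlt ltnS; case: eqP => [-> _|_ /= hj']; rewrite ?t1 ?t2 ?t3 ?t4 //.
- by rewrite natr1.
- by rewrite mulSn addnC.
- by rewrite /=; case: (odd j).
- by rewrite /= uphalf_half addnC.
Qed.

Lemma norm_spec s : env s ->
  wp Y norm_cmd s (fun s' => forall v, (v < n)%N -> rmem s' 3 v = normf v).
Proof.
move=> es; apply: (@wp_for R Y 4 0 0 _ _ n (fun j s1 =>
   forall v, (v < j)%N -> rmem s1 3 v = normf v)) => //=.
- exact: leq_trans (leqLn _ _ _) hY.
- exact: env_n es.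
move=> v s1 hv hI hs h4; have es1 := env_same hs erefl es.
apply: wp_seq; apply: wp_rput => /=; set s2 := rput _ _ _ _.
have es2 : env s2 by apply: env_rput.
apply: wp_seq; apply: (@wp_impl _ _ _ _ (fun s3 =>
  rmem s3 5 0 = \sum_(0 <= i < k) F i v * F i v)); last first.
  move=> s3 [n3 r3 _] h5; apply: wp_rput => /= v'.
  rewrite n3 // -/s2 /= h4 h5 ltnS leq_eqVlt.
  by case: eqP => [-> //|_ /= hv']; rewrite r3 //; exact: hI.
apply: (@wp_for R Y 7 0 2 _ _ k (fun j s3 =>
  rmem s3 5 0 = \sum_(0 <= i < j) F i v * F i v)) => //=.
- by apply: leq_trans hY; exact: leq_trans (leqPk _) (leqLP _ _ _).
- exact: env_k es2.
- by rewrite big_geq.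
move=> i s3 hi hJ hs3 h7; have es3 := env_same hs3 erefl es2.
have h43 : nmem s3 4 0 = v by case: hs3 => [-> // _ _].
have hF : rmem s3 1 (nmem s3 19 (nmem s3 7 0) + nmem s3 4 0) = F i v.
  rewrite h7 h43 (env_row es3) ?(env_F es3) //.
  by apply: leq_trans (ltnW hi) _; exact: leq_trans (leqPk _) (leqLP _ _ _).
by apply: wp_rput => /=; rewrite hF hJ big_nat_recr.
Qed.

Lemma flip_spec s i : env s -> (i < m)%N -> coins s = drop (i * k) om ->
  wp Y flip_cmd s (fun s' =>
    (forall j, (j < k)%N -> nmem s' 22 j = nth false om (i * k + j)) /\
    coins s' = drop (i.+1 * k) om).
Proof.
move=> es hi hc.
apply: (@wp_impl _ _ _ _ (fun s' =>
    (forall j, (j < k)%N -> nmem s' 22 j = nth false om (i * k + j)) /\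
    coins s' = drop (i * k + k) om)); last first.
  by move=> s' _ [h1 h2]; split=> //; rewrite mulSn addnC.
apply: (@wp_for R Y 7 0 2 _ _ k (fun j0 s' =>
    (forall j, (j < j0)%N -> nmem s' 22 j = nth false om (i * k + j)) /\
    coins s' = drop (i * k + j0) om)) => //=.
- by apply: leq_trans hY; exact: leq_trans (leqPk _) (leqLP _ _ _).
- exact: env_k es.
- by rewrite addn0.
move=> j s1 hj [hI1 hI2] hs h7.
have hlt : (i * k + j < size om)%N.
  apply: leq_trans om_size; apply: (@leq_trans (i.+1 * k)).
    by rewrite mulSn addnC ltn_add2r.
  by rewrite leq_mul2r hi orbT.
apply: (@wp_flip _ _ _ _ (nth false om (i * k + j)) (drop (i * k + j).+1 om)).
  by rewrite hI2 (drop_nth false).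
split=> /=; last by rewrite addnS.
by move=> j'; rewrite h7 ltnS leq_eqVlt; case: eqP => [-> //|_ /= /hI1].
Qed.

Lemma project_spec s : env s -> coins s = om ->
  (forall v, (v < n)%N -> rmem s 3 v = normf v) -> wp Y project_cmd s env2.
Proof.
move=> es hc hn.
apply: (@wp_impl _ _ _ _ (fun s1 => coins s1 = drop (m * k) om /\
  forall i v, (i < m)%N -> (v < n)%N -> rmem s1 4 (i * n + v) = projf i v)).
  apply: (@wp_for R Y 3 16 0 _ _ m (fun i0 s1 => coins s1 = drop (i0 * k) om /\
    forall i v, (i < i0)%N -> (v < n)%N -> rmem s1 4 (i * n + v) = projf i v))
    => //=.
  - by apply: leq_trans hY; exact: leq_mP.
  - exact: env_m es.
  - by rewrite drop0.
  move=> i s1 hi [hI1 hI2] hs h3; have es1 := env_same hs erefl es.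
  have hn1 v : (v < n)%N -> rmem s1 3 v = normf v.
    by move=> hv; case: hs => [_ -> // _]; exact: hn.
  apply: wp_seq; apply: wp_impl (flip_spec es1 hi hI1) _ => s2 hs2 [hb hc2].
  have es2 := env_same hs2 erefl es1; have [n2 r2 _] := hs2.
  apply: (@wp_impl _ _ _ _ (fun s3 => forall i' v', (i' < i)%N || (i' == i) ->
    (v' < n)%N -> rmem s3 4 (i' * n + v') = projf i' v')); last first.
    move=> s3 [n3 r3 c3] h4; split=> /=; first by rewrite c3.
    by move=> i' v' hi' hv'; apply: h4 => //; rewrite orbC -leq_eqVlt.
  apply: (@wp_impl _ _ _ _ (fun s3 => forall i' v',
    (i' < i)%N || (i' == i) && (v' < n)%N ->
    (v' < n)%N -> rmem s3 4 (i' * n + v') = projf i' v')); last first.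
    by move=> s3 _ h4 i' v' hi' hv'; apply: h4 => //; rewrite hv' andbT.
  apply: (@wp_for R Y 4 0 0 _ _ n (fun v s3 => forall i' v',
    (i' < i)%N || (i' == i) && (v' < v)%N ->
    (v' < n)%N -> rmem s3 4 (i' * n + v') = projf i' v')) => //.
  - exact: leq_trans (leqLn _ _ _) hY.
  - exact: env_n es2.
  - by move=> i' v'; rewrite ltn0 andbF orbF => hi' hv' /=; rewrite r2 // hI2.
  move=> v s3 hv hJ hs3 h4; have es3 := env_same hs3 erefl es2.
  have [n3 r3 _] := hs3.
  apply: wp_seq; apply: wp_rput => /=; set s4 := rput _ _ _ _.
  have es4 : env s4 by apply: env_rput.
  apply: wp_seq; apply: (@wp_impl _ _ _ _ (fun s5 => rmem s5 5 0 =
    \sum_(0 <= s < k) (2 * (nth false om (i * k + s) : nat)%:R - 1) * F s v));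
    last first.
    move=> s5 hs5 h5; have es5 := env_same hs5 erefl es4.
    have [n5 r5 _] := hs5.
    have h35 : nmem s5 3 0 = i by rewrite n5 // /s4 /= n3 // n2.
    have h45 : nmem s5 4 0 = v by rewrite n5.
    have hnv : rmem s5 3 v = normf v.
      by rewrite r5 // /s4 /= r3 // r2 //; exact: hn1.
    have row : nmem s5 19 i = (i * n)%N.
      rewrite (env_row es5) //; apply: leq_trans (ltnW hi) _; exact: leq_mP.
    apply: wp_rput => /= i' v' hh hv'.
    rewrite h35 h45 row hnv h5 addnM_inj //.
    case: eqP => [ei|ne] /=.
      subst i'; case: eqP => [-> //|ne'] /=.
      rewrite r5 // /s4 /=; apply: hJ => //.
      move: hh; rewrite ltnn eqxx /= ltnS leq_eqVlt.
      by case/orP=> [/eqP //|->].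
    rewrite r5 // /s4 /=; apply: hJ => //.
    by move: hh => /orP[->//|/andP[/eqP]].
  apply: (@wp_for R Y 7 0 2 _ _ k (fun j s5 => rmem s5 5 0 =
    \sum_(0 <= s < j) (2 * (nth false om (i * k + s) : nat)%:R - 1) * F s v))
    => //.
  - by apply: leq_trans hY; exact: leq_trans (leqPk _) (leqLP _ _ _).
  - exact: env_k es4.
  - by rewrite big_geq.
  move=> j s5 hj hK hs5 h7; have es5 := env_same hs5 erefl es4.
  have [n5 r5 _] := hs5.
  have h45 : nmem s5 4 0 = v by rewrite n5.
  have hjL : (j <= L)%N.
    by apply: leq_trans (ltnW hj) _; exact: leq_trans (leqPk _) (leqLP _ _ _).
  have hF : rmem s5 1 (nmem s5 19 (nmem s5 7 0) + nmem s5 4 0) = F j v.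
    by rewrite h7 h45 (env_row es5) ?(env_F es5).
  have hb5 : nmem s5 22 j = nth false om (i * k + j).
    by rewrite n5 // /s4 /= n3 //; exact: hb.
  have hL1 : (0 < L)%N by apply: leq_trans (leqLP _ _ _); rewrite expn_gt0.
  apply: wp_rput => /=; rewrite hF hK h7 hb5 (env_real es5) ?big_nat_recr //.
  by apply: leq_trans hL1; case: (nth _ _ _).
move=> s1 hs [_ h]; split=> //; first exact: env_same hs erefl es.
by move=> v hv; case: hs => [_ -> // _]; exact: hn.
Qed.

Definition bitf (j i : nat) : bool := odd (iter i half j).

Lemma bits_spec s j : env s -> (j < P)%N -> nmem s 8 0 = j ->
  wp Y bits_cmd s (fun s' => forall i, (i < m)%N -> nmem s' 23 i = bitf j i).
Proof.
move=> es hj h8; apply: wp_seq; apply: wp_nput => /=; rewrite h8.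
set s1 := nput _ _ _ _; have es1 : env s1 by apply: env_nput.
apply: (@wp_impl _ _ _ _ (fun s2 => nmem s2 29 0 = iter m half j /\
   forall i, (i < m)%N -> nmem s2 23 i = bitf j i)); last by move=> ? _ [].
apply: (@wp_for R Y 3 16 0 _ _ m (fun i0 s2 => nmem s2 29 0 = iter i0 half j /\
   forall i, (i < i0)%N -> nmem s2 23 i = bitf j i)) => //.
- by apply: leq_trans hY; exact: leq_mP.
- exact: env_m es1.
move=> i s2 hi [hI1 hI2] hs h3; have es2 := env_same hs erefl es1.
have hle : (iter i half j <= L)%N.
  apply: (@leq_trans j); last exact: leq_trans (ltnW hj) (leqLP _ _ _).
  elim: (i) => //= i' IH; apply: leq_trans IH.
  by rewrite -{2}[iter i' half j]odd_double_half -addnn; lia.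
apply: wp_seq; apply: wp_nput; apply: wp_nput => /=.
rewrite hI1 h3 (env_odd es2) // (env_half es2) //; split=> // i'.
by rewrite ltnS leq_eqVlt; case: eqP => [-> //|_ /= /hI2].
Qed.

Definition shift1 (j i : nat) : R := (bitf j i : nat)%:R / 2.
Definition shift2 (j i : nat) : R := j%:R / P%:R.

Local Notation cand1 j := (cand n k normf projf (shift1 j) bump1).
Local Notation cand2 j := (cand n k normf projf (shift2 j) (bump2 m)).

Definition searched (J : nat) (x : R) : Prop :=
  forall j p q' c, (j < J)%N -> (p < n)%N -> (q' < n)%N -> (c < n)%N ->
    (validf R n k (cand1 j p q' c) ->
       x <= phif n E inc wt (cand1 j p q' c)) /\
    (validf R n k (cand2 j p q' c) ->
       x <= phif n E inc wt (cand2 j p q' c)).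

Lemma search_spec s : env2 s -> out s ->
  wp Y search_cmd s (fun s' => [/\ out s', best s' <= best s &
    searched P (best s')]).
Proof.
move=> es os.
have X_le i v : (i < m)%N -> (v < n)%N -> `|projf i v| <= k%:R.
  by move=> _ _; exact: projf_le.
have one_leL : (1 <= L)%N by apply: leq_trans (leqLP _ _ _); rewrite expn_gt0.
apply: (@wp_for R Y 8 17 0 _ _ P (fun J s1 => [/\ out s1, best s1 <= best s &
    searched J (best s1)])) => //.
- by apply: leq_trans hY; exact: leqLP.
- exact: env_P (env2_env es).
move=> j s1 hj [o1 b1 I1] hs1 h8; have es1 := env2_same hs1 erefl es.
apply: wp_seq; apply: wp_impl (bits_spec (env2_env es1) hj h8) _ => s2 hs2 hb.
have es2 := env2_same hs2 erefl es1.
have h82 : nmem s2 8 0 = j by case: hs2 => [-> // _ _].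
have [o2 b2] := out_same hs2 erefl erefl o1.
have e3 : env3 (bitf j) j s2 by split.
have be1 s3 i : env3 (bitf j) j s3 -> (i < m)%N -> nmem s3 3 0 = i ->
    reval s3 shift1_expr = shift1 j i.
  move=> e4 hi h3 /=; rewrite h3 (env3_bit e4) //.
  rewrite (env_real (env2_env (env3_env2 e4))) //.
  by apply: leq_trans one_leL; case: (bitf j i).
have hP : P%:R != 0 :> R by rewrite pnatr_eq0 -lt0n expn_gt0.
have hjL : (j <= L)%N by exact: leq_trans (ltnW hj) (leqLP _ _ _).
have be2 s3 i : env3 (bitf j) j s3 -> (i < m)%N -> nmem s3 3 0 = i ->
    reval s3 shift2_expr = shift2 j i.
  move=> e4 hi h3 /=; have ev := env2_env (env3_env2 e4).
  by rewrite (env3_j e4) (env_P ev) !(env_real ev) // leqLP.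
have b01 i : 0 <= shift1 j i <= 1.
  rewrite /shift1; apply/andP; split; first by rewrite divr_ge0.
  by case: (bitf j i); rewrite /=; lra.
have b02 i : 0 <= shift2 j i <= 1.
  rewrite /shift2 divr_ge0 ?ler0n //= ler_pdivrMr ?mul1r ?ler_nat 1?ltnW //.
  by rewrite ltr0n expn_gt0.
have ee1 s3 : env3 (bitf j) j s3 -> reval s3 bump1_expr = bump1 (rmem s3 7 0).
  by [].
have ee2 s3 : env3 (bitf j) j s3 -> reval s3 bump2_expr = bump2 m (rmem s3 7 0).
  move=> e4; have ev := env2_env (env3_env2 e4).
  rewrite /bump2_expr /bump2 /= (env_m ev) (env_real ev) //.
  exact: leq_mP.
apply: wp_seq.
apply: wp_impl (round_spec k_gt0 X_le hY be1 b01 ee1 e3 o2) _ => s3 hs3 [o3 b3 I3].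
have e3' := env3_same hs3 erefl e3.
apply: wp_impl (round_spec k_gt0 X_le hY be2 b02 ee2 e3' o3) _ => s4 hs4 [o4 b4 I4].
split=> //.
  by rewrite (le_trans b4) // (le_trans b3) // b2.
move=> j' p q' c; rewrite ltnS leq_eqVlt; case: eqP => [-> _|_ /= hj'] hp hq hc.
  split=> h; last exact: I4.
  by apply: le_trans b4 _; exact: I3.
have [i1 i2] := I1 _ _ _ _ hj' hp hq hc.
have b41 : best s4 <= best s1 by rewrite (le_trans b4) // (le_trans b3) // b2.
by split=> h; apply: le_trans b41 _; [exact: i1|exact: i2].
Qed.

Lemma ones_spec s : env2 s ->
  wp Y ones_cmd s (fun s' => forall v, (v < n)%N -> nmem s' 12 v = true).
Proof.
move=> es; apply: (@wp_for R Y 4 0 0 _ _ n (fun j s1 =>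
  forall v, (v < j)%N -> nmem s1 12 v = true)) => //.
- exact: leq_trans (leqLn _ _ _) hY.
- exact: env_n (env2_env es).
move=> j s1 hj hI _ h4; apply: wp_nput => /= v.
by rewrite h4 ltnS leq_eqVlt; case: eqP => [-> //|_ /= /hI].
Qed.

Lemma main_spec s : start s -> wp Y main_cmd s (fun s' =>
  [/\ out s', validf R n k xpredT -> best s' <= phif n E inc wt xpredT
     & searched P (best s')]).
Proof.
move=> ss.
apply: wp_seq; apply: wp_impl (width_spec ss) _ => s1 hs1 [h16 h17].
have [n1 _ c1] := hs1.
apply: wp_seq; apply: wp_impl (table_spec ss hs1 h16 h17) _ => s2 hs2 es2.
have [n2 _ c2] := hs2.
apply: wp_seq; apply: wp_impl (norm_spec es2) _ => s3 hs3 hn.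
have es3 := env_same hs3 erefl es2; have [n3 _ c3] := hs3.
have hc : coins s3 = om by rewrite c3 // c2 // c1 //; exact: start_coins ss.
apply: wp_seq; apply: wp_impl (project_spec es3 hc hn) _ => s4 [n4 _ _] es4.
apply: wp_seq; apply: wp_rput => /=; set s5 := rput _ _ _ _.
have hs5 : same (RPut 10 nzero (RCst 2)) s4 s5.
  by split=> // a i; rewrite inE => ha; exact: update_other.
have es5 := env2_same hs5 erefl es4.
have o5 : out s5.
  right; split=> // v hv; rewrite /s5 /= n4 // n3 // n2 // n1 //.
  by rewrite (start_n0 ss).
apply: wp_seq; apply: wp_impl (ones_spec es5) _ => s6 hs6 h6.
have es6 := env2_same hs6 erefl es5.
have [o6 b6] := out_same hs6 erefl erefl o5.
apply: wp_seq.
apply: wp_impl (@eval_spec _ _ _ _ _ _ _ _ hY s6 xpredT (env2_env es6) h6 o6) _.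
move=> s7 hs7 [o7 b7 I7]; have es7 := env2_same hs7 erefl es6.
apply: wp_impl (search_spec es7 o7) _ => s8 _ [o8 b8 I8]; split=> // h.
by apply: le_trans b8 _; exact: I7.
Qed.

End Main.

(** * Tents and bumps *)

Section Tent.
Variable R : realType.
Implicit Types x y z : R.

Lemma sqr_normr x : `|x| ^+ 2 = x ^+ 2.
Proof. by rewrite real_normK // num_real. Qed.

Lemma triE x : tri x = 1 - `|2 * x - 1|.
Proof. by rewrite /tri -expr2 sqrtr_sqr. Qed.

Lemma bump2E m x : bump2 m x = Num.min 1 (16 * m%:R * tri x).
Proof.
rewrite /bump2 -expr2 sqrtr_sqr; set z := _ * tri x.
by case: (leP 1 z) => h; [rewrite ler0_norm|rewrite gtr0_norm]; lra.
Qed.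

Lemma fpart_itv x : 0 <= x -> 0 <= fpart x < 1.
Proof.
move=> h; have /andP[h1] := truncn_itv h; rewrite /fpart -natr1 => h2.
by apply/andP; split; lra.
Qed.

Definition tent x : R := tri (fpart x).

Lemma tent01 x : 0 <= x -> 0 <= tent x <= 1.
Proof.
move=> /fpart_itv /andP[h1 h2]; rewrite /tent triE.
have : `|2 * fpart x - 1| <= 1 by rewrite ler_norml; apply/andP; split; lra.
by move=> h; rewrite subr_ge0 h /= gerBl.
Qed.

Lemma tent_half x : 0 <= x -> tent (x + 2^-1) = 1 - tent x.
Proof.
move=> h; have /andP[f1 f2] := fpart_itv h; rewrite /tent !triE.
have /andP[t1 t2] := truncn_itv h.
have e1 : (Num.truncn x).+1%:R = (Num.truncn x)%:R + 1 :> R by rewrite natr1.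
have e2 : (Num.truncn x).+2%:R = (Num.truncn x)%:R + 2 :> R.
  by rewrite -addn2 natrD.
case: (lerP 2^-1 (fpart x)) => hx.
  have -> : fpart (x + 2^-1) = fpart x - 2^-1.
    rewrite {1}/fpart (_ : Num.truncn (x + 2^-1) = (Num.truncn x).+1).
      by rewrite /fpart e1; lra.
    by apply: truncn_def; move: hx; rewrite /fpart e1 e2 => hx;
      apply/andP; split; lra.
  rewrite (ger0_norm (_ : 0 <= 2 * fpart x - 1)); last by lra.
  by rewrite ler0_norm; lra.
have -> : fpart (x + 2^-1) = fpart x + 2^-1.
  rewrite {1}/fpart (_ : Num.truncn (x + 2^-1) = Num.truncn x).
    by rewrite /fpart; lra.
  by apply: truncn_def; move: hx; rewrite /fpart e1 => hx;
    apply/andP; split; lra.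
rewrite (ler0_norm (_ : 2 * fpart x - 1 <= 0)); last by lra.
by rewrite ger0_norm; lra.
Qed.

Lemma tent_le x (n : nat) : 0 <= x -> tent x <= 2 * `|x - n%:R|.
Proof.
move=> h; have /andP[f1 f2] := fpart_itv h; rewrite /tent triE.
have -> : x - n%:R = fpart x + ((Num.truncn x)%:R - n%:R) by rewrite /fpart; lra.
have a1 : `|2 * fpart x - 1| >= 2 * fpart x - 1 by exact: ler_norm.
have a2 : `|2 * fpart x - 1| >= - (2 * fpart x - 1).
  by rewrite -normrN; exact: ler_norm.
case: (leqP n (Num.truncn x)) => hn.
  have h1 : n%:R <= (Num.truncn x)%:R :> R by rewrite ler_nat.
  by rewrite [leRHS](congr1 _ (ger0_norm (_ : 0 <= fpart x + _))); lra.
have h1 : (Num.truncn x)%:R + 1 <= n%:R :> R by rewrite natr1 ler_nat.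
by rewrite [leRHS](congr1 _ (ler0_norm (_ : fpart x + _ <= 0))); lra.
Qed.

Lemma tent_attain x : 0 <= x -> exists n : nat, tent x = 2 * `|x - n%:R|.
Proof.
move=> h; have /andP[f1 f2] := fpart_itv h; rewrite /tent triE.
case: (lerP 2^-1 (fpart x)) => hx.
  exists (Num.truncn x).+1; rewrite -[(Num.truncn x).+1%:R]natr1.
  have -> : x - ((Num.truncn x)%:R + 1) = fpart x - 1 by rewrite /fpart; lra.
  rewrite (ger0_norm (_ : 0 <= 2 * fpart x - 1)); last by lra.
  by rewrite ler0_norm; lra.
exists (Num.truncn x); rewrite -/(fpart x).
rewrite (ler0_norm (_ : 2 * fpart x - 1 <= 0)); last by lra.
by rewrite ger0_norm; lra.
Qed.

Lemma tent_lip x y : 0 <= x -> 0 <= y -> `|tent x - tent y| <= 2 * `|x - y|.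
Proof.
have H a b : 0 <= a -> 0 <= b -> tent a - tent b <= 2 * `|a - b|.
  move=> ha hb; have [n hn] := tent_attain hb.
  have h1 := tent_le n ha; have h2 := ler_normD (a - b) (b - n%:R).
  rewrite addrA subrK in h2.
  by rewrite hn; lra.
move=> hx hy; rewrite ler_norml H // andbT.
by have := H _ _ hy hx; rewrite distrC; lra.
Qed.

Lemma tent_sep x y : 0 <= x -> 0 <= y -> Num.truncn x != Num.truncn y ->
  tent x + tent y <= 2 * `|x - y|.
Proof.
wlog hlt : x y / (Num.truncn x < Num.truncn y)%N.
  move=> H hx hy; rewrite neq_ltn => /orP[h|h].
    by apply: H => //; rewrite neq_ltn h.
  by rewrite addrC distrC; apply: H => //; rewrite neq_ltn h.
move=> hx hy _.
have h1 := tent_le (Num.truncn y) hx; have h2 := tent_le (Num.truncn y) hy.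
have /andP[t1 t2] := truncn_itv hy.
have /andP[t3 t4] := truncn_itv hx.
have h3 : (Num.truncn x).+1%:R <= (Num.truncn y)%:R :> R by rewrite ler_nat.
have h4 : x < (Num.truncn y)%:R by exact: lt_le_trans h3.
rewrite (distrC x y) (ger0_norm (_ : 0 <= y - x)); last by lra.
by move: h1 h2; rewrite ler0_norm ?ger0_norm; lra.
Qed.

Definition tnorm (t : R) : R := Num.sqrt (t * t + (1 - t) * (1 - t)).

Lemma tnorm2 t : tnorm t ^+ 2 = t * t + (1 - t) * (1 - t).
Proof. by rewrite sqr_sqrtr // addr_ge0 // -expr2 sqr_ge0. Qed.

Lemma tnorm_gt0 t : 0 < tnorm t.
Proof.
rewrite sqrtr_gt0; have := sqr_ge0 (2 * t - 1); rewrite expr2 => h.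
by apply: (@lt_le_trans _ _ 2^-1); [lra|nra].
Qed.

Lemma tnorm2_ge t : 2^-1 <= tnorm t ^+ 2.
Proof. by rewrite tnorm2; have := sqr_ge0 (2 * t - 1); rewrite expr2; nra. Qed.

Lemma tnormC t : tnorm (1 - t) = tnorm t.
Proof. by rewrite /tnorm subKr addrC. Qed.

Lemma bump1E x : bump1 (fpart x) = tent x / tnorm (tent x). Proof. by []. Qed.

Lemma bump1_half x : 0 <= x ->
  bump1 (fpart (x + 2^-1)) = (1 - tent x) / tnorm (tent x).
Proof. by move=> h; rewrite bump1E tent_half // tnormC. Qed.

Lemma bump1_ge0 x : 0 <= x -> 0 <= bump1 (fpart x).
Proof.
move=> h; rewrite bump1E; apply: divr_ge0; last exact: ltW (tnorm_gt0 _).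
by case/andP: (tent01 h).
Qed.

Lemma bump1_sq x : 0 <= x ->
  bump1 (fpart x) ^+ 2 + bump1 (fpart (x + 2^-1)) ^+ 2 = 1.
Proof.
move=> h; rewrite bump1_half // bump1E !expr_div_n tnorm2 -mulrDl -!expr2 divff //.
by rewrite !expr2 -tnorm2 lt0r_neq0 // exprn_gt0 // tnorm_gt0.
Qed.

Lemma bump1_le x : 0 <= x -> bump1 (fpart x) ^+ 2 <= 2 * tent x ^+ 2.
Proof.
move=> h; rewrite bump1E expr_div_n ler_pdivrMr ?exprn_gt0 ?tnorm_gt0 //.
by have := tnorm2_ge (tent x); have := sqr_ge0 (tent x); nra.
Qed.

(* Both normalised vectors (t, 1-t)/|(t, 1-t)| and (s, 1-s)/|(s, 1-s)| are unit,
   and normalisation is 2-Lipschitz since |(t, 1-t)|^2 >= 1/2. *)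
Lemma bump1_inner x y : 0 <= x -> 0 <= y ->
  1 - 8 * (x - y) ^+ 2 <= bump1 (fpart x) * bump1 (fpart y) +
    bump1 (fpart (x + 2^-1)) * bump1 (fpart (y + 2^-1)).
Proof.
move=> hx hy; rewrite !bump1_half // !bump1E.
have hl : (tent x - tent y) ^+ 2 <= 4 * (x - y) ^+ 2.
  rewrite -(sqr_normr (tent x - tent y)) -(sqr_normr (x - y)).
  have := tent_lip hx hy; have := normr_ge0 (tent x - tent y).
  by move: `|_| => a; move: `|_| => b; nra.
move: hl; move: (tent x) (tent y) => s t hl.
have a0 := tnorm_gt0 s; have b0 := tnorm_gt0 t.
have a2 := tnorm2 s; have b2 := tnorm2 t.
have ha := tnorm2_ge s; have hb := tnorm2_ge t.
set a := tnorm s in a0 a2 ha *; set b := tnorm t in b0 b2 hb *.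
have -> : s / a * (t / b) + (1 - s) / a * ((1 - t) / b) =
   (s * t + (1 - s) * (1 - t)) / (a * b).
  by field; rewrite !gt_eqF.
have ab : 2^-1 <= a * b.
  have : 2^-1 ^+ 2 <= (a * b) ^+ 2.
    by rewrite exprMn expr2; apply: ler_pM => //; rewrite invr_ge0.
  rewrite ler_sqr // nnegrE ?invr_ge0 //; exact: ltW (mulr_gt0 a0 b0).
rewrite ler_pdivlMr ?mulr_gt0 //.
have hd : a * b <= (a ^+ 2 + b ^+ 2) / 2 by have := sqr_ge0 (a - b); nra.
have hn : s * t + (1 - s) * (1 - t) = (a ^+ 2 + b ^+ 2) / 2 - (s - t) ^+ 2.
  by rewrite a2 b2; field.
rewrite hn mulrBl mul1r.
have : (x - y) ^+ 2 * 2^-1 <= (x - y) ^+ 2 * (a * b).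
  by apply: ler_wpM2l => //; exact: sqr_ge0.
by lra.
Qed.

Definition cross (x y : R) : R :=
  bump1 (fpart x) * bump1 (fpart y) * (Num.truncn x == Num.truncn y)%:R.

Lemma cross_ge0 x y : 0 <= x -> 0 <= y -> 0 <= cross x y.
Proof.
by move=> hx hy; rewrite /cross mulr_ge0 ?ler0n // mulr_ge0 // bump1_ge0.
Qed.

Lemma cross_le x y : 0 <= x -> 0 <= y ->
  cross x y <= (bump1 (fpart x) ^+ 2 + bump1 (fpart y) ^+ 2) / 2.
Proof.
move=> hx hy; rewrite /cross.
have := bump1_ge0 hx; have := bump1_ge0 hy.
move: (bump1 _) (bump1 _) => a b; have := sqr_ge0 (a - b).
by case: eqP => _; rewrite ?mulr1 ?mulr0; nra.
Qed.

Lemma cross_ge x y : 0 <= x -> 0 <= y ->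
  bump1 (fpart x) * bump1 (fpart y) - 2 * (x - y) ^+ 2 <= cross x y.
Proof.
move=> hx hy; rewrite /cross.
case: eqP => [_|/eqP ne]; first by rewrite mulr1 gerBl mulr_ge0 // sqr_ge0.
have hs := tent_sep hx hy ne; rewrite mulr0.
have hx1 := bump1_le hx; have hy1 := bump1_le hy.
have x1 := bump1_ge0 hx; have y1 := bump1_ge0 hy.
have /andP[x2 _] := tent01 hx; have /andP[y2 _] := tent01 hy.
rewrite -(sqr_normr (x - y)); move: `|x - y| hs => d hs.
have h1 : bump1 (fpart x) * bump1 (fpart y) <= 2 * tent x * tent y.
  have h2 : (bump1 (fpart x) * bump1 (fpart y)) ^+ 2 <= (2 * tent x * tent y) ^+ 2.
    rewrite exprMn; apply: le_trans (ler_pM (sqr_ge0 _) (sqr_ge0 _) hx1 hy1) _.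
    by rewrite le_eqVlt; apply/orP; left; apply/eqP; ring.
  rewrite ler_sqr // in h2; rewrite nnegrE; first exact: mulr_ge0.
  by rewrite mulr_ge0 // mulr_ge0.
by have := sqr_ge0 (tent x - tent y); nra.
Qed.

Lemma crossD x y : 0 <= x -> 0 <= y ->
  0 <= cross x y + cross (x + 2^-1) (y + 2^-1) <= 1 /\
  1 - 12 * (x - y) ^+ 2 <= cross x y + cross (x + 2^-1) (y + 2^-1).
Proof.
move=> hx hy; have hx' : 0 <= x + 2^-1 by lra.
have hy' : 0 <= y + 2^-1 by lra.
have e : x + 2^-1 - (y + 2^-1) = x - y by lra.
have := cross_ge0 hx hy; have := cross_ge0 hx' hy'.
have := cross_le hx hy; have := cross_le hx' hy'.
have := cross_ge hx hy; have := cross_ge hx' hy'; rewrite e.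
have := bump1_inner hx hy; have := bump1_sq hx; have := bump1_sq hy.
move=> *; split; [apply/andP; split|]; lra.
Qed.

Lemma bump2_01 m x : 0 <= x -> 0 <= bump2 m (fpart x) <= 1.
Proof.
move=> h; rewrite bump2E le_min ler01 ge_min lexx /= andbT.
by rewrite !mulr_ge0 //; case/andP: (tent01 h).
Qed.

Lemma bump2_lip m x y : 0 <= x -> 0 <= y ->
  `|bump2 m (fpart x) - bump2 m (fpart y)| <= 32 * m%:R * `|x - y|.
Proof.
move=> hx hy; rewrite !bump2E -/(tent x) -/(tent y).
apply: (@le_trans _ _ (16 * m%:R * `|tent x - tent y|)); last first.
  apply: (@le_trans _ _ (16 * m%:R * (2 * `|x - y|))).
    by apply: ler_wpM2l; [rewrite mulr_ge0|exact: tent_lip].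
  by rewrite le_eqVlt; apply/orP; left; apply/eqP; ring.
have m0 : 0 <= 16 * m%:R :> R by rewrite mulr_ge0.
have -> : 16 * m%:R * `|tent x - tent y| =
    `|16 * m%:R * tent x - 16 * m%:R * tent y|.
  by rewrite -mulrBr normrM (ger0_norm m0).
move: (16 * m%:R * tent x) (16 * m%:R * tent y) => a b.
wlog hab : a b / a <= b.
  by move=> H; case: (leP a b) => [/H //|/ltW/H]; rewrite distrC (distrC b).
rewrite (ler0_norm (_ : a - b <= 0)) ?subr_le0 //.
by rewrite ler0_norm; case: (leP 1 a) => h1; case: (leP 1 b) => h2; lra.
Qed.

Lemma bump2_sep m x y : 0 <= x -> 0 <= y -> Num.truncn x != Num.truncn y ->
  bump2 m (fpart x) <= 32 * m%:R * `|x - y|.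
Proof.
move=> hx hy ne; rewrite bump2E -/(tent x) ge_min; apply/orP; right.
have h := tent_sep hx hy ne; have /andP[h1 _] := tent01 hy.
have -> : 32 * m%:R * `|x - y| = 16 * m%:R * (2 * `|x - y|) by ring.
by apply: ler_wpM2l; [rewrite mulr_ge0|lra].
Qed.

Lemma bump2_eq1 m x : 1 <= 16 * m%:R * tent x -> bump2 m (fpart x) = 1.
Proof. by move=> h; rewrite bump2E; apply/min_idPl. Qed.

End Tent.

Lemma sum_double (R : nmodType) (N : nat) (G : nat -> R) :
  \sum_(j < N.*2) G j = \sum_(j < N) (G j.*2 + G j.*2.+1).
Proof.
elim: N => [|N IH]; first by rewrite !big_ord0.
by rewrite doubleS !big_ord_recr /= IH addrA.
Qed.

Lemma sum_bits (R : comNzRingType) (m : nat) (phi : nat -> bool -> R) :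
  \sum_(j < 2 ^ m) \prod_(0 <= i < m) phi i (bitf j i) =
  \prod_(0 <= i < m) (phi i false + phi i true).
Proof.
elim: m phi => [|m IH] phi; first by rewrite big_ord_recl big_ord0 addr0 !big_geq.
rewrite expnS mul2n.
rewrite (sum_double _ (fun j => \prod_(0 <= i < m.+1) phi i (bitf j i))).
rewrite big_nat_recl //= -(IH (fun i => phi i.+1)) mulr_sumr.
apply: eq_bigr => j _; rewrite !big_nat_recl //= mulrDl; congr (_ * _ + _ * _).
- by rewrite /bitf /= odd_double.
- by apply: eq_bigr => i _; rewrite /bitf iterSr doubleK.
- by rewrite /bitf /= odd_double.
- apply: eq_bigr => i _; rewrite /bitf iterSr.
  by have -> : j.*2.+1./2 = j by rewrite /= uphalf_double.
Qed.

Lemma sum_divn (T a : nat) : (0 < T)%N -> (\sum_(j < T) (a + j) %/ T = a)%N.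
Proof.
move=> hT; elim: a => [|a IH].
  by apply: big1 => j _; rewrite add0n divn_small.
apply: (@addnI (a %/ T)%N); rewrite addnS -addSn.
transitivity (\sum_(j < T.+1) (a + j) %/ T)%N.
  rewrite big_ord_recl /= addn0; congr (_ + _)%N.
  by apply: eq_bigr => j _; rewrite addSnnS.
by rewrite big_ord_recr /= IH divnDr ?dvdnn // divnn hT addn1 addnC addSn -addnS.
Qed.

(** * Shifts and coins *)

Section Count.
Variable R : realType.
Implicit Types x y : R.

Lemma truncn_shift (T j : nat) y : (0 < T)%N -> 0 <= y ->
  Num.truncn (y + j%:R / T%:R) = ((Num.truncn (T%:R * y) + j) %/ T)%N.
Proof.
move=> hT hy; have T0 : 0 < T%:R :> R by rewrite ltr0n.
have /andP[a1 a2] := truncn_itv (mulr_ge0 (ltW T0) hy).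
set a := Num.truncn _ in a1 a2 *.
have hd := divn_eq (a + j) T; have hr := ltn_pmod (a + j) hT.
set d := ((a + j) %/ T)%N in hd *; set r := ((a + j) %% T)%N in hd hr *.
have e : a%:R + j%:R = d%:R * T%:R + r%:R :> R by rewrite -!natrD -natrM hd natrD.
have r1 : r%:R + 1 <= T%:R :> R by rewrite natr1 ler_nat.
have r0 : 0 <= r%:R :> R by [].
rewrite -[a.+1%:R]natr1 in a2.
have ey : (y + j%:R / T%:R) * T%:R = T%:R * y + j%:R.
  by field; rewrite gt_eqF.
apply: truncn_def; rewrite -[d.+1%:R]natr1.
rewrite -(ler_pM2r T0) -(ltr_pM2r T0) ey mulrDl mul1r.
by apply/andP; split; lra.
Qed.

Lemma count_truncn (T : nat) x y : (0 < T)%N -> 0 <= x -> x <= y ->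
  \sum_(j < T) (Num.truncn (x + j%:R / T%:R) != Num.truncn (y + j%:R / T%:R))%:R
    <= T%:R * (y - x) + 1 :> R.
Proof.
move=> hT hx hxy; have hy : 0 <= y by exact: le_trans hxy.
have T0 : 0 <= T%:R :> R by [].
have /andP[a1 a2] := truncn_itv (mulr_ge0 T0 hx).
have /andP[b1 b2] := truncn_itv (mulr_ge0 T0 hy).
set a := Num.truncn _ in a1 a2 *; set b := Num.truncn _ in b1 b2.
have hab : (a <= b)%N by apply: le_truncn; apply: ler_wpM2l.
apply: (@le_trans _ _ (\sum_(j < T) (((b + j) %/ T)%:R - ((a + j) %/ T)%:R))).
  apply: ler_sum => j _; rewrite !truncn_shift // -/a -/b.
  have h : ((a + j) %/ T <= (b + j) %/ T)%N by apply: leq_div2r; rewrite leq_add2r.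
  case: eqP => [->|/eqP ne] /=; first by rewrite subrr.
  by rewrite lerBrDl natr1 ler_nat ltn_neqAle ne h.
rewrite big_split /= sumrN -!natr_sum !sum_divn //.
by rewrite -[a.+1%:R]natr1 in a2; lra.
Qed.

Lemma count_tent (T m : nat) y : (0 < T)%N -> (0 < m)%N -> 1 <= y ->
  \sum_(j < T) (16 * m%:R * tent (y + j%:R / T%:R) < 1)%R%:R
    <= T%:R / (16 * m%:R) + 1 :> R.
Proof.
move=> hT hm hy; pose e : R := (32 * m%:R)^-1.
have m1 : 1 <= m%:R :> R by rewrite ler1n.
have e0 : 0 < e by rewrite invr_gt0; lra.
have e1 : e <= 1 by rewrite invf_le1; lra.
have em : e * m%:R = 32^-1 by rewrite /e; field; rewrite pnatr_eq0 -lt0n.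
have hh : T%:R / (16 * m%:R) = T%:R * (y + e - (y - e)).
  by rewrite /e; field; rewrite pnatr_eq0 -lt0n.
rewrite hh; apply: le_trans (count_truncn hT _ _); [|lra|lra].
apply: ler_sum => j _; case: (ltP _ 1) => h //=.
rewrite ler1n lt0b; apply/eqP => heq.
have j0 : 0 <= j%:R / T%:R :> R by rewrite divr_ge0.
have z0 : 0 <= y + j%:R / T%:R by lra.
have [p hp] := tent_attain z0.
have h2 : `|y + j%:R / T%:R - p%:R| < e.
  move: h; rewrite hp -(ltr_pM2l e0) => h.
  by have -> : `|y + j%:R / T%:R - p%:R| =
    e * (16 * m%:R * (2 * `|y + j%:R / T%:R - p%:R|));
    [move: em; move: `|_| => c em; have := congr1 (fun t => 32 * c * t) em; lra|lra].
move: h2; rewrite ltr_norml => /andP[l1 l2].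
have p1 : (Num.truncn (y - e + j%:R / T%:R) < p)%N by rewrite truncn_lt_nat; lra.
have p2 : (p <= Num.truncn (y + e + j%:R / T%:R))%N by rewrite truncn_ge_nat; lra.
by move: (leq_trans p1 p2); rewrite heq ltnn.
Qed.

End Count.

Section Coins.
Variable R : realType.
Implicit Types (n : nat) (phi psi : seq bool -> R) (x : nat -> R) (l : seq bool).

Fixpoint Ex n phi : R :=
  if n is n'.+1 then
    (Ex n' (fun l => phi (true :: l)) + Ex n' (fun l => phi (false :: l))) / 2
  else phi [::].

Lemma Ex_le n phi psi : (forall l, size l = n -> phi l <= psi l) ->
  Ex n phi <= Ex n psi.
Proof.
elim: n phi psi => [|n IH] phi psi h /=; first exact: h.
rewrite ler_pM2r ?invr_gt0 //; apply: lerD; apply: IH => l hl; apply: h;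
  by rewrite /= hl.
Qed.

Lemma Ex_ext n phi psi : (forall l, size l = n -> phi l = psi l) ->
  Ex n phi = Ex n psi.
Proof. by move=> h; apply/le_anti/andP; split; apply: Ex_le => l /h->. Qed.

Lemma ExD n phi psi : Ex n (fun l => phi l + psi l) = Ex n phi + Ex n psi.
Proof. by elim: n phi psi => //= n IH phi psi; rewrite !IH; lra. Qed.

Lemma ExZ n (a : R) phi : Ex n (fun l => a * phi l) = a * Ex n phi.
Proof. by elim: n phi => //= n IH phi; rewrite !IH; lra. Qed.

Lemma Ex_cst n (a : R) : Ex n (fun=> a) = a.
Proof. by elim: n => //= n ->; lra. Qed.

Lemma Ex_sum (I : Type) (r : seq I) (Q : pred I) n (phi : I -> seq bool -> R) :
  Ex n (fun l => \sum_(i <- r | Q i) phi i l) = \sum_(i <- r | Q i) Ex n (phi i).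
Proof.
elim: r => [|i r IH].
  transitivity (Ex n (fun=> 0)); last by rewrite Ex_cst big_nil.
  by apply: Ex_ext => l _; rewrite big_nil.
rewrite big_cons -IH; case: ifP => hi; last first.
  by apply: Ex_ext => l _; rewrite big_cons hi.
by rewrite -ExD; apply: Ex_ext => l _; rewrite big_cons hi.
Qed.

Lemma Ex_cat a b phi :
  Ex (a + b) phi = Ex a (fun l => Ex b (fun l' => phi (l ++ l'))).
Proof. by elim: a phi => //= a IH phi; rewrite !IH. Qed.

Lemma Ex_ge0 n phi : (forall l, 0 <= phi l) -> 0 <= Ex n phi.
Proof. by move=> h; rewrite -(Ex_cst n 0); apply: Ex_le. Qed.

Lemma Ex_le0 n phi : (forall l, 0 <= phi l) -> Ex n phi <= 0 ->
  forall l, size l = n -> phi l <= 0.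
Proof.
elim: n phi => [|n IH] phi h0 /= h [|b l] //= [hl].
have h1 := @Ex_ge0 n (fun l => phi (true :: l)) (fun l => h0 _).
have h2 := @Ex_ge0 n (fun l => phi (false :: l)) (fun l => h0 _).
by case: b; apply: (IH (fun l => phi (_ :: l))) hl => //; lra.
Qed.

Lemma Ex_markov n phi (mu : R) : (forall l, 0 <= phi l) -> Ex n phi <= mu ->
  Ex n (fun l => (4 * mu < phi l)%R%:R) <= 4^-1.
Proof.
move=> h0 h; have mu0 : 0 <= mu by apply: le_trans h; exact: Ex_ge0.
have [z|nz] := eqVneq mu 0.
  rewrite z in h; apply: (@le_trans _ _ (Ex n (fun=> 0))); last first.
    by rewrite Ex_cst; lra.
  apply: Ex_le => l hl; rewrite z mulr0 ltNge.
  by rewrite (Ex_le0 h0 h hl).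
have mu1 : 0 < mu by rewrite lt0r nz.
apply: (@le_trans _ _ (Ex n (fun l => (4 * mu)^-1 * phi l))); last first.
  by rewrite ExZ mulrC ler_pdivrMr; [apply: le_trans h _|]; lra.
apply: Ex_le => l _; case: ltP => hl /=; last first.
  by rewrite mulr_ge0 // invr_ge0; lra.
by rewrite mulrC ler_pdivlMr; lra.
Qed.

Definition sg (b : bool) : R := 2 * (b : nat)%:R - 1.

Definition lin n x l : R := \sum_(0 <= s < n) sg (nth false l s) * x s.
Definition nrm2 n x : R := \sum_(0 <= s < n) x s ^+ 2.

Lemma lin_cons n x b l :
  lin n.+1 x (b :: l) = sg b * x 0%N + lin n (fun s => x s.+1) l.
Proof. by rewrite /lin big_nat_recl. Qed.

Lemma nrm2S n x : nrm2 n.+1 x = x 0%N ^+ 2 + nrm2 n (fun s => x s.+1).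
Proof. by rewrite /nrm2 big_nat_recl. Qed.

Lemma nrm2_ge0 n x : 0 <= nrm2 n x.
Proof. by apply: sumr_ge0 => s _; exact: sqr_ge0. Qed.

Lemma sg_true : sg true = 1. Proof. by rewrite /sg /= mulr1; lra. Qed.
Lemma sg_false : sg false = -1. Proof. by rewrite /sg /= mulr0 sub0r. Qed.

Lemma Ex_lin2 n x : Ex n (fun l => lin n x l ^+ 2) = nrm2 n x.
Proof.
elim: n x => [|n IH] x; first by rewrite /= /lin /nrm2 !big_geq // expr0n.
rewrite nrm2S -IH /= -ExD.
transitivity (Ex n (fun l => x 0%N ^+ 2 + lin n (fun s => x s.+1) l ^+ 2)).
  rewrite [LHS]mulrC -ExZ; apply: Ex_ext => l _.
  by rewrite !lin_cons sg_true sg_false; field.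
by rewrite ExD Ex_cst.
Qed.

Lemma Ex_lin4 n x : Ex n (fun l => lin n x l ^+ 4) <= 3 * nrm2 n x ^+ 2.
Proof.
elim: n x => [|n IH] x; first by rewrite /= /lin /nrm2 !big_geq // !expr0n mulr0.
rewrite nrm2S /= -ExD.
set y := fun s => x s.+1; have h4 := IH y; have h2 := Ex_lin2 n y.
have -> : Ex n (fun l => lin n.+1 x (true :: l) ^+ 4 +
      lin n.+1 x (false :: l) ^+ 4) / 2 =
   x 0%N ^+ 4 + 6 * x 0%N ^+ 2 * nrm2 n y + Ex n (fun l => lin n y l ^+ 4).
  rewrite -h2 -ExZ -{1}[x 0%N ^+ 4](Ex_cst n) -!ExD [LHS]mulrC -ExZ.
  by apply: Ex_ext => l _; rewrite !lin_cons sg_true sg_false; field.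
have := sqr_ge0 (x 0%N); have := nrm2_ge0 n y; rewrite !expr2 in h4 *.
by have := sqr_ge0 (x 0%N ^+ 2); rewrite !exprS expr0; nra.
Qed.

(* Paley-Zygmund for the square of a Rademacher sum, from
   Y <= D/4 + Y^2/(8D) + 2D [Y >= D/4] with D the second moment. *)
Lemma Ex_lin_small n x : 1 <= nrm2 n x ->
  Ex n (fun l => (`|lin n x l| < 2^-1)%R%:R) <= 13 / 16.
Proof.
move=> hD; set D := nrm2 n x in hD *.
have D0 : 0 < D by lra.
have h : D <= Ex n (fun l => D / 4 + (8 * D)^-1 * lin n x l ^+ 4 +
     2 * D * (1 - (`|lin n x l| < 2^-1)%R%:R)).
  rewrite -{1}/D -{1}[D](Ex_lin2 n x); apply: Ex_le => l _.
  have -> : lin n x l ^+ 4 = (lin n x l ^+ 2) ^+ 2 by rewrite -exprM.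
  rewrite -(sqr_normr (lin n x l)); have a0 := normr_ge0 (lin n x l).
  move: `|lin n x l| a0 => a a0.
  have ha : 0 <= (8 * D)^-1 * (a ^+ 2) ^+ 2.
    by rewrite mulr_ge0 ?sqr_ge0 // invr_ge0; lra.
  case: ltP => h /=; first by rewrite expr2 in ha *; nra.
  have : (8 * D)^-1 * (a ^+ 2) ^+ 2 + 2 * D - a ^+ 2 =
      (8 * D)^-1 * (a ^+ 2 - 4 * D) ^+ 2 by field; rewrite gt_eqF.
  have : 0 <= (8 * D)^-1 * (a ^+ 2 - 4 * D) ^+ 2.
    by rewrite mulr_ge0 ?sqr_ge0 // invr_ge0; lra.
  by lra.
rewrite !ExD Ex_cst !ExZ in h.
have e : Ex n (fun l => 1 - (`|lin n x l| < 2^-1)%R%:R) =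
   1 - Ex n (fun l => (`|lin n x l| < 2^-1)%R%:R).
  transitivity (Ex n (fun l => 1 + -1 * (`|lin n x l| < 2^-1)%R%:R)).
    by apply: Ex_ext => l _; rewrite mulN1r.
  by rewrite ExD Ex_cst ExZ mulN1r.
rewrite e in h; clear e.
have e8 : (8 * D)^-1 * Ex n (fun l => lin n x l ^+ 4) <= 3 / 8 * D.
  have := Ex_lin4 n x; rewrite -/D => h4.
  apply: (@le_trans _ _ ((8 * D)^-1 * (3 * D ^+ 2))).
    by apply: ler_wpM2l => //; rewrite invr_ge0; lra.
  by rewrite le_eqVlt; apply/orP; left; apply/eqP; field; rewrite gt_eqF.
move: h e8; set p := Ex n (fun l => (_ < _)%R%:R); set u := _ * Ex n _ => h e8.
by rewrite -(ler_pM2l D0); nra.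
Qed.

Definition coin_row k i l : seq bool := drop (i * k) l.

Lemma lin_row k i l x :
  lin k x (coin_row k i l) = \sum_(0 <= s < k) sg (nth false l (i * k + s)) * x s.
Proof. by apply: eq_bigr => s _; rewrite nth_drop. Qed.

Lemma lin_prefix k x l l' : size l = k -> lin k x (l ++ l') = lin k x l.
Proof.
move=> hl; rewrite /lin big_nat [RHS]big_nat; apply: eq_bigr => s /andP[_ hs].
by rewrite nth_cat hl hs.
Qed.

Lemma Ex_row k i T x (phi : R -> R) : (i.+1 * k <= T)%N ->
  Ex T (fun l => phi (lin k x (coin_row k i l))) = Ex k (fun l => phi (lin k x l)).
Proof.
move=> hT; have -> : T = (i * k + (k + (T - i.+1 * k)))%N.
  by rewrite addnA -mulSnr subnKC.
rewrite Ex_cat -[RHS](Ex_cst (i * k)); apply: Ex_ext => l1 h1.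
rewrite Ex_cat; apply: Ex_ext => l2 h2.
rewrite -[RHS](Ex_cst (T - i.+1 * k)); apply: Ex_ext => l3 _.
by rewrite /coin_row drop_size_cat // lin_prefix.
Qed.

Lemma Ex_rows k M T x (B : pred R) : (M * k <= T)%N ->
  Ex T (fun l => \prod_(0 <= i < M) (B (lin k x (coin_row k i l)))%:R) =
  Ex k (fun l => (B (lin k x l))%:R) ^+ M.
Proof.
elim: M T => [|M IH] T hT.
  rewrite expr0 -[RHS](Ex_cst T); apply: Ex_ext => l _.
  by rewrite big_geq.
have -> : T = (k + (T - k))%N.
  by rewrite subnKC //; apply: leq_trans hT; rewrite mulSn leq_addr.
rewrite exprS -(IH (T - k)%N); last by rewrite leq_subRL ?(leq_trans _ hT) // mulSn ?leq_addr.
rewrite Ex_cat mulrC -ExZ; apply: Ex_ext => l1 h1.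
rewrite mulrC -ExZ; apply: Ex_ext => l2 h2.
rewrite big_nat_recl // /coin_row mul0n drop0 lin_prefix //; congr (_ * _).
apply: eq_bigr => i _; rewrite mulSn addnC -drop_drop drop_size_cat //.
Qed.

Lemma card_tupleS n (g : seq bool -> bool) :
  #|[pred w : n.+1.-tuple bool | g w]| =
  (#|[pred w : n.-tuple bool | g (true :: w)]| +
   #|[pred w : n.-tuple bool | g (false :: w)]|)%N.
Proof.
rewrite -!sum1_card big_mkcond.
rewrite (reindex (fun p : bool * n.-tuple bool => [tuple of p.1 :: p.2])) /=.
  rewrite (eq_bigr (fun p : bool * n.-tuple bool => (g (p.1 :: p.2) : nat)));
    last by move=> p _; rewrite inE /=; case: (g _).
  rewrite -(pair_bigA _ (fun b (w : n.-tuple bool) => (g (b :: w) : nat))).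
  rewrite big_bool; congr (_ + _)%N; rewrite [RHS]big_mkcond;
    by apply: eq_bigr => w _; rewrite inE /=; case: (g _).
exists (fun w => (thead w, [tuple of behead w])) => [[b w] _|w _] /=.
  by congr (_, _); apply: val_inj.
by rewrite -tuple_eta.
Qed.

Lemma coin_probE T (g : seq bool -> bool) :
  coin_prob R (fun w : T.-tuple bool => g w) = Ex T (fun l => (g l)%:R).
Proof.
rewrite /coin_prob; elim: T g => [|T IH] g.
  rewrite expr0 divr1 /=; congr (_%:R).
  case hg : (g [::]).
    by apply: (@eq_card1 _ [tuple]) => w; rewrite (tuple0 w) !inE eqxx; exact: hg.
  by apply: eq_card0 => w; rewrite (tuple0 w) inE; exact: hg.
rewrite /= -(IH (fun l => g (true :: l))) -(IH (fun l => g (false :: l))).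
rewrite -mulrDl -natrD -card_tupleS exprS.
by rewrite invfM [2^-1 * _]mulrC mulrA.
Qed.

End Coins.

(** * Sweep cuts *)

Section Cheeger.
Variables (R : realType) (V : finType) (H : hypergraph R V).
Implicit Types (y g : V -> R) (S : {set V}) (o : {set V} -> R).

Definition cut S : R := \sum_(e in boundary H S) weight H e.
Definition mass y : R := \sum_v vweight H v * y v.

Lemma vweight_gt0 v : 0 < vweight H v. Proof. exact: edge_sum_gt0. Qed.

Lemma vweight_ge0 v : 0 <= vweight H v. Proof. exact: ltW (vweight_gt0 v). Qed.

Lemma volume_gt0 S : S != set0 -> 0 < volume H S.
Proof.
case/set0Pn => v hv; rewrite /volume (bigD1 v) //=.
apply: ltr_wpDr; last exact: vweight_gt0.
by apply: sumr_ge0 => u _; exact: ltW (vweight_gt0 u).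
Qed.

Lemma volumeE S : volume H S = \sum_(e in edges H) weight H e * #|e :&: S|%:R.
Proof.
rewrite /volume /vweight /edge_sum (exchange_big_dep (mem (edges H))) /=; last first.
  by move=> v e _ /andP[].
apply: eq_bigr => e he; rewrite -sum1_card natr_sum mulr_sumr.
apply: eq_big => [v|v _]; first by rewrite !inE he andbC.
by rewrite mulr1.
Qed.

Lemma cutE S : cut S = \sum_(e in edges H)
  weight H e * ((e :&: S != set0) && (e :&: ~: S != set0))%:R.
Proof.
rewrite /cut big_mkcond [RHS]big_mkcond; apply: eq_bigr => e _.
by rewrite inE; case: (e \in edges H) => //=; case: (_ && _);
  rewrite ?mulr1 ?mulr0.
Qed.

Lemma massE y : mass y = \sum_(e in edges H) weight H e * \sum_(v in e) y v.
Proof.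
rewrite /mass /vweight /edge_sum.
under eq_bigr do rewrite mulr_suml.
rewrite (exchange_big_dep (mem (edges H))) /=; last by move=> v e _ /andP[].
by apply: eq_bigr => e he; rewrite mulr_sumr; apply: eq_bigl => v; rewrite he.
Qed.

(* Layer-cake argument: subtract the least positive value of y on its support
   and iterate. *)
Lemma sweep_cut y o lam :
  (forall v, 0 <= y v) ->
  (forall e u v, e \in edges H -> u \in e -> v \in e -> y u - y v <= o e) ->
  (exists v, 0 < y v) ->
  \sum_(e in edges H) weight H e * o e <= lam * mass y ->
  exists2 c, 0 < y c &
    cut [set v | y c <= y v] <= lam * volume H [set v | y c <= y v].
Proof.
move=> y0 yo ypos hle.
case: (pickP (fun c => (0 < y c) &&
    (cut [set v | y c <= y v] <= lam * volume H [set v | y c <= y v]))).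
  by move=> c /andP[h1 h2]; exists c.
move=> hno; exfalso.
have {hno} hno c : 0 < y c ->
    lam * volume H [set v | y c <= y v] < cut [set v | y c <= y v].
  by move=> hc; have := hno c; rewrite hc /= ltNge => ->.
suff : lam * mass y < \sum_(e in edges H) weight H e * o e by rewrite ltNge hle.
case: ypos => v0 hv0 {hle}.
suff gen (N : nat) y' o' : (#|[set v | (0 < y' v)%R]| <= N)%N ->
    (forall v, 0 <= y' v) ->
    (forall e u v, e \in edges H -> u \in e -> v \in e -> y' u - y' v <= o' e) ->
    (forall c, 0 < y' c ->
      lam * volume H [set v | y' c <= y' v] < cut [set v | y' c <= y' v]) ->
    lam * mass y' <= \sum_(e in edges H) weight H e * o' e /\
    ((exists v, 0 < y' v) ->
      lam * mass y' < \sum_(e in edges H) weight H e * o' e).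
  by have [_ h] := gen _ y o (leqnn _) y0 yo hno; apply: h; exists v0.
move: N y' o' {y o y0 yo v0 hv0 hno}; elim=> [|N IH] y o hN y0 yo hno.
  have ze v : y v = 0.
    apply/eqP; rewrite eq_le y0 andbT leNgt; apply/negP => hv.
    by move: hN; rewrite leqn0 cards_eq0 => /eqP/setP/(_ v); rewrite !inE hv.
  split; last by case=> v; rewrite ze ltxx.
  rewrite /mass big1 ?mulr0; last by move=> v _; rewrite ze mulr0.
  apply: sumr_ge0 => e he; rewrite mulr_ge0 ?weight_ge0 //.
  have /set0Pn[u hu] := edges_neq0 he.
  by apply: le_trans (yo e u u he hu hu); rewrite subrr.
case: (pickP (fun v => 0 < y v)) => [v0 hv0|none]; last first.
  have [] // := IH y o _ y0 yo hno.
  by rewrite (_ : [set v | _] = set0) ?cards0 //; apply/setP => v; rewrite !inE none.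
case: (@arg_minP _ _ _ v0 (fun v => 0 < y v) y hv0) => c0 hc0 hmin.
set S := [set v | 0 < y v]; set mu := y c0.
have SE : S = [set v | y c0 <= y v].
  apply/setP => v; rewrite !inE; apply/idP/idP; first exact: hmin.
  exact: lt_le_trans.
have hS := hno c0 hc0; rewrite -SE in hS.
pose y' v := if v \in S then y v - mu else 0.
pose o' e := o e - mu * ((e :&: S != set0) && (e :&: ~: S != set0))%:R.
have y'0 v : 0 <= y' v.
  by rewrite /y' inE; case: ifP => // hv; rewrite subr_ge0 hmin.
have yz v : v \notin S -> y v = 0.
  by rewrite inE -leNgt => h; apply/eqP; rewrite eq_le h y0.
have y'o e u v : e \in edges H -> u \in e -> v \in e -> y' u - y' v <= o' e.
  move=> he hu hv; rewrite /o'; case hb : (_ && _).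
    move: hb => /andP[/set0Pn[a]]; rewrite inE => /andP[ae aS] /set0Pn[b]; rewrite !inE => /andP[be].
    rewrite -leNgt => yb; have {}yb : y b = 0 by apply/eqP; rewrite eq_le yb y0.
    rewrite mulr1; apply: (@le_trans _ _ (y' u)); first by rewrite gerBl.
    rewrite /y'; case: ifP => uS.
      by rewrite lerB //; have := yo e u b he hu be; rewrite yb subr0.
    rewrite subr_ge0; apply: le_trans (yo e a b he ae be); rewrite yb subr0.
    by apply: hmin; move: aS; rewrite inE.
  rewrite mulr0 subr0 /y'.
  have hh a b : a \in e -> b \in e -> a \in S -> b \notin S -> False.
    move=> ae be aS bS; move/negP: hb; apply; apply/andP; split; apply/set0Pn.
      by exists a; rewrite inE ae.
    by exists b; rewrite !inE be /=; move: bS; rewrite inE.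
  case: ifP => uS; case: ifP => vS.
  - by have := yo e u v he hu hv; lra.
  - by case: (hh u v) => //; rewrite vS.
  - by case: (hh v u) => //; rewrite uS.
  - by rewrite subrr; apply: le_trans (yo e u u he hu hu); rewrite subrr.
have level c : 0 < y' c -> [set v | y' c <= y' v] = [set v | y c <= y v] /\ 0 < y c.
  rewrite /y'; case: ifP => cS hc; last by rewrite ltxx in hc.
  have yc : 0 < y c by move: cS; rewrite inE.
  split=> //; apply/setP => v; rewrite !inE; case: ifP => vS; first by rewrite lerD2r.
  have -> : (y c <= y v) = false by rewrite (yz v) ?inE ?vS // leNgt yc.
  by rewrite leNgt hc.
have hno' c : 0 < y' c ->
    lam * volume H [set v | y' c <= y' v] < cut [set v | y' c <= y' v].
  by move=> /level[-> hc]; exact: hno.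
have sub : (#|[set v | (0 < y' v)%R]| <= N)%N.
  rewrite -ltnS; apply: leq_trans hN; apply: proper_card; apply/properP; split.
    by apply/subsetP => v; rewrite !inE => /level[].
  exists c0; first by rewrite inE.
  by rewrite inE /y' inE hc0 subrr ltxx.
have [ih _] := IH y' o' sub y'0 y'o hno'.
have em : mass y = mass y' + mu * volume H S.
  rewrite /mass /volume mulr_sumr [X in _ + X]big_mkcond -big_split /=.
  apply: eq_bigr => v _; rewrite /y'; case vS: (v \in S); first by ring.
  by rewrite (yz v (negbT vS)) mulr0 addr0.
have eo : \sum_(e in edges H) weight H e * o e =
    \sum_(e in edges H) weight H e * o' e + mu * cut S.
  rewrite cutE mulr_sumr -big_split /=; apply: eq_bigr => e _.
  by rewrite /o'; ring.
have key : lam * mass y < \sum_(e in edges H) weight H e * o e.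
  rewrite em eo mulrDr; apply: ler_ltD ih _.
  by rewrite mulrCA ltr_pM2l.
by split=> //; exact: ltW.
Qed.

Lemma family_sweep (J : finType) (Q : pred J) (g : J -> V -> R)
    (p : J -> {set V} -> R) (Pt lam : R) :
  (forall j v, 0 <= g j v) -> (forall j e, 0 <= p j e) ->
  (forall j e u v, Q j -> e \in edges H -> u \in e -> v \in e ->
     g j u - g j v <= p j e) ->
  0 < \sum_(j | Q j) mass (fun v => g j v ^+ 2) -> 0 <= lam ->
  \sum_(j | Q j) \sum_(e in edges H) weight H e * p j e ^+ 2 <= Pt ->
  4 * Pt <= lam ^+ 2 * \sum_(j | Q j) mass (fun v => g j v ^+ 2) ->
  exists j c, [/\ Q j, 0 < g j c &
    cut [set v | g j c <= g j v] <= lam * volume H [set v | g j c <= g j v]].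
Proof.
move=> g0 p0 gp Mt0 lam0 hPt hlam.
pose mx j (e : {set V}) : R := Num.sqrt (\sum_(v in e) g j v ^+ 2).
have mx0 j e : 0 <= mx j e by exact: sqrtr_ge0.
have mx2 j e : mx j e ^+ 2 = \sum_(v in e) g j v ^+ 2.
  by rewrite sqr_sqrtr // sumr_ge0 // => v _; exact: sqr_ge0.
have gmx j (e : {set V}) u : u \in e -> g j u <= mx j e.
  move=> hu; rewrite -(ger0_norm (g0 j u)) -sqrtr_sqr; apply: ler_wsqrtr.
  by rewrite (bigD1 u) //= lerDl sumr_ge0 // => v _; exact: sqr_ge0.
pose o j e := 2 * p j e * mx j e.
set Mt := \sum_(j | Q j) _ in Mt0 hlam.
have MtE : Mt = \sum_(j | Q j) \sum_(e in edges H) weight H e * mx j e ^+ 2.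
  apply: eq_bigr => j _; rewrite massE; apply: eq_bigr => e _.
  by rewrite mx2.
have tot : \sum_(j | Q j) \sum_(e in edges H) weight H e * o j e <= lam * Mt.
  have [lz|lnz] := eqVneq lam 0.
    have PtM : Pt <= 0 by move: hlam; rewrite lz expr0n /= mul0r; lra.
    have wp j e : Q j -> e \in edges H -> weight H e * p j e ^+ 2 = 0.
      have t0 j' e' : e' \in edges H -> 0 <= weight H e' * p j' e' ^+ 2.
        by move=> h; rewrite mulr_ge0 ?sqr_ge0 ?weight_ge0.
      move=> hj he; apply/eqP; rewrite eq_le t0 // andbT.
      apply: le_trans PtM; apply: le_trans hPt; rewrite (bigD1 j) //= (bigD1 e) //=.
      rewrite -addrA lerDl addr_ge0 //; first by apply: sumr_ge0 => e' /andP[/t0].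
      by apply: sumr_ge0 => j' _; apply: sumr_ge0 => e' /t0.
    rewrite lz mul0r big1 // => j hj; rewrite big1 // => e he.
    have /eqP := wp j e hj he; rewrite mulf_eq0 sqrf_eq0 => /orP[] /eqP h.
      by rewrite h mul0r.
    by rewrite /o h mulr0 mul0r mulr0.
  have l0 : 0 < lam by rewrite lt0r lnz.
  apply: (@le_trans _ _ (2 / lam * Pt + lam / 2 * Mt)); last first.
    have -> : 2 / lam * Pt = 4 * Pt / (2 * lam) by field; rewrite lnz.
    have : 4 * Pt / (2 * lam) <= lam ^+ 2 * Mt / (2 * lam).
      by rewrite ler_pM2r // invr_gt0; lra.
    have -> : lam ^+ 2 * Mt / (2 * lam) = lam * Mt / 2 by field; rewrite lnz.
    by lra.
  rewrite MtE; apply: (@le_trans _ _ (2 / lam *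
     (\sum_(j | Q j) \sum_(e in edges H) weight H e * p j e ^+ 2) +
     lam / 2 * \sum_(j | Q j) \sum_(e in edges H) weight H e * mx j e ^+ 2));
    last by rewrite lerD2r ler_wpM2l // divr_ge0.
  rewrite !mulr_sumr -big_split; apply: ler_sum => j _.
  rewrite !mulr_sumr -big_split; apply: ler_sum => e he /=.
  have w0 := weight_ge0 he.
  have -> : 2 / lam * (weight H e * p j e ^+ 2) +
      lam / 2 * (weight H e * mx j e ^+ 2) =
    weight H e * (2 / lam * p j e ^+ 2 + lam / 2 * mx j e ^+ 2) by ring.
  apply: ler_wpM2l => //; rewrite /o -subr_ge0.
  have -> : 2 / lam * p j e ^+ 2 + lam / 2 * mx j e ^+ 2 - 2 * p j e * mx j e =
     2 / lam * (p j e - lam / 2 * mx j e) ^+ 2 by field; rewrite lnz.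
  by rewrite mulr_ge0 ?sqr_ge0 // divr_ge0.
case: (pickP (fun j => [&& Q j, 0 < mass (fun v => g j v ^+ 2) &
    \sum_(e in edges H) weight H e * o j e <=
      lam * mass (fun v => g j v ^+ 2)])) => [j /and3P[hj hm ho]|none].
  have [|||c hc hcut] := @sweep_cut (fun v => g j v ^+ 2) (o j) lam _ _ _ ho.
  - by move=> v; exact: sqr_ge0.
  - move=> e u v he hu hv; rewrite subr_sqr /o.
    have h1 := gp j e u v hj he hu hv; have h2 := gmx j e u hu.
    have h3 := gmx j e v hv; have h4 := g0 j u; have h5 := g0 j v.
    have h6 := p0 j e.
    apply: (@le_trans _ _ (p j e * (g j u + g j v))).
      by apply: ler_wpM2r => //; exact: addr_ge0.
    have -> : 2 * p j e * mx j e = p j e * (mx j e + mx j e) by ring.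
    by apply: ler_wpM2l => //; exact: lerD.
  - case: (pickP (fun v => 0 < g j v ^+ 2)) => [v hv|nv]; first by exists v.
    move: hm; rewrite /mass big1 ?ltxx // => v _.
    have := nv v; rewrite lt0r sqr_ge0 andbT => /negbFE/eqP->.
    by rewrite mulr0.
  exists j, c; split=> //.
    by rewrite lt0r g0 andbT; apply: contraTneq hc => ->; rewrite expr0n ltxx.
  have -> : [set v | g j c <= g j v] = [set v | g j c ^+ 2 <= g j v ^+ 2].
    by apply/setP => v; rewrite !inE ler_sqr // nnegrE.
  exact: hcut.
exfalso; move: tot; rewrite leNgt; apply/negP/negPn.
have ho j : Q j -> lam * mass (fun v => g j v ^+ 2) <=
    \sum_(e in edges H) weight H e * o j e.
  move=> hj; have := none j; rewrite hj /=; case: ltP => [hm /negbT|hm _].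
    by rewrite -ltNge => /ltW.
  apply: (@le_trans _ _ 0).
    by rewrite mulr_ge0_le0.
  apply: sumr_ge0 => e he; rewrite mulr_ge0 ?weight_ge0 // /o.
  by rewrite mulr_ge0 // mulr_ge0.
have [j1 hj1 hm1] : exists2 j1, Q j1 & 0 < mass (fun v => g j1 v ^+ 2).
  case: (pickP (fun j => Q j && (0 < mass (fun v => g j v ^+ 2)))) => [j /andP[]|nj].
    by exists j.
  move: Mt0; rewrite ltNge; case/negP; apply: sumr_le0 => j hj.
  by have := nj j; rewrite hj /= => /negbT; rewrite -leNgt.
rewrite /Mt mulr_sumr (bigD1 j1) //= [ltRHS](bigD1 j1) //=.
apply: ltr_leD; last by apply: ler_sum => j /andP[hj _]; exact: ho.
by have := none j1; rewrite hj1 hm1 /= => /negbT; rewrite -ltNge.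
Qed.

End Cheeger.

(** * Geometry of the embedding *)

Lemma sqr_sum_le (R : realType) k (y : nat -> R) :
  (\sum_(0 <= s < k) y s) ^+ 2 <= k%:R * \sum_(0 <= s < k) y s ^+ 2.
Proof.
elim: k => [|k IH]; first by rewrite !big_geq // expr0n mul0r.
rewrite !big_nat_recr //= -natr1.
move: IH; set S := \sum_(0 <= s < k) y s; set N := \sum_(0 <= s < k) y s ^+ 2.
have N0 : 0 <= N by apply: sumr_ge0 => s _; exact: sqr_ge0.
move: (y k) => a IH.
have [k0|k0] := posnP k.
  by rewrite {1}/S k0 big_geq // !add0r mul1r lerDr.
have k1 : 0 < k%:R :> R by rewrite ltr0n.
suff : 2 * a * S <= k%:R * a ^+ 2 + N by rewrite !expr2 in IH *; nra.
rewrite -(ler_pM2l k1).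
by have := sqr_ge0 (k%:R * a - S); rewrite !expr2 in IH *; nra.
Qed.

Section Embedding.
Variables (R : realType) (V : finType) (H : hypergraph R V).
Variables (k : nat) (fn : nat -> V -> R).
Hypothesis orth : forall s t, (s < k)%N -> (t < k)%N ->
  \sum_v vweight H v * fn s v * fn t v = (s == t)%:R.

Local Notation wv := (vweight H).

Definition dot u v : R := \sum_(0 <= s < k) fn s u * fn s v.
Definition nu v : R := Num.sqrt (dot v v).
Definition hn s v : R := fn s v / nu v.
Definition dist2 u v : R := nrm2 k (fun s => fn s u - fn s v).
Definition hdist2 u v : R := nrm2 k (fun s => hn s u - hn s v).

Lemma nu_ge0 v : 0 <= nu v. Proof. exact: sqrtr_ge0. Qed.

Lemma nu2 v : nu v ^+ 2 = dot v v.
Proof. by rewrite sqr_sqrtr // sumr_ge0 // => s _; rewrite -expr2 sqr_ge0. Qed.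

Lemma nu0 v s : nu v = 0 -> (s < k)%N -> fn s v = 0.
Proof.
move=> h hs; have : dot v v = 0 by rewrite -nu2 h expr0n.
rewrite /dot big_mkord => /eqP; rewrite psumr_eq0; last first.
  by move=> i _; rewrite -expr2 sqr_ge0.
move=> /allP /(_ (Ordinal hs)); rewrite mem_index_enum => /(_ isT) /=.
by rewrite -expr2 sqrf_eq0 => /eqP.
Qed.

Lemma dist2E u v : dist2 u v = nu u ^+ 2 + nu v ^+ 2 - 2 * dot u v.
Proof.
rewrite !nu2 /dist2 /nrm2 /dot mulr_sumr -big_split -sumrB /=.
by apply: eq_bigr => s _; ring.
Qed.

Lemma dist2_ge0 u v : 0 <= dist2 u v. Proof. exact: nrm2_ge0. Qed.
Lemma hdist2_ge0 u v : 0 <= hdist2 u v. Proof. exact: nrm2_ge0. Qed.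

Lemma hdist2E u v : nu u != 0 -> nu v != 0 ->
  nu u * nu v * hdist2 u v = 2 * nu u * nu v - 2 * dot u v.
Proof.
move=> hu hv; rewrite /hdist2 /nrm2.
have -> : \sum_(0 <= s < k) (hn s u - hn s v) ^+ 2 =
   dot u u / nu u ^+ 2 + dot v v / nu v ^+ 2 - 2 * dot u v / (nu u * nu v).
  rewrite /dot mulr_sumr !mulr_suml -big_split -sumrB /=.
  by apply: eq_bigr => s _; rewrite /hn; field; rewrite hu hv.
by rewrite -!nu2; field; rewrite hu hv.
Qed.

Lemma dot_le u v : dot u v <= nu u * nu v.
Proof.
have [hu|hu] := eqVneq (nu u) 0.
  rewrite hu mul0r /dot big_nat big1 // => s /andP[_ hs].
  by rewrite (nu0 hu hs) mul0r.
have [hv|hv] := eqVneq (nu v) 0.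
  rewrite hv mulr0 /dot big_nat big1 // => s /andP[_ hs].
  by rewrite (nu0 hv hs) mulr0.
have := hdist2E hu hv.
have : 0 <= nu u * nu v * hdist2 u v.
  by rewrite mulr_ge0 ?hdist2_ge0 // mulr_ge0 // nu_ge0.
by lra.
Qed.

Lemma hdist2_le u v : nu u * nu v * hdist2 u v <= dist2 u v.
Proof.
have [hu|hu] := eqVneq (nu u) 0; first by rewrite hu !mul0r dist2_ge0.
have [hv|hv] := eqVneq (nu v) 0; first by rewrite hv mulr0 mul0r dist2_ge0.
rewrite hdist2E // dist2E; have := sqr_ge0 (nu u - nu v).
by rewrite !expr2; nra.
Qed.

Lemma nu_dist u v : (nu u - nu v) ^+ 2 <= dist2 u v.
Proof. by rewrite dist2E; have := dot_le u v; rewrite !expr2; nra. Qed.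

Lemma isotropy (x : nat -> R) :
  \sum_u wv u * (\sum_(0 <= s < k) fn s u * x s) ^+ 2 = nrm2 k x.
Proof.
have e u : wv u * (\sum_(0 <= s < k) fn s u * x s) ^+ 2 =
   \sum_(s < k) \sum_(t < k) x s * x t * (wv u * fn s u * fn t u).
  rewrite big_mkord expr2 big_distrlr mulr_sumr; apply: eq_bigr => s _.
  by rewrite mulr_sumr; apply: eq_bigr => t _ /=; ring.
under eq_bigr => u _ do rewrite e.
rewrite exchange_big /= /nrm2 big_mkord.
apply: eq_bigr => s _; rewrite exchange_big (bigD1 s) //= [X in _ + X]big1.
  by rewrite -mulr_sumr orth // eqxx addr0 mulr1 expr2.
move=> t hts; rewrite -mulr_sumr orth //.
by rewrite eq_sym (inj_eq val_inj) (negPf hts) mulr0.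
Qed.

Lemma total_mass : \sum_v wv v * nu v ^+ 2 = k%:R.
Proof.
under eq_bigr do rewrite nu2 /dot mulr_sumr.
rewrite exchange_big /= big_mkord.
under eq_bigr => s _.
  under eq_bigr do rewrite mulrA.
  by rewrite orth // eqxx; over.
by rewrite sumr_const card_ord.
Qed.

Lemma unit_nrm2 v : nu v != 0 -> nrm2 k (fun s => hn s v) = 1.
Proof.
move=> hv; rewrite /nrm2 /hn.
transitivity (dot v v / nu v ^+ 2); last by rewrite -nu2 divff // expf_neq0.
by rewrite /dot mulr_suml; apply: eq_bigr => s _; rewrite expr_div_n expr2.
Qed.

Lemma near_mass v :
  \sum_u wv u * nu u ^+ 2 * (hdist2 u v < 1)%R%:R <= 4.
Proof.
have w0 u : 0 <= wv u by exact: ltW (vweight_gt0 H u).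
have [hv|hv] := eqVneq (nu v) 0.
  rewrite big1 ?ler0n // => u _.
  have [hu|hu] := eqVneq (nu u) 0; first by rewrite hu expr0n mulr0 mul0r.
  suff -> : (hdist2 u v < 1) = false by rewrite mulr0.
  rewrite -(unit_nrm2 hu) /hdist2 /nrm2.
  apply/negbTE; rewrite -leNgt le_eqVlt; apply/orP; left; apply/eqP.
  by apply: eq_bigr => s _; rewrite [hn s v]/hn hv invr0 mulr0 subr0.
have one := isotropy (fun s => hn s v); rewrite (unit_nrm2 hv) in one.
rewrite -[leRHS]mulr1 -[X in _ <= _ * X]one mulr_sumr; apply: ler_sum => u _.
have -> : \sum_(0 <= s < k) fn s u * hn s v = dot u v / nu v.
  by rewrite /dot mulr_suml; apply: eq_bigr => s _; rewrite /hn mulrA.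
rewrite [leRHS]mulrCA -mulrA; apply: ler_wpM2l => //.
case: ltP => h; last by rewrite mulr0 mulr_ge0 // ?sqr_ge0.
rewrite mulr1; have [hu|hu] := eqVneq (nu u) 0.
  by rewrite hu expr0n mulr_ge0 // ?sqr_ge0.
have u0 : 0 < nu u by rewrite lt0r hu nu_ge0.
have v0 : 0 < nu v by rewrite lt0r hv nu_ge0.
have e := hdist2E hu hv.
have h2 : nu u * nu v * hdist2 u v < nu u * nu v.
  by rewrite gtr_pMr // mulr_gt0.
have h3 : nu u / 2 <= dot u v / nu v by rewrite ler_pdivlMr //; lra.
by rewrite !expr2; nra.
Qed.

Lemma mass_le1 v : wv v * nu v ^+ 2 <= 1.
Proof.
have w0 u : 0 <= wv u by exact: ltW (vweight_gt0 H u).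
have [hv|hv] := eqVneq (nu v) 0; first by rewrite hv expr0n mulr0.
rewrite -(unit_nrm2 hv) -isotropy (bigD1 v) //=.
have -> : \sum_(0 <= s < k) fn s v * hn s v = nu v.
  transitivity (dot v v / nu v); last by rewrite -nu2 expr2 mulfK.
  by rewrite /dot mulr_suml; apply: eq_bigr => s _; rewrite /hn mulrA.
by rewrite lerDl sumr_ge0 // => u _; rewrite mulr_ge0 // ?sqr_ge0.
Qed.

Lemma dim_le : (k <= #|V|)%N.
Proof.
rewrite -(ler_nat R) -total_mass -sum1_card natr_sum; apply: ler_sum => v _.
exact: mass_le1.
Qed.

Definition osc2 (e : {set V}) : R :=
  \sum_(s < k) \big[Num.max/0]_(u in e) \big[Num.max/0]_(v in e)
     (fn s u - fn s v) ^+ 2.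

Lemma dist2_osc2 (e : {set V}) u v : u \in e -> v \in e -> dist2 u v <= osc2 e.
Proof.
move=> hu hv; rewrite /dist2 /nrm2 big_mkord; apply: ler_sum => s _.
apply: le_trans (le_bigmax_cond _ (fun u => \big[Num.max/0]_(v in e)
     (fn s u - fn s v) ^+ 2) hu).
exact: (le_bigmax_cond _ (fun v => (fn s u - fn s v) ^+ 2) hv).
Qed.

Lemma osc2_sum xi :
  \big[Num.max/0]_(s < k) discrepancy H (fn s) <= xi ->
  \sum_(e in edges H) weight H e * osc2 e <= k%:R * xi.
Proof.
move=> hxi; rewrite /osc2.
under eq_bigr do rewrite mulr_sumr.
rewrite exchange_big /= mulr_natl -[k in _ *+ k]card_ord -sumr_const.
apply: ler_sum => s _; apply: le_trans hxi.
apply: le_trans (le_bigmax_cond _ (fun s : 'I_k => discrepancy H (fn s)) (isT : xpredT s)).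
rewrite /discrepancy; have -> : \sum_u vweight H u * fn s u ^+ 2 = 1.
  transitivity (\sum_v wv v * fn s v * fn s v); last by rewrite orth // eqxx.
  by apply: eq_bigr => u _; rewrite expr2 mulrA.
by rewrite divr1.
Qed.

Definition proj (om : seq bool) i v : R :=
  (\sum_(0 <= s < k) sg R (nth false om (i * k + s)) * fn s v) / nu v.

Lemma proj_diff om i u v :
  proj om i u - proj om i v = lin k (fun s => hn s u - hn s v) (coin_row k i om).
Proof.
rewrite lin_row /proj !mulr_suml -sumrB; apply: eq_bigr => s _.
by rewrite /hn; ring.
Qed.

Lemma proj_diff2_le om i u v :
  (proj om i u - proj om i v) ^+ 2 <= k%:R * hdist2 u v.
Proof.
rewrite proj_diff; apply: le_trans (sqr_sum_le _ _) _.
apply: ler_wpM2l => //; apply: ler_sum => s _; rewrite exprMn.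
by rewrite ler_piMl ?sqr_ge0 // /sg; case: (nth _ _ _) => /=; rewrite expr2; lra.
Qed.

Let q := up_log 2 (16 * k).
Let m := (4 * q)%N.

Definition unsep om u v : bool :=
  all (fun i => `|proj om i u - proj om i v| < 2^-1) (iota 0 m).

Definition unsep_mass om : R :=
  \sum_v \sum_u wv u * nu u ^+ 2 * (unsep om u v)%:R.

Definition far_mass om : R :=
  \sum_v \sum_u wv u * nu u ^+ 2 * ((1 <= hdist2 u v) && unsep om u v)%R%:R.

Lemma unsep_mass_le om : unsep_mass om <= 4 * #|V|%:R + far_mass om.
Proof.
have -> : 4 * #|V|%:R = \sum_(v : V) (4 : R).
  by rewrite sumr_const mulr_natr.
rewrite -big_split; apply: ler_sum => v _ /=.
apply: (@le_trans _ _ (\sum_u wv u * nu u ^+ 2 * (hdist2 u v < 1)%R%:R +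
   \sum_u wv u * nu u ^+ 2 * ((1 <= hdist2 u v) && unsep om u v)%R%:R));
   last by apply: lerD => //; exact: near_mass.
rewrite -big_split; apply: ler_sum => u _ /=; rewrite -mulrDr.
apply: ler_wpM2l; first by rewrite mulr_ge0 ?sqr_ge0 // ltW // vweight_gt0.
by case: ltP => _; case: (unsep om u v); rewrite /= ?addr0 ?add0r ?lerDl.
Qed.

Lemma far_mass_ge0 om : 0 <= far_mass om.
Proof.
apply: sumr_ge0 => v _; apply: sumr_ge0 => u _.
by rewrite mulr_ge0 // mulr_ge0 ?sqr_ge0 // ltW // vweight_gt0.
Qed.

Lemma unsep_prob T u v : (0 < k)%N -> (m * k <= T)%N -> 1 <= hdist2 u v ->
  Ex T (fun om => (unsep om u v)%:R) <= (16 * k%:R)^-1 :> R.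
Proof.
move=> k0 hT hd.
pose B (x : R) := `|x| < 2^-1.
have e om : (unsep om u v)%:R =
    \prod_(0 <= i < m) (B (lin k (fun s => hn s u - hn s v) (coin_row k i om)))%:R :> R.
  rewrite /unsep; elim: (m) => [|M IH]; first by rewrite big_geq.
  rewrite big_nat_recr // -IH -[in iota 0 M.+1]addn1 iotaD all_cat /= andbT add0n.
  by rewrite proj_diff /B; case: all; case: (_ < _); rewrite ?mulr1 ?mulr0 ?mul0r.
rewrite (Ex_ext (fun l _ => e l)) Ex_rows // /m exprM.
have p0 : 0 <= Ex k (fun l => (B (lin k (fun s => hn s u - hn s v) l))%:R) :> R.
  exact: Ex_ge0.
have p1 := Ex_lin_small hd.
apply: (@le_trans _ _ (2^-1 ^+ q)).
  apply: lerXn2r; rewrite ?nnegrE ?exprn_ge0 ?invr_ge0 //.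
  apply: (@le_trans _ _ ((13 / 16) ^+ 4)).
    by apply: lerXn2r; rewrite ?nnegrE //; lra.
  by rewrite !exprS expr0; lra.
rewrite exprVn lef_pV2 ?posrE ?exprn_gt0 ?mulr_gt0 ?ltr0n //.
by rewrite -natrX -natrM ler_nat; exact: up_logP.
Qed.

Lemma Ex_far_mass T : (0 < k)%N -> (m * k <= T)%N ->
  Ex T far_mass <= #|V|%:R / 4.
Proof.
move=> k0 hT; rewrite /far_mass Ex_sum.
apply: (@le_trans _ _ (\sum_(v : V) (16^-1 : R))); last first.
  by rewrite sumr_const -[16^-1 *+ _]mulr_natl; have : 0 <= #|V|%:R :> R by []; lra.
apply: ler_sum => v _; rewrite Ex_sum.
apply: (@le_trans _ _ (\sum_u wv u * nu u ^+ 2 * (16 * k%:R)^-1)); last first.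
  by rewrite -mulr_suml total_mass invfM mulrCA divff ?mulr1 // pnatr_eq0 -lt0n.
apply: ler_sum => u _; rewrite ExZ; apply: ler_wpM2l.
  by rewrite mulr_ge0 ?sqr_ge0 // ltW // vweight_gt0.
case: (lerP 1 (hdist2 u v)) => h; first exact: unsep_prob.
by rewrite /= Ex_cst invr_ge0 mulr_ge0.
Qed.

Variable ctr : {set V} -> V.
Hypothesis ctrP : forall e, e \in edges H -> ctr e \in e.

Definition star_energy om : R :=
  \sum_(e in edges H) weight H e * \sum_(x in e)
    nu x * nu (ctr e) * \sum_(0 <= i < m) (proj om i x - proj om i (ctr e)) ^+ 2.

Lemma star_energy_ge0 om : 0 <= star_energy om.
Proof.
apply: sumr_ge0 => e he; rewrite mulr_ge0 ?weight_ge0 //.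
apply: sumr_ge0 => x _; rewrite mulr_ge0 ?mulr_ge0 ?nu_ge0 //.
by apply: sumr_ge0 => i _; exact: sqr_ge0.
Qed.

Lemma Ex_star_energy T xi : (m * k <= T)%N ->
  \big[Num.max/0]_(s < k) discrepancy H (fn s) <= xi ->
  Ex T star_energy <= m%:R * (max_edge_size H)%:R * (k%:R * xi).
Proof.
move=> hT hxi; apply: le_trans (ler_wpM2l _ (osc2_sum hxi)); last first.
  by rewrite mulr_ge0.
rewrite mulr_sumr /star_energy Ex_sum; apply: ler_sum => e he.
rewrite ExZ mulrCA; apply: ler_wpM2l; first exact: weight_ge0.
rewrite Ex_sum; apply: (@le_trans _ _ (\sum_(x in e) (m%:R * osc2 e))).
  apply: ler_sum => x hx; rewrite ExZ Ex_sum.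
  have e2 i : (i < m)%N ->
      Ex T (fun l => (proj l i x - proj l i (ctr e)) ^+ 2) = hdist2 x (ctr e).
    move=> hi; rewrite -[RHS]Ex_lin2 -(@Ex_row _ k i T _ (fun x => x ^+ 2)).
      by apply: Ex_ext => l _; rewrite proj_diff.
    by apply: leq_trans hT; rewrite leq_mul2r hi orbT.
  rewrite big_nat (eq_bigr (fun=> hdist2 x (ctr e))); last first.
    by move=> i /andP[_ /e2].
  rewrite -big_nat sumr_const_nat subn0 -[hdist2 _ _ *+ m]mulr_natl mulrCA; apply: ler_wpM2l => //.
  apply: le_trans (hdist2_le _ _) _; apply: dist2_osc2 => //; exact: ctrP.
rewrite sumr_const -[(_ * _) *+ _]mulr_natl mulrCA -mulrA; apply: ler_wpM2l => //.
apply: ler_wpM2r; last by rewrite ler_nat; exact: leq_bigmax_cond.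
apply: sumr_ge0 => s _; elim/big_rec: _ => // u x _ hx.
by rewrite le_max hx orbT.
Qed.

End Embedding.

(** * Cells and the bound sqrt(r log k) *)

Section Cells.
Variables (R : realType) (V : finType) (H : hypergraph R V).
Variables (T n k : nat) (h : 'I_T -> V -> R) (r : 'I_T -> V -> 'I_n).
Hypothesis n_gt0 : (0 < n)%N.
Hypothesis h_ge0 : forall j v, 0 <= h j v.

Definition csize (j : 'I_T) (p : 'I_n) : nat := #|[set v | r j v == p]|.
Definition cell_fun (j : 'I_T) (p : 'I_n) (v : V) : R := h j v * (r j v == p)%:R.

Lemma sum_indicator (p0 : 'I_n) (x : R) : \sum_(p < n) x * (p0 == p)%:R = x.
Proof.
rewrite (bigD1 p0) //= eqxx mulr1 big1 ?addr0 // => p.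
by rewrite eq_sym => /negPf->; rewrite mulr0.
Qed.

Lemma cell_mass_total j :
  \sum_(p < n) mass H (fun v => cell_fun j p v ^+ 2) = mass H (fun v => h j v ^+ 2).
Proof.
rewrite exchange_big; apply: eq_bigr => v _ /=.
rewrite -[RHS](sum_indicator (r j v)); apply: eq_bigr => p _.
by rewrite exprMn -mulrA; congr (_ * (_ * _)); case: (_ == _); rewrite ?expr1n ?expr0n.
Qed.

(* A cell with more than A n / k vertices is charged to the pairs it contains. *)
Lemma valid_mass (A : nat) (U : R) : (0 < A)%N ->
  \sum_j \sum_v \sum_u vweight H u * h j u ^+ 2 * (r j u == r j v)%:R <= U ->
  \sum_j mass H (fun v => h j v ^+ 2) - U * k%:R / (A%:R * n%:R) <=
  \sum_(jp : 'I_T * 'I_n | (csize jp.1 jp.2 * k <= A * n)%N)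
     mass H (fun v => cell_fun jp.1 jp.2 v ^+ 2).
Proof.
move=> A0 hU.
have w0 u : 0 <= vweight H u by exact: ltW (vweight_gt0 H u).
have M0 j p : 0 <= mass H (fun v => cell_fun j p v ^+ 2).
  by apply: sumr_ge0 => v _; rewrite mulr_ge0 ?sqr_ge0.
have -> : \sum_j mass H (fun v => h j v ^+ 2) =
    \sum_(jp : 'I_T * 'I_n) mass H (fun v => cell_fun jp.1 jp.2 v ^+ 2).
  rewrite -(pair_bigA _ (fun j p => mass H (fun v => cell_fun j p v ^+ 2))) /=.
  by apply: eq_bigr => j _; rewrite cell_mass_total.
rewrite (bigID (fun jp : 'I_T * 'I_n => (csize jp.1 jp.2 * k <= A * n)%N)) /=.
rewrite -addrA gerDl subr_le0.
have AN : 0 < A%:R * n%:R :> R by rewrite mulr_gt0 ?ltr0n.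
rewrite ler_pdivlMr // -[leLHS]mulrC mulr_sumr.
apply: (@le_trans _ _ (\sum_(jp : 'I_T * 'I_n) k%:R * ((csize jp.1 jp.2)%:R *
   mass H (fun v => cell_fun jp.1 jp.2 v ^+ 2)))).
  rewrite [leRHS](bigID (fun jp : 'I_T * 'I_n => (csize jp.1 jp.2 * k <= A * n)%N)) /=.
  rewrite -[leLHS]add0r; apply: lerD.
    by apply: sumr_ge0 => jp _; rewrite mulr_ge0 // mulr_ge0.
  apply: ler_sum => jp; rewrite -ltnNge => hlt.
  rewrite [leRHS]mulrA; apply: ler_wpM2r => //.
  by rewrite -!natrM ler_nat [(k * _)%N]mulnC ltnW.
rewrite -mulr_sumr mulrC; apply: ler_wpM2r => //; apply: le_trans hU.
rewrite -(pair_bigA _ (fun j p => (csize j p)%:R *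
   mass H (fun v => cell_fun j p v ^+ 2))) /=.
rewrite le_eqVlt; apply/orP; left; apply/eqP; apply: eq_bigr => j _.
rewrite (eq_bigr (fun p : 'I_n => \sum_v \sum_u
   (r j v == p)%:R * (vweight H u * h j u ^+ 2 * (r j u == p)%:R))).
  rewrite exchange_big; apply: eq_bigr => v _ /=.
  rewrite exchange_big; apply: eq_bigr => u _ /=.
  rewrite -[RHS](sum_indicator (r j v)); apply: eq_bigr => p _.
  case: (r j v =P p) => [->|_]; last by rewrite mul0r mulr0.
  by rewrite mul1r mulr1.
move=> p _; rewrite /csize -sum1dep_card natr_sum mulr_suml big_mkcond /=.
apply: eq_bigr => v _; rewrite mul1r; case: (_ == _); last first.
  by rewrite big1 // => u _; rewrite mul0r.
rewrite /mass; apply: eq_bigr => u _; rewrite mul1r /cell_fun exprMn mulrA.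
by congr (_ * _); case: (_ == _); rewrite ?expr1n ?expr0n.
Qed.

Lemma cell_energy j x y : \sum_(p < n) (cell_fun j p x - cell_fun j p y) ^+ 2 =
  h j x ^+ 2 + h j y ^+ 2 - 2 * (h j x * h j y * (r j x == r j y)%:R).
Proof.
rewrite -{1}(sum_indicator (r j x) (h j x ^+ 2)).
rewrite -{1}(sum_indicator (r j y) (h j y ^+ 2)).
rewrite -(sum_indicator (r j x) (2 * _)) -big_split -sumrB; apply: eq_bigr => p _ /=.
rewrite /cell_fun; case: (r j x =P p) => [->|hx].
  rewrite [p == _]eq_sym; case: (_ == _); rewrite ?mulr1 ?mulr0 ?subr0; ring.
by case: (_ == _); rewrite ?mulr1 ?mulr0 ?subr0; ring.
Qed.

End Cells.

Lemma prod_ge (R : realType) (A : nat -> R) m :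
  (forall i, (i < m)%N -> 0 <= A i <= 1) ->
  1 - \sum_(0 <= i < m) (1 - A i) <= \prod_(0 <= i < m) A i /\
  0 <= \prod_(0 <= i < m) A i <= 1.
Proof.
elim: m => [|m IH] hA; first by rewrite !big_geq // subr0 lexx ler01.
have [|h1 /andP[h2 h3]] := IH; first by move=> i hi; apply: hA; apply: ltnW.
have /andP[a0 a1] := hA m (leqnn _).
rewrite !big_nat_recr //=; move: h1 h2 h3.
move: (\sum_(_ <= _ < _) _) (\prod_(_ <= _ < _) _) => s p h1 h2 h3.
by split; [nra|apply/andP; split; nra].
Qed.

Section Search.
Variables (R : realType) (V : finType) (H : hypergraph R V).
Variables (k : nat) (fn : nat -> V -> R) (om : seq bool).
Hypothesis orth : forall s t, (s < k)%N -> (t < k)%N ->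
  \sum_v vweight H v * fn s v * fn t v = (s == t)%:R.
Hypothesis k_gt0 : (0 < k)%N.
Let q := up_log 2 (16 * k).
Let m := (4 * q)%N.
Let P := (2 ^ m)%N.
Let n := #|V|.

Local Notation wv := (vweight H).
Local Notation nu := (nu k fn).
Local Notation proj := (proj k fn om).
Local Notation osc2 := (osc2 k fn).
Local Notation dist2 := (dist2 k fn).
Local Notation hdist2 := (hdist2 k fn).

Hypothesis proj_le : forall i v, `|proj i v| <= k%:R.

Definition shifted_pos (b : nat -> R) i v : R := 2 * proj i v + 2 * k%:R + 1 + b i.
Definition height (b : nat -> R) (eta : R -> R) v : R :=
  nu v * \prod_(0 <= i < m) eta (fpart (shifted_pos b i v)).
Definition together (b : nat -> R) u v : bool :=
  all (fun i => Num.truncn (shifted_pos b i u) == Num.truncn (shifted_pos b i v)) (iota 0 m).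

Lemma ps_ge1 b i v : 0 <= b i -> 1 <= shifted_pos b i v.
Proof. by rewrite /shifted_pos; have := proj_le i v; rewrite ler_norml => /andP[]; lra. Qed.

Lemma ps_diff b i u v : shifted_pos b i u - shifted_pos b i v = 2 * (proj i u - proj i v).
Proof. by rewrite /shifted_pos; ring. Qed.

Lemma together_unsep b u v : (forall i, 0 <= b i) -> together b u v ->
  unsep k fn om u v.
Proof.
move=> hb /allP ht; apply/allP => i hi; have /eqP e := ht i hi.
have p1 := ps_ge1 u (hb i); have p2 := ps_ge1 v (hb i).
have /andP[a1 a2] := truncn_itv (le_trans ler01 p1).
have /andP[b1 b2] := truncn_itv (le_trans ler01 p2).
rewrite -natr1 in a2; rewrite -natr1 in b2; rewrite e in a1 a2.
have := ps_diff b i u v.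
by rewrite ltr_norml => hd; apply/andP; split; lra.
Qed.

Lemma together_mass T (b : 'I_T -> nat -> R) (th : 'I_T -> V -> R) :
  (forall j i, 0 <= b j i) ->
  \sum_(j < T) \sum_v \sum_u wv u * (nu u * th j u) ^+ 2 * (together (b j) u v)%:R
  <= \sum_v \sum_u wv u * nu u ^+ 2 * (unsep k fn om u v)%:R *
       \sum_(j < T) th j u ^+ 2.
Proof.
move=> hb; rewrite exchange_big; apply: ler_sum => v _ /=.
rewrite exchange_big; apply: ler_sum => u _ /=.
rewrite mulr_sumr; apply: ler_sum => j _.
have -> : wv u * (nu u * th j u) ^+ 2 * (together (b j) u v)%:R =
   wv u * nu u ^+ 2 * th j u ^+ 2 * (together (b j) u v)%:R by ring.
rewrite [leRHS]mulrAC; apply: ler_wpM2l.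
  by rewrite mulr_ge0 ?sqr_ge0 // mulr_ge0 ?sqr_ge0 // vweight_ge0.
rewrite ler_nat; case ht: together => //.
by rewrite (together_unsep (hb j) ht).
Qed.

Lemma shift1_ge0 j i : 0 <= shift1 R j i.
Proof. by rewrite divr_ge0. Qed.

Lemma sum_bump1_sq v :
  \sum_(j < P) (\prod_(0 <= i < m) bump1 (fpart (shifted_pos (shift1 R j) i v))) ^+ 2 = 1.
Proof.
pose phi i (c : bool) := bump1 (fpart (2 * proj i v + 2 * k%:R + 1 + (c : nat)%:R / 2)) ^+ 2.
transitivity (\sum_(j < P) \prod_(0 <= i < m) phi i (bitf j i)).
  by apply: eq_bigr => j _; rewrite -prodrXl.
rewrite sum_bits big_nat big1 // => i /andP[_ hi]; rewrite /phi /= mul0r addr0 mul1r.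
apply: bump1_sq; have := ps_ge1 (b := fun=> 0) v (lexx 0) => /(_ i).
by rewrite /shifted_pos; lra.
Qed.

Lemma sum_cross u v :
  1 - 48 * \sum_(0 <= i < m) (proj i u - proj i v) ^+ 2 <=
  \sum_(j < P) (\prod_(0 <= i < m) bump1 (fpart (shifted_pos (shift1 R j) i u))) *
    (\prod_(0 <= i < m) bump1 (fpart (shifted_pos (shift1 R j) i v))) *
    (together (shift1 R j) u v)%:R.
Proof.
pose z i v := 2 * proj i v + 2 * k%:R + 1.
have z0 i w : 0 <= z i w.
  have := ps_ge1 (b := fun=> 0) w (lexx 0) => /(_ i).
  by rewrite /shifted_pos /z; lra.
pose phi i (c : bool) := cross (z i u + (c : nat)%:R / 2) (z i v + (c : nat)%:R / 2).
have -> : \sum_(j < P) (\prod_(0 <= i < m) bump1 (fpart (shifted_pos (shift1 R j) i u))) *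
    (\prod_(0 <= i < m) bump1 (fpart (shifted_pos (shift1 R j) i v))) *
    (together (shift1 R j) u v)%:R = \sum_(j < P) \prod_(0 <= i < m) phi i (bitf j i).
  apply: eq_bigr => j _.
  have -> : (together (shift1 R j) u v)%:R = \prod_(0 <= i < m)
      (Num.truncn (shifted_pos (shift1 R j) i u) == Num.truncn (shifted_pos (shift1 R j) i v))%:R :> R.
    rewrite /together; elim: (m) => [|M IH]; first by rewrite big_geq.
    rewrite big_nat_recr // -IH -[in iota 0 M.+1]addn1 iotaD all_cat /= andbT add0n.
    by case: all; case: (_ == _); rewrite ?mulr1 ?mulr0 ?mul0r.
  by rewrite -!big_split.
rewrite sum_bits.
have hc i : 0 <= phi i false + phi i true <= 1 /\
    1 - 12 * (z i u - z i v) ^+ 2 <= phi i false + phi i true.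
  by rewrite /phi /= mul0r !addr0 mul1r; exact: crossD.
have [h1 _] := @prod_ge R (fun i => phi i false + phi i true) m (fun i _ => (hc i).1).
apply: le_trans h1; rewrite lerD2l lerN2 mulr_sumr; apply: ler_sum => i _.
have [_ h2] := hc i; have e : z i u - z i v = 2 * (proj i u - proj i v).
  by rewrite /z; ring.
by rewrite e exprMn in h2; lra.
Qed.

Variable xi : R.
Hypothesis osc_le : \sum_(e in edges H) weight H e * osc2 e <= k%:R * xi.
Hypothesis unsep_le : unsep_mass H k fn om <= 5 * n%:R.

Lemma n_gt0 : (0 < n)%N.
Proof. by apply: leq_trans k_gt0 _; exact: dim_le orth. Qed.

Lemma osc2_ge0 e : 0 <= osc2 e.
Proof.
apply: sumr_ge0 => s _; elim/big_rec: _ => // u x _ hx.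
by rewrite le_max hx orbT.
Qed.

Lemma xi_ge0 : 0 <= xi.
Proof.
have k0 : 0 < k%:R :> R by rewrite ltr0n.
rewrite -(pmulr_rge0 _ k0); apply: le_trans osc_le.
by apply: sumr_ge0 => e he; rewrite mulr_ge0 ?weight_ge0 ?osc2_ge0.
Qed.

Section Mode1.
Variable r : 'I_P -> V -> 'I_n.
Hypothesis rP : forall j u v, (r j u == r j v) = together (shift1 R j) u v.
Variable ctr : {set V} -> V.
Hypothesis ctrP : forall e, e \in edges H -> ctr e \in e.
Let rr : R := (max_edge_size H)%:R.
Hypothesis star_le : star_energy H k fn ctr om <= 4 * (m%:R * rr * (k%:R * xi)).

Let th (j : 'I_P) v : R := \prod_(0 <= i < m) bump1 (fpart (shifted_pos (shift1 R j) i v)).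
Let h (j : 'I_P) v : R := height (shift1 R j) (@bump1 R) v.

Lemma shift1_bump_ge0 j v : 0 <= th j v.
Proof.
apply: prodr_ge0 => i _; apply: bump1_ge0; apply: le_trans ler01 _.
exact: ps_ge1 (shift1_ge0 _ _).
Qed.

Lemma height1_ge0 j v : 0 <= h j v.
Proof. by rewrite /h /height mulr_ge0 ?nu_ge0 // shift1_bump_ge0. Qed.

Lemma pair_energy1 x y :
  \sum_(j < P) \sum_(p < n) (cell_fun h r j p x - cell_fun h r j p y) ^+ 2 <=
  dist2 x y + 96 * (nu x * nu y *
    \sum_(0 <= i < m) (proj i x - proj i y) ^+ 2).
Proof.
rewrite (eq_bigr (fun j => nu x ^+ 2 * th j x ^+ 2 + nu y ^+ 2 * th j y ^+ 2 -
  2 * (nu x * nu y) * (th j x * th j y * (together (shift1 R j) x y)%:R))); last first.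
  by move=> j _; rewrite cell_energy rP /h /height -/(th j x) -/(th j y); ring.
rewrite big_split sumrN big_split -!mulr_sumr !sum_bump1_sq /= !mulr1.
have h1 := sum_cross x y; have h2 := nu_dist k fn x y.
have h3 : 0 <= nu x * nu y by rewrite mulr_ge0 ?nu_ge0.
rewrite -/(th _ x) in h1.
move: h1; set S := \sum_(j < P) _; set D := \sum_(0 <= i < m) _ => h1.
have h4 := ler_wpM2l h3 h1.
by rewrite !expr2 in h2 *; nra.
Qed.

Lemma mode1 : exists j p c, [/\ (csize r j p * k <= 24 * n)%N,
  0 < cell_fun h r j p c &
  cut H [set v | cell_fun h r j p c <= cell_fun h r j p v] <=
  Num.sqrt (4000 * (m%:R * rr * xi)) *
    volume H [set v | cell_fun h r j p c <= cell_fun h r j p v]].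
Proof.
have xi0 := xi_ge0.
have k0 : 0 < k%:R :> R by rewrite ltr0n.
have n0 : 0 < n%:R :> R by rewrite ltr0n n_gt0.
have q1 : (1 <= m)%N.
  by rewrite /m muln_gt0 /= /q up_log_gt0 /= (leq_trans _ (leq_pmulr 16 k_gt0)).
have m1 : 1 <= m%:R :> R by rewrite ler1n.
have rr0 : 0 <= rr by [].
have mx0 : 0 <= m%:R * rr * xi by rewrite mulr_ge0 // mulr_ge0.
have hM : \sum_j mass H (fun v => h j v ^+ 2) = k%:R.
  rewrite exchange_big /= -(total_mass orth); apply: eq_bigr => v _.
  rewrite -mulr_sumr; congr (_ * _).
  under eq_bigr do rewrite /h /height exprMn.
  by rewrite -mulr_sumr sum_bump1_sq mulr1.
have hU : \sum_j \sum_v \sum_u wv u * h j u ^+ 2 * (r j u == r j v)%:R <= 5 * n%:R.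
  under eq_bigr do under eq_bigr do under eq_bigr do rewrite rP.
  apply: le_trans unsep_le; apply: le_trans (together_mass th _) _.
    by move=> j i; exact: shift1_ge0.
  apply: ler_sum => v _; apply: ler_sum => u _.
  by rewrite sum_bump1_sq mulr1.
have hval := valid_mass k n_gt0 (isT : (0 < 24)%N) hU.
rewrite hM in hval.
have e24 : 5 * n%:R * k%:R / (24%:R * n%:R) = 5 / 24 * k%:R :> R.
  by field; rewrite gt_eqF.
rewrite e24 in hval.
set Mt := \sum_(jp : _ | _) _ in hval.
have [|||||||jp [c [h1 h2 h3]]] := @family_sweep R V H _
  (fun jp : 'I_P * 'I_n => (csize r jp.1 jp.2 * k <= 24 * n)%N)
  (fun jp v => cell_fun h r jp.1 jp.2 v)
  (fun jp e => Num.sqrt (2 * \sum_(x in e) (cell_fun h r jp.1 jp.2 x -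
      cell_fun h r jp.1 jp.2 (ctr e)) ^+ 2))
  (770 * (m%:R * rr * xi * k%:R))
  (Num.sqrt (4000 * (m%:R * rr * xi))).
- by move=> jp v; rewrite mulr_ge0 // height1_ge0.
- by move=> jp e; exact: sqrtr_ge0.
- move=> jp e u v _ he hu hv; set g := cell_fun h r jp.1 jp.2.
  apply: le_trans (ler_norm _) _; rewrite -sqrtr_sqr; apply: ler_wsqrtr.
  have [->|ne] := eqVneq u v.
    rewrite subrr expr0n mulr_ge0 // sumr_ge0 // => x _; exact: sqr_ge0.
  rewrite (bigD1 u) //= (bigD1 v) /=; last by rewrite hv eq_sym.
  set S := \sum_(i | _) _.
  have S0 : 0 <= S by apply: sumr_ge0 => x _; exact: sqr_ge0.
  by have := sqr_ge0 ((g u - g (ctr e)) + (g v - g (ctr e))); rewrite !expr2; nra.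
- by rewrite -/Mt; lra.
- exact: sqrtr_ge0.
- apply: (@le_trans _ _ (\sum_(jp : 'I_P * 'I_n) \sum_(e in edges H) weight H e *
     (2 * \sum_(x in e) (cell_fun h r jp.1 jp.2 x -
      cell_fun h r jp.1 jp.2 (ctr e)) ^+ 2))).
    rewrite [leRHS](bigID (fun jp : 'I_P * 'I_n => (csize r jp.1 jp.2 * k <= 24 * n)%N)) /=.
    have pos (jp : 'I_P * 'I_n) (e : {set V}) : 0 <= 2 * \sum_(x in e)
        (cell_fun h r jp.1 jp.2 x - cell_fun h r jp.1 jp.2 (ctr e)) ^+ 2.
      by rewrite mulr_ge0 // sumr_ge0 // => x _; exact: sqr_ge0.
    rewrite -[leLHS]addr0; apply: lerD.
      by apply: ler_sum => jp _; apply: ler_sum => e he; rewrite sqr_sqrtr.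
    by apply: sumr_ge0 => jp _; apply: sumr_ge0 => e he; rewrite mulr_ge0 ?weight_ge0.
  rewrite exchange_big /=.
  apply: (@le_trans _ _ (2 * rr * (k%:R * xi) + 192 * star_energy H k fn ctr om)); last first.
    have : rr * (k%:R * xi) <= m%:R * rr * (k%:R * xi).
      by rewrite -mulrA ler_peMl // mulr_ge0 // mulr_ge0 // ltW.
    have -> : m%:R * rr * xi * k%:R = m%:R * rr * (k%:R * xi) by ring.
    rewrite -[2 * rr * _]mulrA; move: star_le; move: (star_energy _ _ _ _ _) => a.
    by move: (m%:R * rr * _) (rr * _) => b c; lra.
  apply: le_trans (lerD (ler_wpM2l _ osc_le) (lexx _)); last by rewrite mulr_ge0.
  rewrite /star_energy !mulr_sumr -big_split; apply: ler_sum => e he /=.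
  rewrite -mulr_sumr [2 * rr * _]mulrCA [192 * _]mulrCA -mulrDr.
  apply: ler_wpM2l; first exact: weight_ge0.
  rewrite -mulr_sumr exchange_big /=.
  apply: (@le_trans _ _ (2 * \sum_(x in e) (osc2 e + 96 * (nu x * nu (ctr e) *
    \sum_(0 <= i < m) (proj i x - proj i (ctr e)) ^+ 2)))).
    apply: ler_wpM2l => //; apply: ler_sum => x hx.
    rewrite -(pair_bigA _ (fun j p => (cell_fun h r j p x -
      cell_fun h r j p (ctr e)) ^+ 2)) /=.
    apply: le_trans (pair_energy1 _ _) _; rewrite lerD2r.
    by apply: dist2_osc2 => //; exact: ctrP.
  rewrite big_split -mulr_sumr /= sumr_const.
  have : osc2 e *+ #|e| <= rr * osc2 e.
    rewrite -mulr_natl; apply: ler_wpM2r; first exact: osc2_ge0.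
    by rewrite ler_nat; exact: leq_bigmax_cond.
  set a := _ *+ _; set b := \sum_(x in e) _ => ha.
  by lra.
- rewrite sqr_sqrtr; last by rewrite mulr_ge0.
  rewrite -/Mt; apply: (@le_trans _ _ (4000 * (m%:R * rr * xi) * (19 / 24 * k%:R))).
    have : 0 <= m%:R * rr * xi * k%:R by rewrite mulr_ge0 // ltW.
    by lra.
  by apply: ler_wpM2l; [rewrite mulr_ge0|lra].
by exists jp.1, jp.2, c.
Qed.

End Mode1.

End Search.

(** * Groups of cells and the bound for large hyperedges *)

Lemma sqr_le_expn2 n : (4 <= n)%N -> (n * n <= 2 ^ n)%N.
Proof.
elim: n => // n IH; rewrite leq_eqVlt => /orP[/eqP<- //|h].
by rewrite expnS; have := IH h; nia.
Qed.

Lemma prod_dist (R : realType) (a b : nat -> R) m :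
  (forall i, (i < m)%N -> 0 <= a i <= 1) -> (forall i, (i < m)%N -> 0 <= b i <= 1) ->
  `|\prod_(0 <= i < m) a i - \prod_(0 <= i < m) b i| <=
  \sum_(0 <= i < m) `|a i - b i|.
Proof.
elim: m => [|m IH] ha hb; first by rewrite !big_geq // subrr normr0.
have ha' i : (i < m)%N -> 0 <= a i <= 1 by move=> hi; apply: ha; apply: ltnW.
have hb' i : (i < m)%N -> 0 <= b i <= 1 by move=> hi; apply: hb; apply: ltnW.
have /andP[p0 p1] := (prod_ge ha').2; have /andP[q0 q1] := (prod_ge hb').2.
have /andP[a0 a1] := ha m (leqnn _); have /andP[b0 b1] := hb m (leqnn _).
have := IH ha' hb'; rewrite !big_nat_recr //=.
move: (\prod_(0 <= i < m) a i) (\prod_(0 <= i < m) b i) p0 p1 q0 q1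
  => p p' p0 p1 q0 q1 h.
have -> : p * a m - p' * b m = (p - p') * a m + p' * (a m - b m) by ring.
apply: le_trans (ler_normD _ _) _; apply: lerD.
  by apply: le_trans h; rewrite normrM (ger0_norm a0) ler_piMr.
by rewrite normrM (ger0_norm q0) ler_piMl.
Qed.

Lemma prod_le_factor (R : realType) (a : nat -> R) m i :
  (forall i, (i < m)%N -> 0 <= a i <= 1) -> (i < m)%N ->
  \prod_(0 <= i < m) a i <= a i.
Proof.
elim: m => // m IH ha; rewrite ltnS leq_eqVlt big_nat_recr //=.
have ha' j : (j < m)%N -> 0 <= a j <= 1 by move=> hj; apply: ha; apply: ltnW.
have /andP[p0 p1] := (prod_ge ha').2.
have /andP[a0 a1] := ha m (leqnn _).
case/orP=> [/eqP->|hi]; first by rewrite ler_piMl.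
by apply: le_trans (IH ha' hi); rewrite ler_piMr.
Qed.

Section Mode2.
Variables (R : realType) (V : finType) (H : hypergraph R V).
Variables (k : nat) (fn : nat -> V -> R) (om : seq bool).
Hypothesis orth : forall s t, (s < k)%N -> (t < k)%N ->
  \sum_v vweight H v * fn s v * fn t v = (s == t)%:R.
Hypothesis k_ge : (25 <= k)%N.
Let q := up_log 2 (16 * k).
Let m := (4 * q)%N.
Let P := (2 ^ m)%N.
Let n := #|V|.

Local Notation wv := (vweight H).
Local Notation nu := (nu k fn).
Local Notation proj := (proj k fn om).
Local Notation osc2 := (osc2 k fn).
Local Notation dist2 := (dist2 k fn).
Local Notation hdist2 := (hdist2 k fn).
Local Notation ps := (shifted_pos k fn om).

Hypothesis proj_le : forall i v, `|proj i v| <= k%:R.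
Variable xi : R.
Hypothesis osc_le : \sum_(e in edges H) weight H e * osc2 e <= k%:R * xi.
Hypothesis unsep_le : unsep_mass H k fn om <= 5 * n%:R.
Variable r : 'I_P -> V -> 'I_n.
Local Notation sh j := (shift2 R k j).
Hypothesis rP : forall j u v, (r j u == r j v) = together k fn om (sh j) u v.
Variable ctr : {set V} -> V.
Hypothesis ctrP : forall e, e \in edges H -> ctr e \in e.

Let th (j : 'I_P) v : R := \prod_(0 <= i < m) bump2 m (fpart (ps (sh j) i v)).
Let h (j : 'I_P) v : R := height k fn om (sh j) (@bump2 R m) v.

Lemma k_gt0' : (0 < k)%N. Proof. exact: leq_trans k_ge. Qed.

Lemma m_ge16 : (16 <= m)%N.
Proof.
rewrite /m (_ : 16 = 4 * 4)%N // leq_mul2l /= /q.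
apply: (@leq_trans (up_log 2 (16 * 1))) => //; apply: leq_up_log.
by rewrite leq_mul2l /= k_gt0'.
Qed.

Lemma m_le_k : (m <= 4 * k)%N.
Proof.
rewrite /m leq_mul2l /=; apply: up_log_min => //.
apply: leq_trans (sqr_le_expn2 _); last exact: leq_trans k_ge.
by rewrite leq_mul2r orbC (leq_trans _ k_ge).
Qed.

Lemma mm_le_P : (m * m <= P)%N.
Proof. by apply: sqr_le_expn2; apply: leq_trans m_ge16. Qed.

Lemma P_gt0 : (0 < P)%N. Proof. by rewrite expn_gt0. Qed.

Lemma shift2_ge0 j i : 0 <= sh j i.
Proof. by rewrite divr_ge0. Qed.

Lemma ps2_ge0 j i v : 0 <= ps (sh j) i v.
Proof. by apply: le_trans ler01 (ps_ge1 proj_le _ (shift2_ge0 _ _)). Qed.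

Lemma bump2_ps01 j v i : (i < m)%N -> 0 <= bump2 m (fpart (ps (sh j) i v)) <= 1.
Proof. by move=> _; apply: bump2_01; exact: ps2_ge0. Qed.

Lemma th01 j v : 0 <= th j v <= 1.
Proof. exact: (prod_ge (bump2_ps01 j v)).2. Qed.

Lemma height2_ge0 j v : 0 <= h j v.
Proof.
by rewrite /h /height mulr_ge0 ?nu_ge0 //; case/andP: (th01 j v).
Qed.

Lemma th_lip (j : 'I_P) u v (a b : bool) : (together k fn om (sh j) u v -> a = b) ->
  `|th j u * a%:R - th j v * b%:R| <=
  64 * m%:R * \sum_(0 <= i < m) `|proj i u - proj i v|.
Proof.
move=> hab.
have lip i : `|bump2 m (fpart (ps (sh j) i u)) - bump2 m (fpart (ps (sh j) i v))|
    <= 64 * m%:R * `|proj i u - proj i v|.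
  apply: le_trans (bump2_lip m (ps2_ge0 _ _ _) (ps2_ge0 _ _ _)) _.
  rewrite ps_diff normrM (ger0_norm (_ : 0 <= 2)) //.
  by rewrite le_eqVlt; apply/orP; left; apply/eqP; ring.
have /andP[u0 u1] := th01 j u; have /andP[v0 v1] := th01 j v.
case ht : (together k fn om (sh j) u v).
  rewrite (hab ht) -mulrBl normrM.
  apply: (@le_trans _ _ `|th j u - th j v|).
    by rewrite ler_piMr //; case: b {hab}; rewrite /= ?normr1 ?normr0.
  apply: le_trans (prod_dist (bump2_ps01 j u) (bump2_ps01 j v)) _.
  by rewrite mulr_sumr; apply: ler_sum => i _; exact: lip.
have [i hi ne] : exists2 i, (i < m)%N &
    Num.truncn (ps (sh j) i u) != Num.truncn (ps (sh j) i v).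
  move/negbT: ht; rewrite /together -has_predC => /hasP[i].
  by rewrite mem_iota => /andP[_ hi] /= ne; exists i.
have sumi : 64 * m%:R * `|proj i u - proj i v| <=
    64 * m%:R * \sum_(0 <= i < m) `|proj i u - proj i v|.
  apply: ler_wpM2l; first by rewrite mulr_ge0.
  rewrite big_mkord (bigD1 (Ordinal hi)) //= lerDl.
  exact: sumr_ge0.
have e64 : 32 * m%:R * `|ps (sh j) i u - ps (sh j) i v| =
    64 * m%:R * `|proj i u - proj i v|.
  by rewrite ps_diff normrM (ger0_norm (_ : 0 <= 2)) //; ring.
have bu : th j u <= 64 * m%:R * `|proj i u - proj i v|.
  rewrite -e64; apply: le_trans (bump2_sep m (ps2_ge0 _ _ _) (ps2_ge0 _ _ _) ne).
  exact: (prod_le_factor (bump2_ps01 j u) hi).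
have bv : th j v <= 64 * m%:R * `|proj i u - proj i v|.
  rewrite -e64 distrC; rewrite eq_sym in ne.
  apply: le_trans (bump2_sep m (ps2_ge0 _ _ _) (ps2_ge0 _ _ _) ne).
  exact: (prod_le_factor (bump2_ps01 j v) hi).
apply: le_trans sumi; move: bu bv; set B := 64 * _ * _ => bu bv.
by rewrite ler_norml; case: a {hab}; case: b; rewrite ?mulr1 ?mulr0;
  apply/andP; split; lra.
Qed.

Definition prefix_size (j : 'I_P) (p : 'I_n) : nat := #|[set v | (r j v < p)%N]|.
Definition group (j : 'I_P) (v : V) : nat := (prefix_size j (r j v) * k) %/ (12 * n).
Definition small (j : 'I_P) (v : V) : bool := (csize r j (r j v) * k <= 12 * n)%N.
Definition group_fun (j : 'I_P) (a : 'I_k) (v : V) : R :=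
  h j v * (small j v && (group j v == a))%:R.

Lemma n_gt0' : (0 < n)%N. Proof. exact: n_gt0 orth k_gt0'. Qed.

Lemma group_lt j v : (group j v < k)%N.
Proof.
have h1 : (prefix_size j (r j v) <= n)%N by exact: max_card.
rewrite /group ltn_divLR ?muln_gt0 ?n_gt0' //.
have := k_gt0'; have := n_gt0'.
by move: (prefix_size _ _) h1 => x; nia.
Qed.

Lemma group_fun_ge0 j a v : 0 <= group_fun j a v.
Proof. by rewrite mulr_ge0 // height2_ge0. Qed.

Lemma group_fun_le j a v : group_fun j a v <= nu v.
Proof.
rewrite /group_fun /h /height -/(th j v); have /andP[t0 t1] := th01 j v.
have n0 := nu_ge0 k fn v; case: (_ && _); rewrite ?mulr1 ?mulr0 //.
by rewrite ler_piMr.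
Qed.

Lemma together_group (j : 'I_P) u v : together k fn om (sh j) u v ->
  small j u = small j v /\ group j u = group j v.
Proof. by rewrite -rP => /eqP e; rewrite /small /group e. Qed.

Lemma group_fun_lip j a (e : {set V}) u v : u \in e -> v \in e ->
  (group_fun j a u - group_fun j a v) ^+ 2 <= 65 ^+ 2 * m%:R ^+ 4 * k%:R * osc2 e.
Proof.
move=> hu hv.
wlog le_uv : u v hu hv / nu u <= nu v.
  move=> W; case: (leP (nu u) (nu v)) => [/W -> //|/ltW/W].
  by move=> /(_ hv hu); rewrite -sqrrN opprB.
have k1 : 1 <= k%:R :> R by rewrite ler1n k_gt0'.
have m1 : 1 <= m%:R :> R by rewrite ler1n (leq_trans _ m_ge16).
set Q := osc2 e; have Q0 : 0 <= Q by exact: osc2_ge0.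
have dQ : dist2 u v <= Q by exact: dist2_osc2.
set s := Num.sqrt Q; have s2 : s ^+ 2 = Q by rewrite sqr_sqrtr.
have s0 : 0 <= s by exact: sqrtr_ge0.
set w := Num.sqrt (k%:R * Q).
have w2 : w ^+ 2 = k%:R * Q by rewrite sqr_sqrtr // mulr_ge0.
have w0 : 0 <= w by exact: sqrtr_ge0.
have sw : s <= w by apply: ler_wsqrtr; rewrite ler_peMl.
have hnu : nu v - nu u <= s.
  have := le_trans (nu_dist k fn u v) dQ; rewrite -s2 -sqrrN opprB.
  by rewrite ler_sqr // nnegrE subr_ge0.
have u0 := nu_ge0 k fn u; have v0 := nu_ge0 k fn v.
have hd i : nu u * `|proj i u - proj i v| <= w.
  rewrite -ler_sqr ?nnegrE ?mulr_ge0 //.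
  rewrite exprMn sqr_normr w2.
  apply: le_trans (ler_wpM2l (sqr_ge0 _) (proj_diff2_le _ _ _ _ _ _)) _.
  rewrite mulrCA; apply: ler_wpM2l; first exact: le_trans k1.
  apply: le_trans dQ; apply: le_trans (hdist2_le k fn u v).
  by apply: ler_wpM2r; [exact: hdist2_ge0|rewrite expr2 ler_wpM2l].
set a1 := small j u && (group j u == a); set a2 := small j v && (group j v == a).
have ht : nu u * `|th j u * a1%:R - th j v * a2%:R| <= 64 * m%:R ^+ 2 * w.
  apply: le_trans (ler_wpM2l u0 (@th_lip j u v a1 a2 _)) _.
    by rewrite /a1 /a2 => /together_group[-> ->].
  rewrite mulrCA mulr_sumr.
  apply: (@le_trans _ _ (64 * m%:R * \sum_(0 <= i < m) w)).
    apply: ler_wpM2l; first by rewrite mulr_ge0 // (le_trans _ m1).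
    by apply: ler_sum => i _; exact: hd.
  rewrite sumr_const_nat subn0 -[w *+ m]mulr_natl.
  by rewrite le_eqVlt; apply/orP; left; apply/eqP; ring.
have hg : `|group_fun j a u - group_fun j a v| <= 65 * m%:R ^+ 2 * w.
  have -> : group_fun j a u - group_fun j a v =
     nu u * (th j u * a1%:R - th j v * a2%:R) - (nu v - nu u) * (th j v * a2%:R).
    by rewrite /group_fun /h /height -/(th j u) -/(th j v) -/a1 -/a2; ring.
  apply: le_trans (ler_normB _ _) _.
  rewrite normrM (ger0_norm u0).
  have : `|(nu v - nu u) * (th j v * a2%:R)| <= s.
    have /andP[t0 t1] := th01 j v.
    rewrite ger0_norm; last by rewrite mulr_ge0 ?subr_ge0 // mulr_ge0.
    apply: le_trans hnu; rewrite ler_piMr ?subr_ge0 //.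
    by case: (a2); rewrite ?mulr1 ?mulr0.
  have : w <= m%:R ^+ 2 * w by rewrite ler_peMl // expr2; nra.
  by lra.
rewrite -sqr_normr.
apply: (@le_trans _ _ ((65 * m%:R ^+ 2 * w) ^+ 2)).
  by apply: lerXn2r => //; rewrite nnegrE // mulr_ge0 // mulr_ge0 // exprn_ge0.
rewrite !exprMn w2.
by rewrite le_eqVlt; apply/orP; left; apply/eqP; ring.
Qed.

Definition top (e : {set V}) : V := [arg max_(v > ctr e in e) nu v]%O.

Lemma topP e : e \in edges H -> top e \in e /\ forall v, v \in e -> nu v <= nu (top e).
Proof.
move=> he; rewrite /top; case: (@arg_maxP _ _ _ (ctr e) (mem e) nu (ctrP he)) => v hv hm.
by split.
Qed.

Definition hit (j : 'I_P) (e : {set V}) : bool :=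
  [exists u in e, exists v in e, ~~ together k fn om (sh j) u v].

Lemma hit_count (e : {set V}) (w : R) : e \in edges H ->
  (forall i u v, u \in e -> v \in e -> proj i u - proj i v <= w) ->
  \sum_(j < P) (hit j e)%:R <= m%:R * (2 * P%:R * w + 1) :> R.
Proof.
move=> he hw; have hc := ctrP he.
pose x i := [arg min_(v < ctr e in e) proj i v]%O.
pose y i := [arg max_(v > ctr e in e) proj i v]%O.
have xP i : x i \in e /\ forall v, v \in e -> proj i (x i) <= proj i v.
  by rewrite /x; case: (@arg_minP _ _ _ (ctr e) (mem e) (proj i) hc).
have yP i : y i \in e /\ forall v, v \in e -> proj i v <= proj i (y i).
  by rewrite /y; case: (@arg_maxP _ _ _ (ctr e) (mem e) (proj i) hc).
pose z i v := 2 * proj i v + 2 * k%:R + 1.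
have z0 i v : 0 <= z i v.
  by have := proj_le i v; rewrite ler_norml /z => /andP[]; lra.
apply: (@le_trans _ _ (\sum_(0 <= i < m) \sum_(j < P)
   (Num.truncn (z i (x i) + j%:R / P%:R) != Num.truncn (z i (y i) + j%:R / P%:R))%:R)).
  rewrite exchange_big; apply: ler_sum => j _ /=.
  case hj : (hit j e); last by apply: sumr_ge0.
  move: hj => /exists_inP[u hu /exists_inP[v hv]].
  rewrite /together -has_predC => /hasP[i]; rewrite mem_iota => /andP[_ hi] /= ne.
  rewrite big_mkord (bigD1 (Ordinal hi)) //= -[leLHS]addr0; apply: lerD; last first.
    exact: sumr_ge0.
  rewrite ler_nat lt0b; apply: contra ne => /eqP eq.
  have hh c : c \in e ->
      (Num.truncn (z i (x i) + j%:R / P%:R) <= Num.truncn (ps (sh j) i c) <=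
       Num.truncn (z i (y i) + j%:R / P%:R))%N.
    move=> hce; apply/andP; split; apply: le_truncn; rewrite /z /shifted_pos !lerD2r;
      apply: ler_wpM2l => //; [exact: (xP i).2|exact: (yP i).2].
  have := hh u hu; have := hh v hv; rewrite eq -!eqn_leq.
  by move=> /eqP <- /eqP <-.
apply: (@le_trans _ _ (\sum_(0 <= i < m) (2 * P%:R * w + 1))); last first.
  by rewrite sumr_const_nat subn0 -[_ *+ m]mulr_natl.
apply: ler_sum => i _; have [xe xm] := xP i; have [ye ym] := yP i.
have hxy := xm _ ye.
apply: le_trans (count_truncn P_gt0 (z0 _ _) _) _.
  by rewrite /z; lra.
rewrite lerD2r.
have -> : P%:R * (z i (y i) - z i (x i)) = 2 * P%:R * (proj i (y i) - proj i (x i)).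
  by rewrite /z; ring.
by apply: ler_wpM2l; [rewrite mulr_ge0|exact: hw].
Qed.

Lemma edge_energy (C0 : R) (e : {set V}) : 1 <= C0 -> e \in edges H ->
  Num.min (nu (top e) ^+ 2) (C0 * m%:R ^+ 4 * k%:R * osc2 e) *
    (k%:R * \sum_(j < P) (hit j e)%:R + P%:R) <=
  9 * C0 * P%:R * k%:R ^+ 2 * m%:R ^+ 3 * osc2 e.
Proof.
move=> C1 he; have [te tm] := topP he.
have k1 : 1 <= k%:R :> R by rewrite ler1n k_gt0'.
have m1 : 16 <= m%:R :> R by rewrite ler_nat m_ge16.
have mk : m%:R <= 4 * k%:R :> R by rewrite -natrM ler_nat m_le_k.
have mP : m%:R * m%:R <= P%:R :> R by rewrite -natrM ler_nat mm_le_P.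
set Q := osc2 e; have Q0 : 0 <= Q by exact: osc2_ge0.
set A := nu (top e); have A0 : 0 <= A by exact: nu_ge0.
set hits := \sum_(j < P) _.
have hits0 : 0 <= hits by exact: sumr_ge0.
have hitsP : hits <= P%:R.
  rewrite -[X in X%:R](card_ord P) -sumr_const; apply: ler_sum => j _.
  by case: (hit _ _).
set mn := Num.min _ _.
have P0 : 0 <= P%:R :> R by [].
have mn0 : 0 <= mn.
  rewrite le_min sqr_ge0 /=; apply: mulr_ge0 => //; apply: mulr_ge0; last by lra.
  by apply: mulr_ge0; [lra|apply: exprn_ge0; lra].
have mnA : mn <= A ^+ 2 by rewrite ge_min lexx.
have mnL : mn <= C0 * m%:R ^+ 4 * k%:R * Q by rewrite ge_min lexx orbT.
have C00 : 0 <= C0 by lra.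
have K0 : 0 <= P%:R * Q by rewrite mulr_ge0.
case: (leP (A ^+ 2) (4 * Q)) => hA.
  apply: (@le_trans _ _ (4 * Q * (2 * k%:R * P%:R))).
    apply: ler_pM => //; [nra|exact: le_trans mnA hA|nra].
  have -> : 4 * Q * (2 * k%:R * P%:R) = 8 * k%:R * (P%:R * Q) by ring.
  have -> : 9 * C0 * P%:R * k%:R ^+ 2 * m%:R ^+ 3 * Q =
     9 * C0 * (k%:R ^+ 2 * m%:R ^+ 3) * (P%:R * Q) by ring.
  apply: ler_wpM2r => //; rewrite expr2 !exprS expr0 mulr1.
  have : 1 <= m%:R * (m%:R * m%:R) :> R by nra.
  move: (_ * (m%:R * m%:R)) => mmm hm.
  have hX : k%:R <= k%:R * k%:R * mmm :> R by nra.
  move: (k%:R * k%:R * mmm) hX => X hX.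
  have : 0 <= (C0 - 1) * X by apply: mulr_ge0; lra.
  by lra.
have A1 : 0 < A ^+ 2 by apply: le_lt_trans hA; rewrite mulr_ge0.
set z := Num.sqrt (m%:R ^+ 4 * k%:R * Q / A ^+ 2).
have z2 : z ^+ 2 * A ^+ 2 = m%:R ^+ 4 * k%:R * Q.
  rewrite sqr_sqrtr ?divfK ?gt_eqF //.
  apply: divr_ge0; last exact: ltW.
  by apply: mulr_ge0 => //; apply: mulr_ge0; [apply: exprn_ge0|]; lra.
have z0 : 0 <= z by exact: sqrtr_ge0.
have hw i u v : u \in e -> v \in e -> proj i u - proj i v <= 2 * z / m%:R ^+ 2.
  move=> hu hv; apply: le_trans (ler_norm _) _.
  have low c : c \in e -> A / 2 <= nu c.
    move=> hc; have h1 : (A - nu c) ^+ 2 <= Q.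
      by apply: le_trans (nu_dist k fn _ _) _; exact: dist2_osc2.
    rewrite leNgt; apply/negP => h2; have n0 := nu_ge0 k fn c.
    by rewrite !expr2 in h1 hA; nra.
  have mm0 : 0 < m%:R ^+ 2 :> R by rewrite exprn_gt0 //; lra.
  rewrite -ler_sqr ?nnegrE //; last by rewrite divr_ge0 ?mulr_ge0 // ltW.
  rewrite sqr_normr; apply: le_trans (proj_diff2_le _ _ _ _ _ _) _.
  rewrite expr_div_n exprMn -exprM ler_pdivlMr ?exprn_gt0 //; last by lra.
  rewrite -(ler_pM2r A1) -[leRHS]mulrA z2.
  have hl : A ^+ 2 * hdist2 u v <= 4 * Q.
    have h1 := le_trans (hdist2_le k fn u v) (dist2_osc2 k fn hu hv).
    have h2 : A ^+ 2 / 4 <= nu u * nu v.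
      have := low u hu; have := low v hv; rewrite expr2; nra.
    have h3 := ler_wpM2r (hdist2_ge0 k fn u v) h2.
    by rewrite -/Q in h1; lra.
  have -> : k%:R * hdist2 u v * m%:R ^+ 4 * A ^+ 2 =
     k%:R * m%:R ^+ 4 * (A ^+ 2 * hdist2 u v) by ring.
  have -> : 2 ^+ 2 * (m%:R ^+ 4 * k%:R * Q) = k%:R * m%:R ^+ 4 * (4 * Q) by ring.
  by apply: ler_wpM2l => //; rewrite mulr_ge0 ?exprn_ge0 //; lra.
have hh := hit_count he hw; rewrite -/hits in hh.
have m0 : 0 < m%:R :> R by lra.
have hitsB : m%:R * hits <= P%:R * (4 * z + 1).
  apply: le_trans (ler_wpM2l (ltW m0) hh) _.
  have -> : m%:R * (m%:R * (2 * P%:R * (2 * z / m%:R ^+ 2) + 1)) =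
      P%:R * (4 * z) + m%:R * m%:R.
    by field; rewrite gt_eqF.
  by rewrite mulrDr mulr1 lerD2l.
rewrite -(ler_pM2l m0).
have mnz : mn <= C0 * z ^+ 2 * A ^+ 2.
  have -> : C0 * z ^+ 2 * A ^+ 2 = C0 * (z ^+ 2 * A ^+ 2) by ring.
  rewrite z2; have -> : C0 * (m%:R ^+ 4 * k%:R * Q) = C0 * m%:R ^+ 4 * k%:R * Q.
    by ring.
  exact: mnL.
have key : mn * (4 * z + 1) <= 5 * C0 * z ^+ 2 * A ^+ 2.
  case: (leP z 1) => hz.
    apply: (@le_trans _ _ (C0 * z ^+ 2 * A ^+ 2 * 5)); last by lra.
    by apply: ler_pM => //; lra.
  apply: (@le_trans _ _ (A ^+ 2 * (5 * z ^+ 2))).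
    by apply: ler_pM => //; [lra|rewrite expr2; nra].
  have AZ : 0 <= A ^+ 2 * z ^+ 2 by rewrite mulr_ge0 ?sqr_ge0.
  have : 0 <= (C0 - 1) * (A ^+ 2 * z ^+ 2) by apply: mulr_ge0; lra.
  by lra.
have e1 : m%:R * (9 * C0 * P%:R * k%:R ^+ 2 * m%:R ^+ 3 * Q) =
    9 * C0 * P%:R * k%:R * (z ^+ 2 * A ^+ 2) by rewrite z2; ring.
rewrite e1.
have t1 : m%:R * (mn * (k%:R * hits)) <=
    5 * C0 * P%:R * k%:R * (z ^+ 2 * A ^+ 2).
  have -> : m%:R * (mn * (k%:R * hits)) = k%:R * mn * (m%:R * hits) by ring.
  apply: (@le_trans _ _ (k%:R * mn * (P%:R * (4 * z + 1)))).
    by apply: ler_wpM2l => //; rewrite mulr_ge0.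
  have -> : k%:R * mn * (P%:R * (4 * z + 1)) = k%:R * P%:R * (mn * (4 * z + 1)) by ring.
  have -> : 5 * C0 * P%:R * k%:R * (z ^+ 2 * A ^+ 2) =
    k%:R * P%:R * (5 * C0 * z ^+ 2 * A ^+ 2) by ring.
  by apply: ler_wpM2l => //; rewrite mulr_ge0.
have t2 : m%:R * (mn * P%:R) <= 4 * C0 * P%:R * k%:R * (z ^+ 2 * A ^+ 2).
  have -> : m%:R * (mn * P%:R) = P%:R * (m%:R * mn) by ring.
  have -> : 4 * C0 * P%:R * k%:R * (z ^+ 2 * A ^+ 2) =
    P%:R * (4 * k%:R * (C0 * z ^+ 2 * A ^+ 2)) by ring.
  by apply: ler_wpM2l => //; apply: ler_pM => //; exact: ltW.
by rewrite !mulrDr; lra.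
Qed.

Lemma sum_th2 v : 7 / 8 * P%:R <= \sum_(j < P) th j v ^+ 2.
Proof.
have mP : m%:R * m%:R <= P%:R :> R by rewrite -natrM ler_nat mm_le_P.
have m1 : 16 <= m%:R :> R by rewrite ler_nat m_ge16.
pose bad i (j : 'I_P) : R := (16 * m%:R * tent (ps (sh j) i v) < 1)%R%:R.
apply: (@le_trans _ _ (\sum_(j < P) (1 - \sum_(0 <= i < m) bad i j))).
  rewrite sumrB sumr_const card_ord exchange_big /=.
  have : \sum_(0 <= i < m) \sum_(j < P) bad i j <=
      \sum_(0 <= i < m) (P%:R / (16 * m%:R) + 1 : R).
    apply: ler_sum => i _; apply: count_tent; [exact: P_gt0| |].
      by apply: leq_trans m_ge16.
    by have := proj_le i v; rewrite ler_norml => /andP[]; lra.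
  rewrite sumr_const_nat subn0 -[_ *+ m]mulr_natl mulrDr mulr1.
  have -> : m%:R * (P%:R / (16 * m%:R)) = P%:R / 16 :> R.
    by field; rewrite gt_eqF //; lra.
  have : m%:R <= P%:R / 16 :> R by nra.
  by lra.
apply: ler_sum => j _; have /andP[t0 t1] := th01 j v.
case hb : (all (fun i => 1 <= 16 * m%:R * tent (ps (sh j) i v)) (iota 0 m)).
  have -> : th j v = 1.
    rewrite /th big_nat big1 // => i /andP[_ hi]; apply: bump2_eq1.
    by move/allP: hb; apply; rewrite mem_iota.
  by rewrite expr1n gerBl sumr_ge0.
move/negbT: hb; rewrite -has_predC => /hasP[i].
rewrite mem_iota => /andP[_ hi] /=; rewrite -ltNge => hlt.
apply: (@le_trans _ _ 0); last exact: sqr_ge0.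
rewrite subr_le0 big_mkord (bigD1 (Ordinal hi)) //= {1}/bad hlt lerDl.
exact: sumr_ge0.
Qed.

Lemma prefix_size_split (j : 'I_P) (p0 p1 : 'I_n) : (p0 <= p1)%N ->
  (#|[set v | (p0 <= r j v <= p1)%N]| + prefix_size j p0 =
   prefix_size j p1 + csize r j p1)%N.
Proof.
move=> hp; rewrite /prefix_size /csize -cardsUI -[RHS]cardsUI.
have e v : (r j v == p1) = ((r j v : nat) == p1) by [].
by congr (_ + _)%N; apply: eq_card => v; rewrite !inE ?e;
  move: (nat_of_ord (r j v)) => x; lia.
Qed.

Lemma prefix_size_le (j : 'I_P) (p p1 : 'I_n) : (p < p1)%N ->
  (prefix_size j p + csize r j p <= prefix_size j p1)%N.
Proof.
move=> hp; rewrite /prefix_size /csize -cardsUI.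
have -> : #|[set v | (r j v < p)%N] :&: [set v | r j v == p]| = 0%N.
  apply/eqP; rewrite cards_eq0; apply/eqP/setP => v; rewrite !inE.
  have -> : (r j v == p) = ((r j v : nat) == p) by [].
  move: (nat_of_ord (r j v)) => x; lia.
rewrite addn0; apply: subset_leq_card; apply/subsetP => v; rewrite !inE.
have -> : (r j v == p) = ((r j v : nat) == p) by [].
  move: (nat_of_ord (r j v)) => x; lia.
Qed.

Lemma group_interval (j : 'I_P) (a : 'I_k) (c : V) : 0 < group_fun j a c ->
  exists p0 p1 : 'I_n,
    [set v | group_fun j a c <= group_fun j a v] =
      [set v | (p0 <= r j v <= p1)%N && (h j c <= h j v)] /\
    (#|[set v | (p0 <= r j v <= p1)%N]| * k <= 24 * n)%N.
Proof.
move=> hc; pose W := [set v | small j v && (group j v == a)].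
have n12 : (0 < 12 * n)%N by rewrite muln_gt0 n_gt0'.
have cW : c \in W.
  by move: hc; rewrite inE /group_fun; case: (_ && _); rewrite ?mulr0 ?ltxx.
have ec : group_fun j a c = h j c.
  by move: cW; rewrite inE /group_fun => ->; rewrite mulr1.
case: (@arg_minnP _ c (mem W) (fun v => r j v : nat) cW) => v0 v0W hmin.
case: (@arg_maxnP _ c (mem W) (fun v => r j v : nat) cW) => v1 v1W hmax.
exists (r j v0), (r j v1).
have h01 : (r j v0 <= r j v1)%N by exact: hmin.
move: v0W v1W; rewrite !inE => /andP[s0 /eqP g0] /andP[s1 /eqP g1].
have lo : (a * (12 * n) <= prefix_size j (r j v0) * k)%N.
  by rewrite -g0 /group leq_trunc_div.
have hi : (prefix_size j (r j v1) * k < a.+1 * (12 * n))%N.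
  by rewrite -g1 /group; exact: ltn_ceil.
split; last first.
  have := prefix_size_split j h01; rewrite /small in s1.
  move=> e; have := congr1 (muln^~ k) e; rewrite /= !mulnDl; lia.
apply/setP => v; rewrite !inE ec; apply/idP/idP => [hv|].
  have vW : v \in W.
    rewrite inE; case b : (_ && _) => //; move: hv.
    by rewrite /group_fun b mulr0 leNgt -ec hc.
  have hm1 : (r j v0 <= r j v)%N by exact: hmin.
  have hm2 : (r j v <= r j v1)%N by exact: (hmax _ vW).
  rewrite hm1 hm2 /=.
  by move: hv vW; rewrite inE /group_fun => + b; rewrite b mulr1.
move=> /andP[/andP[h0 h1] hh]; suff : v \in W.
  by rewrite inE /group_fun => ->; rewrite mulr1.
rewrite inE; move: h0; rewrite leq_eqVlt => /orP[/eqP/val_inj e|h0].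
  by rewrite /small /group -e -/(small j v0) -/(group j v0) s0 g0 eqxx.
move: h1; rewrite leq_eqVlt => /orP[/eqP/val_inj e|h1].
  by rewrite /small /group e -/(small j v1) -/(group j v1) s1 g1 eqxx.
have l0 := prefix_size_le j h0; have l1 := prefix_size_le j h1.
have l0' : (prefix_size j (r j v0) * k <= prefix_size j (r j v) * k)%N.
  by rewrite leq_mul2r (leq_trans (leq_addr _ _) l0) orbT.
have l1' : (prefix_size j (r j v) * k + csize r j (r j v) * k <=
    prefix_size j (r j v1) * k)%N by rewrite -mulnDl leq_mul2r l1 orbT.
apply/andP; split; first by rewrite /small; lia.
rewrite /group eqn_leq; apply/andP; split.
  by rewrite -ltnS ltn_divLR //; lia.
by rewrite leq_divRL //; lia.
Qed.

Lemma group_mass_total : 11 / 24 * P%:R * k%:R <=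
  \sum_(ja : 'I_P * 'I_k) mass H (fun v => group_fun ja.1 ja.2 v ^+ 2).
Proof.
have n0 : 0 < n%:R :> R by rewrite ltr0n n_gt0'.
have k0 : 0 < k%:R :> R by rewrite ltr0n k_gt0'.
have w0 v : 0 <= wv v * nu v ^+ 2 by rewrite mulr_ge0 ?sqr_ge0 // vweight_ge0.
have hU : \sum_j \sum_v \sum_u wv u * h j u ^+ 2 * (r j u == r j v)%:R <=
    5 * n%:R * P%:R.
  under eq_bigr do under eq_bigr do under eq_bigr do rewrite rP.
  apply: (@le_trans _ _ (unsep_mass H k fn om * P%:R)); last exact: ler_wpM2r.
  apply: le_trans (@together_mass R V H k fn om proj_le P (fun j => sh j) th _) _.
    by move=> j i; exact: shift2_ge0.
  rewrite /unsep_mass mulr_suml; apply: ler_sum => v _.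
  rewrite mulr_suml; apply: ler_sum => u _.
  apply: ler_wpM2l; first by rewrite mulr_ge0.
  apply: (@le_trans _ _ (\sum_(j < P) (1 : R))); last by rewrite sumr_const card_ord.
  apply: ler_sum => j _; have /andP[t0 t1] := th01 j u.
  by rewrite exprn_ile1.
have hval := valid_mass k n_gt0' (isT : (0 < 12)%N) hU.
have e12 : 5 * n%:R * P%:R * k%:R / (12%:R * n%:R) = 5 / 12 * P%:R * k%:R :> R.
  by field; rewrite gt_eqF.
rewrite e12 in hval.
have hM : 7 / 8 * P%:R * k%:R <= \sum_j mass H (fun v => h j v ^+ 2).
  rewrite exchange_big /= -(total_mass orth) mulr_sumr; apply: ler_sum => v _.
  rewrite -mulr_sumr.
  under eq_bigr do rewrite /h /height exprMn.
  rewrite -mulr_sumr mulrA [leLHS]mulrC; apply: ler_wpM2l => //.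
  exact: sum_th2.
suff -> : \sum_(ja : 'I_P * 'I_k) mass H (fun v => group_fun ja.1 ja.2 v ^+ 2) =
  \sum_(jp : 'I_P * 'I_n | (csize r jp.1 jp.2 * k <= 12 * n)%N)
     mass H (fun v => cell_fun h r jp.1 jp.2 v ^+ 2) by lra.
rewrite -(pair_bigA _ (fun j a => mass H (fun v => group_fun j a v ^+ 2))) /=.
rewrite -(pair_big_dep xpredT (fun j p => (csize r j p * k <= 12 * n)%N)
  (fun j p => mass H (fun v => cell_fun h r j p v ^+ 2))) /=.
apply: eq_bigr => j _; rewrite exchange_big [RHS]exchange_big /=.
apply: eq_bigr => v _; rewrite -!mulr_sumr; congr (_ * _).
transitivity (h j v ^+ 2 * (small j v)%:R).
  rewrite (bigD1 (Ordinal (group_lt j v))) //= big1 ?addr0.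
    rewrite /group_fun eqxx andbT exprMn; congr (_ * _).
    by case: small; rewrite ?expr1n ?expr0n.
  move=> a /negPf ha; rewrite /group_fun; have -> : (group j v == a) = false.
    by rewrite eq_sym -ha -(inj_eq val_inj).
  by rewrite andbF mulr0 expr0n.
rewrite big_mkcond (bigD1 (r j v)) //= big1 ?addr0.
  by rewrite /cell_fun eqxx mulr1 /small; case: (_ <= _)%N; rewrite ?mulr1 ?mulr0.
move=> p; rewrite eq_sym => /negPf hp; rewrite /cell_fun hp mulr0 expr0n.
by case: ifP.
Qed.

Lemma mode2 : exists j c (p0 p1 : 'I_n),
  let S := [set v | (p0 <= r j v <= p1)%N && (h j c <= h j v)] in
  [/\ (#|S| * k <= 24 * n)%N, c \in S &
    cut H S <= Num.sqrt (80 * 65 ^+ 2 * (k%:R ^+ 2 * m%:R ^+ 3 * xi)) * volume H S].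
Proof.
have xi0 : 0 <= xi by exact: (@xi_ge0 R V H k fn k_gt0' xi osc_le).
have k0 : 0 < k%:R :> R by rewrite ltr0n k_gt0'.
have P0 : 0 < P%:R :> R by rewrite ltr0n P_gt0.
have Pk : 0 < P%:R * k%:R :> R by exact: mulr_gt0.
have hM := group_mass_total; set Mt := \sum_(ja : _) _ in hM.
pose mn (e : {set V}) : R :=
  Num.min (nu (top e) ^+ 2) (65 ^+ 2 * m%:R ^+ 4 * k%:R * osc2 e).
have mn0 e : 0 <= mn e.
  by rewrite le_min sqr_ge0 mulr_ge0 ?osc2_ge0 // !mulr_ge0 // exprn_ge0.
have c1 : 1 <= 65 ^+ 2 :> R by apply: exprn_ege1; lra.
have X0 : 0 <= k%:R ^+ 2 * m%:R ^+ 3 * xi.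
  by rewrite mulr_ge0 // mulr_ge0 // exprn_ge0.
have [|||||||ja [c [_ h2 h3]]] := @family_sweep R V H _ xpredT
  (fun (ja : 'I_P * 'I_k) v => group_fun ja.1 ja.2 v)
  (fun ja e => Num.sqrt (mn e * (hit ja.1 e || (group ja.1 (ctr e) == ja.2))%:R))
  (9 * 65 ^+ 2 * P%:R * (k%:R ^+ 2 * m%:R ^+ 3 * xi) * k%:R)
  (Num.sqrt (80 * 65 ^+ 2 * (k%:R ^+ 2 * m%:R ^+ 3 * xi))).
- by move=> ja v; exact: group_fun_ge0.
- by move=> ja e; exact: sqrtr_ge0.
- move=> [j a] e u v _ he hu hv /=; have [te tm] := topP he.
  have gmn : group_fun j a u - group_fun j a v <= Num.sqrt (mn e).
    apply: le_trans (ler_norm _) _; rewrite -sqrtr_sqr; apply: ler_wsqrtr.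
    rewrite le_min group_fun_lip // andbT -[leLHS]sqr_normr.
    rewrite ler_sqr ?nnegrE ?nu_ge0 // ler_norml.
    have g1 := group_fun_ge0 j a u; have g2 := group_fun_ge0 j a v.
    have g3 := le_trans (group_fun_le j a u) (tm u hu).
    have g4 := le_trans (group_fun_le j a v) (tm v hv).
    by apply/andP; split; lra.
  case hb : (hit j e || _) => /=; first by rewrite mulr1.
  move/negbT: hb; rewrite negb_or => /andP[/exists_inPn nh ng].
  have z x : x \in e -> group_fun j a x = 0.
    move=> hx; have := nh x hx; rewrite negb_exists => /forallP/(_ (ctr e)).
    rewrite ctrP //= negbK => /together_group[_ e2].
    by rewrite /group_fun e2 (negPf ng) andbF mulr0.
  by rewrite !z // subrr mulr0 sqrtr0.
- by apply: lt_le_trans hM; rewrite -mulrA; apply: mulr_gt0 => //; lra.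
- exact: sqrtr_ge0.
- rewrite exchange_big /=.
  apply: (@le_trans _ _ (\sum_(e in edges H) weight H e *
      (9 * 65 ^+ 2 * P%:R * k%:R ^+ 2 * m%:R ^+ 3 * osc2 e))); last first.
    apply: (@le_trans _ _ (9 * 65 ^+ 2 * P%:R * k%:R ^+ 2 * m%:R ^+ 3 * (k%:R * xi))).
      apply: le_trans (ler_wpM2l _ osc_le); last first.
        by rewrite !mulr_ge0 ?exprn_ge0.
      by rewrite mulr_sumr; apply: ler_sum => e _; rewrite mulrCA.
    by rewrite le_eqVlt; apply/orP; left; apply/eqP; ring.
  apply: ler_sum => e he; rewrite -mulr_sumr; apply: ler_wpM2l.
    exact: weight_ge0.
  apply: le_trans (edge_energy c1 he).
  rewrite -/(mn e) -(pair_bigA _ (fun (j : 'I_P) (a : 'I_k) =>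
    Num.sqrt (mn e * (hit j e || (group j (ctr e) == a))%:R) ^+ 2)) /=.
  apply: (@le_trans _ _ (\sum_(j < P) mn e * (k%:R * (hit j e)%:R + 1))); last first.
    rewrite -mulr_sumr big_split -mulr_sumr /= sumr_const card_ord.
    by rewrite lexx.
  apply: ler_sum => j _.
  apply: (@le_trans _ _ (\sum_(a < k) mn e *
     ((hit j e)%:R + (a == Ordinal (group_lt j (ctr e)))%:R))).
    apply: ler_sum => a _; rewrite sqr_sqrtr ?mulr_ge0 //; apply: ler_wpM2l => //.
    have -> : (group j (ctr e) == a) = (a == Ordinal (group_lt j (ctr e))).
      by rewrite eq_sym -(inj_eq val_inj).
    by rewrite -natrD ler_nat; case: hit; case: (_ == _).
  rewrite -mulr_sumr; apply: ler_wpM2l => //.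
  rewrite big_split /= sumr_const card_ord -[(hit j e)%:R *+ k]mulr_natl lerD2l.
  rewrite (bigD1 (Ordinal (group_lt j (ctr e)))) //= eqxx big1 ?addr0 //.
  by move=> a /negPf->.
- move: c1; set c := 65 ^+ 2 => c1.
  have B0 : 0 <= 80 * c * (k%:R ^+ 2 * m%:R ^+ 3 * xi).
    by apply: mulr_ge0 => //; lra.
  rewrite sqr_sqrtr // -/Mt; apply: (@le_trans _ _ (80 * c *
      (k%:R ^+ 2 * m%:R ^+ 3 * xi) * (11 / 24 * P%:R * k%:R)));
    last exact: ler_wpM2l.
  have : 0 <= c * ((k%:R ^+ 2 * m%:R ^+ 3 * xi) * (P%:R * k%:R)).
    by apply: mulr_ge0; [lra|rewrite mulr_ge0 // ltW].
  by lra.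
have [p0 [p1 [eS hsz]]] := group_interval h2.
exists ja.1, c, p0, p1; rewrite -eS /=; split=> //; last by rewrite inE.
apply: leq_trans hsz; rewrite eS leq_mul2r; apply/orP; right.
by apply: subset_leq_card; apply/subsetP => v; rewrite !inE => /andP[].
Qed.

End Mode2.

(** * Encoding of the input *)

Lemma nth_allpairs (S T U : Type) (x0 : U) (s0 : S) (t0 : T) (g : S -> T -> U)
    (ss : seq S) (ts : seq T) i j : (i < size ss)%N -> (j < size ts)%N ->
  nth x0 [seq g a b | a <- ss, b <- ts] (i * size ts + j) =
  g (nth s0 ss i) (nth t0 ts j).
Proof.
elim: ss i => // a ss IH [|i] hi hj /=.
  by rewrite mul0n add0n nth_cat size_map hj (nth_map t0).
rewrite nth_cat size_map mulSn -addnA ltnNge leq_addr /= addKn.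
exact: IH.
Qed.

Section Log.
Variable R : realType.
Implicit Types x y : R.

Lemma ln2_gt0 : 0 < ln 2 :> R. Proof. by apply: ln_gt0; lra. Qed.

Lemma log2_le x y : 0 < x -> x <= y -> log2 x <= log2 y.
Proof.
move=> hx hxy; rewrite ler_pM2r ?invr_gt0 ?ln2_gt0 // ler_ln ?posrE //.
exact: lt_le_trans hxy.
Qed.

Lemma log2_exp (j : nat) : log2 (2 ^+ j : R) = j%:R.
Proof.
by rewrite /log2 lnXn // -[_ *+ _]mulr_natl mulfK // gt_eqF // ln2_gt0.
Qed.

Lemma log2_2 : log2 2 = 1 :> R.
Proof. by rewrite /log2 divff // gt_eqF // ln2_gt0. Qed.

Lemma log2M x y : 0 < x -> 0 < y -> log2 (x * y) = log2 x + log2 y.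
Proof. by move=> hx hy; rewrite /log2 lnM ?posrE // mulrDl. Qed.

Lemma width_log (k : nat) : (25 <= k)%N ->
  [/\ 4 <= log2 (k%:R : R), 1 <= log2 (log2 (k%:R : R)) &
      (4 * up_log 2 (16 * k))%:R <= 10 * log2 (k%:R : R)].
Proof.
move=> hk; have k0 : 0 < k%:R :> R by rewrite ltr0n (leq_trans _ hk).
have l4 : 4 <= log2 (k%:R : R).
  rewrite -(log2_exp 4); apply: log2_le; first by rewrite exprn_gt0.
  by rewrite -natrX ler_nat; apply: leq_trans hk.
split=> //.
  by rewrite -[X in X <= _]log2_2; apply: log2_le => //; lra.
set q := up_log 2 (16 * k).
have q1 : (0 < q)%N by rewrite up_log_gt0 /=; lia.
have hq : (2 ^ q.-1 <= 16 * k)%N.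
  by apply: ltnW; apply: up_log_gtn => //; lia.
have : (q.-1)%:R <= 4 + log2 (k%:R : R).
  rewrite -[X in X <= _](log2_exp q.-1) -{1}(log2_exp 4) -log2M ?exprn_gt0 //.
  apply: log2_le; first by rewrite exprn_gt0.
  by rewrite -!natrX -natrM ler_nat.
have -> : (4 * q)%:R = 4 * ((q.-1)%:R + 1) :> R by rewrite natr1 prednK // natrM.
by lra.
Qed.

End Log.

Section Encoded.
Variables (R : realType) (V : finType) (H : hypergraph R V).
Variables (k : nat) (f : 'I_k -> V -> R) (v0 : V).

Local Notation n := #|V|.
Local Notation E := #|edges H|.

Definition vertex_at (j : nat) : V := nth v0 (enum V) j.
Definition edge_at (j : nat) : {set V} := nth set0 (enum (edges H)) j.
Definition inc (e v : nat) : bool := vertex_at v \in edge_at e.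
Definition wt (e : nat) : R := weight H (edge_at e).
Definition fn (s : nat) (v : V) : R := oapp (fun s' => f s' v) 0 (insub s).
Definition Fn (s v : nat) : R := fn s (vertex_at v).

Lemma vxK v : vertex_at (enum_rank v) = v.
Proof. exact: nth_enum_rank. Qed.

Lemma fnE (s : 'I_k) v : fn s v = f s v.
Proof. by rewrite /fn valK. Qed.

Lemma start_input om : start n E k inc wt Fn om (input H f om).
Proof.
split=> //.
- move=> e v he hv /=; rewrite {1}cardE.
  by rewrite (nth_allpairs _ set0 v0) -?cardE.
- move=> e he /=; rewrite (nth_map set0) //.
  by rewrite -cardE.
- move=> i v hi hv /=; rewrite {1}cardE.
  rewrite (nth_allpairs _ (Ordinal hi) v0) -?cardE ?card_ord //.
  rewrite /Fn -[i]/(nat_of_ord (Ordinal hi)) fnE; congr (f _ _).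
  by apply: val_inj; rewrite /= nth_enum_ord.
- by case=> [|[|[|a]]].
- by case=> [|[|a]].
Qed.

Lemma sum_vertices (U : nmodType) (G : V -> U) :
  \sum_(0 <= v < n) G (vertex_at v) = \sum_v G v.
Proof.
rewrite big_mkord (reindex_onto enum_rank enum_val) /=; last first.
  by move=> i _; exact: enum_valK.
apply: eq_big => [v|v _]; first by rewrite enum_rankK eqxx.
by rewrite vxK.
Qed.

Lemma sum_edges (U : nmodType) (G : {set V} -> U) :
  \sum_(0 <= e < E) G (edge_at e) = \sum_(e in edges H) G e.
Proof. by rewrite -big_enum (big_nth set0) -cardE. Qed.

Section Sets.
Variable S' : nat -> bool.
Let S : {set V} := [set v | S' (enum_rank v)].

Lemma S_vx j : (j < n)%N -> (vertex_at j \in S) = S' j.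
Proof.
move=> hj; rewrite inE -[in RHS](_ : enum_rank (vertex_at j) = j :> nat) //.
have {1}-> : j = Ordinal hj by [].
by rewrite /vertex_at -enum_val_nth enum_valK.
Qed.

Lemma sizef_set : sizef n S' = #|S|.
Proof.
rewrite /sizef -sum1_card [RHS]big_mkcond -sum_vertices big_nat [RHS]big_nat.
by apply: eq_bigr => v /andP[_ hv]; rewrite S_vx //; case: (S' v).
Qed.

Lemma degf_set e : degf n inc e = #|edge_at e|.
Proof.
rewrite /degf -sum1_card [RHS]big_mkcond -sum_vertices.
by apply: eq_bigr => v _; rewrite /inc; case: (_ \in _).
Qed.

Lemma hitf_set e : hitf n inc S' e = #|edge_at e :&: S|.
Proof.
rewrite /hitf -sum1_card [RHS]big_mkcond -sum_vertices big_nat [RHS]big_nat.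
by apply: eq_bigr => v /andP[_ hv]; rewrite inE S_vx // /inc; case: (_ && _).
Qed.

Lemma phif_set : phif n E inc wt S' = expansion H S.
Proof.
rewrite /phif /expansion -/(cut H S); congr (_ / _).
  rewrite cutE -sum_edges /cutf; apply: eq_bigr => e _.
  rewrite hitf_set degf_set /wt !card_gt0.
  have -> : (#|edge_at e :&: S| < #|edge_at e|)%N = (edge_at e :&: ~: S != set0).
    by rewrite -(cardsID S (edge_at e)) -{1}[#|_|]addn0 ltn_add2l card_gt0 setDE.
  by case: (_ && _); rewrite ?mulr1 ?mulr0.
rewrite volumeE -sum_edges; apply: eq_bigr => e _.
by rewrite hitf_set.
Qed.

Lemma validf_set : validf R n k S' = (S != set0) && (#|S| * k <= 24 * n)%N.
Proof.
by rewrite /validf sizef_set card_gt0 -natrM -(natrM R 24) ler_nat.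
Qed.

End Sets.

Lemma expansion_le1 (S : {set V}) : S != set0 -> expansion H S <= 1.
Proof.
move=> hS; rewrite /expansion ler_pdivrMr ?volume_gt0 // mul1r -/(cut H S).
rewrite cutE volumeE; apply: ler_sum => e he; apply: ler_wpM2l.
  exact: weight_ge0.
by rewrite ler_nat -card_gt0; case: (#|_ :&: S|) => //= c; case: (_ != _).
Qed.

Variable om : seq bool.

Lemma normfE v : normf k Fn (enum_rank v) = nu k fn v.
Proof. by rewrite /normf /Fn vxK. Qed.

Lemma projfE i v : projf k Fn om i (enum_rank v) = proj k fn om i v.
Proof. by rewrite /projf normfE /Fn vxK. Qed.

Lemma hvalE b eta v :
  hval k (normf k Fn) (projf k Fn om) b eta (enum_rank v) = height k fn om b eta v.
Proof.
rewrite /hval normfE /height; congr (_ * _); apply: eq_bigr => i _.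
by rewrite /pos projfE.
Qed.

Lemma eqvE b u v : eqv k (projf k Fn om) b (enum_rank u) (enum_rank v) =
  together k fn om b u v.
Proof.
rewrite /eqv /together; apply: eq_all => i.
by rewrite /idx /pos !projfE.
Qed.

Lemma repf_lt b v : (repf n k (projf k Fn om) b (enum_rank v : 'I_n) < n)%N.
Proof. by case: (repfP k (projf k Fn om) b (ltn_ord (enum_rank v))). Qed.

Definition rep b (v : V) : 'I_n := Ordinal (repf_lt b v).

Lemma repP b u v : (rep b u == rep b v) = together k fn om b u v.
Proof.
rewrite -eqvE -(inj_eq val_inj) /=.
have [a1 a2 a3] := repfP k (projf k Fn om) b (ltn_ord (enum_rank u)).
have [b1 b2 b3] := repfP k (projf k Fn om) b (ltn_ord (enum_rank v)).
apply/eqP/eqvP => [e i hi|h].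
  move/eqvP: a2 => /(_ i hi) <-; rewrite e.
  by move/eqvP: b2 => /(_ i hi).
apply/eqP; rewrite eqn_leq; apply/andP; split.
  apply: (a3 _ b1); apply/eqvP => i hi; rewrite h //.
  by move/eqvP: b2 => /(_ i hi).
apply: (b3 _ a1); apply/eqvP => i hi; rewrite -h //.
by move/eqvP: a2 => /(_ i hi).
Qed.

Lemma candE b eta p q' c :
  [set v | cand n k (normf k Fn) (projf k Fn om) b eta p q' (enum_rank c)
             (enum_rank v : 'I_n)] =
  [set v | (p <= rep b v <= q')%N &&
     (height k fn om b eta c <= height k fn om b eta v)].
Proof. by apply/setP => v; rewrite !inE /cand !hvalE andbA. Qed.

Lemma proj_le_k i v : `|proj k fn om i v| <= k%:R.
Proof. by rewrite -projfE; exact: projf_le. Qed.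

Hypothesis orth : orthonormal_w H f.

Lemma fn_orth s t : (s < k)%N -> (t < k)%N ->
  \sum_v vweight H v * fn s v * fn t v = (s == t)%:R.
Proof.
move=> hs ht; rewrite -[s]/(nat_of_ord (Ordinal hs)) -[t]/(nat_of_ord (Ordinal ht)).
under eq_bigr do rewrite !fnE.
exact: orth.
Qed.

Variable xi : R.
Hypothesis xi_bound : \big[Num.max/0]_(s < k) discrepancy H (f s) <= xi.

Lemma fn_discrepancy : \big[Num.max/0]_(s < k) discrepancy H (fn s) <= xi.
Proof.
apply: le_trans xi_bound; rewrite le_eqVlt; apply/orP; left; apply/eqP.
apply: eq_bigr => s _; rewrite /discrepancy; congr (_ / _).
  apply: eq_bigr => e _; congr (_ * _); apply: eq_bigr => u _.
  by apply: eq_bigr => v _; rewrite !fnE.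
by apply: eq_bigr => u _; rewrite fnE.
Qed.

Definition ctr (e : {set V}) : V := odflt v0 [pick v in e].

Lemma ctrP e : e \in edges H -> ctr e \in e.
Proof.
move=> he; rewrite /ctr; case: pickP => //= h.
by have /set0Pn[v] := edges_neq0 he; rewrite h.
Qed.

Let q := up_log 2 (16 * k).
Let m := (4 * q)%N.

Definition good : bool := (far_mass H k fn om <= n%:R) &&
  (star_energy H k fn ctr om <= 4 * (m%:R * (max_edge_size H)%:R * (k%:R * xi))).

Definition bound : R :=
  2 * 100 ^+ 2 * Num.min (Num.sqrt ((max_edge_size H)%:R * log2 (k%:R : R)))
     (k%:R * log2 (k%:R : R) * log2 (log2 (k%:R : R)) *
        Num.sqrt (log2 ((max_edge_size H)%:R : R))) * Num.sqrt xi.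

Hypothesis k_gt0 : (0 < k)%N.

Lemma expansion_V : expansion H setT = 0.
Proof.
rewrite /expansion (_ : boundary H setT = set0) ?big_set0 ?mul0r //.
by apply/setP => e; rewrite !inE setCT setI0 eqxx /= !andbF.
Qed.

Lemma expansion_small (S : {set V}) : (max_edge_size H <= 1)%N -> expansion H S = 0.
Proof.
move=> hr; rewrite /expansion (_ : boundary H S = set0) ?big_set0 ?mul0r //.
apply/setP => e; rewrite !inE; apply/negbTE/negP => /andP[he /andP[h1 h2]].
have : (#|e| <= 1)%N by apply: leq_trans hr; exact: leq_bigmax_cond.
rewrite -card_gt0 in h1; rewrite -card_gt0 in h2.
by rewrite -(cardsID S e) setDE; lia.
Qed.

Lemma expansion_lam (S : {set V}) lam : S != set0 ->
  cut H S <= lam * volume H S -> expansion H S <= lam.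
Proof.
by move=> hS h; rewrite /expansion ler_pdivrMr ?volume_gt0.
Qed.

Lemma bound_ge0 : 0 <= bound.
Proof.
rewrite /bound; apply: mulr_ge0; last exact: sqrtr_ge0.
apply: mulr_ge0; first by rewrite mulr_ge0 // exprn_ge0.
rewrite le_min sqrtr_ge0 /=; apply: mulr_ge0; last exact: sqrtr_ge0.
have [->|k1] := eqVneq k 1%N; first by rewrite /log2 ln1 mul0r mulr0 mul0r.
have k2 : 2 <= k%:R :> R by rewrite ler_nat; lia.
have l1 : 1 <= log2 (k%:R : R).
  by rewrite -[X in X <= _](log2_2 R); apply: log2_le => //; lra.
have l2 : 0 <= log2 (log2 (k%:R : R)).
  by have := log2_le (ltr01 : 0 < 1 :> R) l1; rewrite {1}/log2 ln1 mul0r.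
by rewrite mulr_ge0 // mulr_ge0 //; lra.
Qed.

Lemma bound_of_modes x : (25 <= k)%N -> (1 < max_edge_size H)%N -> 0 <= xi ->
  x <= Num.sqrt (4000 * (m%:R * (max_edge_size H)%:R * xi)) ->
  x <= Num.sqrt (80 * 65 ^+ 2 * (k%:R ^+ 2 * m%:R ^+ 3 * xi)) ->
  x <= bound.
Proof.
move=> hk hr xi0 h1 h2; have [l4 ll1 hm] := width_log R hk.
set L := log2 (k%:R : R) in l4 ll1 hm *; set r : R := (max_edge_size H)%:R in h1 *.
have r2 : 2 <= r by rewrite ler_nat.
have k25 : 25 <= k%:R :> R by rewrite ler_nat.
have m0 : 0 <= m%:R :> R by [].
have hm' : m%:R <= 10 * L by exact: hm.
have s0 := sqrtr_ge0 xi.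
set B2 := k%:R * L * log2 L * Num.sqrt (log2 r).
have b1 : x <= 2 * 100 ^+ 2 * Num.sqrt (r * L) * Num.sqrt xi.
  apply: le_trans h1 _.
  apply: (@le_trans _ _ (Num.sqrt (200 ^+ 2 * ((r * L) * xi)))).
    apply: ler_wsqrtr.
    have : m%:R * r * xi <= 10 * L * r * xi.
      by apply: ler_wpM2r => //; apply: ler_wpM2r => //; lra.
    by lra.
  have rL : 0 <= r * L by apply: mulr_ge0; lra.
  rewrite sqrtrM ?sqr_ge0 // sqrtr_sqr ger0_norm // sqrtrM // mulrA.
  apply: ler_wpM2r => //; apply: ler_wpM2r; first exact: sqrtr_ge0.
  by lra.
have lr1 : 1 <= log2 r.
  by rewrite -[X in X <= _](log2_2 R); apply: log2_le => //; lra.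
have sr1 : 1 <= Num.sqrt (log2 r) by rewrite -sqrtr1 ler_wsqrtr.
have kL0 : 0 <= k%:R * L by apply: mulr_ge0; lra.
have B2ge : k%:R * L * Num.sqrt (log2 r) <= B2.
  apply: ler_wpM2r; first exact: sqrtr_ge0.
  by rewrite ler_peMr.
rewrite /bound -/L -/r -/B2.
case: (leP (Num.sqrt (r * L)) B2) => hB; first exact: b1.
have hkr : k%:R <= r.
  rewrite leNgt; apply/negP => hlt; move: hB; rewrite ltNge => /negP; apply.
  apply: le_trans B2ge; apply: (@le_trans _ _ (k%:R * L)); last by rewrite ler_peMr.
  rewrite -(ger0_norm kL0) -sqrtr_sqr; apply: ler_wsqrtr.
  apply: (@le_trans _ _ (k%:R * L)); first by apply: ler_wpM2r; lra.
  rewrite expr2 ler_peMr //; apply: (@le_trans _ _ (1 * L)); first by lra.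
  by apply: ler_wpM2r; lra.
apply: le_trans h2 _.
apply: (@le_trans _ _ (2 * 100 ^+ 2 * (k%:R * L * Num.sqrt L) * Num.sqrt xi)).
  have L0 : 0 <= L by lra.
  have A0 : 0 <= 2 * 100 ^+ 2 * (k%:R * L * Num.sqrt L) * Num.sqrt xi.
    apply: mulr_ge0 => //; apply: mulr_ge0; first by rewrite mulr_ge0 // exprn_ge0.
    by rewrite mulr_ge0 // sqrtr_ge0.
  rewrite -[leRHS](ger0_norm A0) -sqrtr_sqr; apply: ler_wsqrtr.
  rewrite [leRHS]exprMn (sqr_sqrtr xi0).
  have -> : (2 * 100 ^+ 2 * (k%:R * L * Num.sqrt L)) ^+ 2 =
     (2 * 100 ^+ 2) ^+ 2 * (k%:R ^+ 2 * L ^+ 2 * Num.sqrt L ^+ 2) by ring.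
  rewrite sqr_sqrtr // mulrA; apply: ler_wpM2r => //.
  have m3 : m%:R ^+ 3 <= (10 * L) ^+ 3 by apply: lerXn2r; rewrite ?nnegrE //; lra.
  have km : k%:R ^+ 2 * m%:R ^+ 3 <= k%:R ^+ 2 * (10 * L) ^+ 3.
    by apply: ler_wpM2l => //; exact: sqr_ge0.
  apply: (@le_trans _ _ (80 * 65 ^+ 2 * (k%:R ^+ 2 * (10 * L) ^+ 3))).
    by apply: ler_wpM2l => //; rewrite mulr_ge0 // exprn_ge0.
  have -> : 80 * 65 ^+ 2 * (k%:R ^+ 2 * (10 * L) ^+ 3) =
     (8 * 65 ^+ 2) * (100 ^+ 2) * (k%:R ^+ 2 * L ^+ 3) by ring.
  have -> : (2 * 100 ^+ 2) ^+ 2 * (k%:R ^+ 2 * L ^+ 2 * L) =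
     (2 ^+ 2 * 100 ^+ 2) * (100 ^+ 2) * (k%:R ^+ 2 * L ^+ 3) by ring.
  apply: ler_wpM2r; first by rewrite mulr_ge0 // exprn_ge0.
  apply: ler_wpM2r; first by rewrite exprn_ge0.
  by rewrite !expr2; lra.
apply: ler_wpM2r => //; apply: ler_wpM2l; first by rewrite mulr_ge0 // exprn_ge0.
apply: le_trans B2ge; apply: ler_wpM2l => //; apply: ler_wsqrtr.
by apply: log2_le => //; lra.
Qed.

Lemma result_bound s : out n E k inc wt s ->
  (validf R n k xpredT -> best s <= phif n E inc wt xpredT) ->
  searched n E k inc wt Fn om (2 ^ m) (best s) ->
  exists2 S : {set V}, outputs s S &
    good -> [&& S != set0, #|S|%:R <= 24 * n%:R / k%:R :> R & expansion H S <= bound].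
Proof.
move=> os hall hs.
have k0 : 0 < k%:R :> R by rewrite ltr0n.
have pick_set (S' : nat -> bool) : (forall v, (v < n)%N -> nmem s 2 v = S' v) ->
    outputs s [set v | S' (enum_rank v : 'I_n)].
  by move=> h v; rewrite inE h.
have size_le (S : {set V}) : (#|S| * k <= 24 * n)%N -> #|S|%:R <= 24 * n%:R / k%:R :> R.
  by move=> h; rewrite ler_pdivlMr // -!natrM ler_nat.
suff key : good -> exists2 S : {set V},
    S != set0 & best s <= expansion H S /\ ((1 < max_edge_size H)%N -> best s <= bound) \/
    best s <= 0.
  case: os => [[S' [h1 hv hb]]|[h1 hb]]; last first.
    exists set0; first by move=> v; rewrite h1 ?inE.
    move=> /key[S hS [[h2 _]|h2]]; exfalso; last by rewrite hb in h2; lra.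
    by have := expansion_le1 hS; rewrite hb in h2; lra.
  exists [set v | S' (enum_rank v : 'I_n)]; first exact: pick_set.
  move=> hg; move: hv; rewrite validf_set => /andP[-> hsz] /=.
  rewrite size_le //= -phif_set -hb.
  have [hr|hr] := leqP (max_edge_size H) 1.
    by rewrite hb phif_set expansion_small // bound_ge0.
  have [S _ [[_ h2]|h2]] := key hg; first exact: h2.
  exact: le_trans bound_ge0.
move=> /andP[hfar hstar].
have [hk|hk] := leqP 25 k; last first.
  exists setT.
    apply/set0Pn; exists v0; exact: in_setT.
  right; rewrite -expansion_V.
  have eT : [set v | (xpredT : nat -> bool) (enum_rank v : 'I_n)] = setT.
    by apply/setP => v; rewrite !inE.
  have e1 : phif n E inc wt xpredT = expansion H setT.
    by rewrite -eT; exact: phif_set.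
  rewrite -e1; apply: hall; have := validf_set xpredT; rewrite eT cardsT => ->.
  apply/andP; split; last by rewrite mulnC leq_mul2r orbC -ltnS hk.
  by apply/set0Pn; exists v0; exact: in_setT.
have uns : unsep_mass H k fn om <= 5 * n%:R.
  by apply: le_trans (unsep_mass_le fn_orth om) _; lra.
have osc := osc2_sum fn_orth fn_discrepancy.
have xi0 : 0 <= xi by exact: (@xi_ge0 R V H k fn k_gt0 xi osc).
have [j [p [c [hsz hc hcut]]]] := mode1 fn_orth k_gt0 proj_le_k osc uns
  (r := fun j => rep (shift1 R j)) (fun j => repP (shift1 R j)) ctrP hstar.
set S1 := [set v | _] in hcut.
have S1c : c \in S1 by rewrite inE.
have S1nz : S1 != set0 by apply/set0Pn; exists c.
have hrc : rep (shift1 R j) c = p.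
  by apply/eqP; move: hc; rewrite /cell_fun; case: (_ == _); rewrite ?mulr0 ?ltxx.
have S1sub : S1 \subset [set v | rep (shift1 R j) v == p].
  apply/subsetP => v; rewrite !inE => hv; apply: contraTT hc => hne.
  by rewrite -leNgt; apply: le_trans hv _; rewrite /cell_fun (negPf hne) mulr0.
have S1E : S1 = [set v | cand n k (normf k Fn) (projf k Fn om) (shift1 R j)
    (@bump1 R) p p (enum_rank c) (enum_rank v : 'I_n)].
  rewrite candE; apply/setP => v; rewrite [RHS]inE -eqn_leq.
  rewrite (_ : (p == rep (shift1 R j) v :> nat) = (rep (shift1 R j) v == p)); last first.
    by rewrite eq_sym.
  case hv : (_ == p) => /=; last first.
    by apply/negbTE; apply: contraFN hv => /(subsetP S1sub); rewrite inE.
  by rewrite inE /cell_fun hv hrc eqxx !mulr1.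
have S1v : (#|S1| * k <= 24 * n)%N.
  by apply: leq_trans hsz; rewrite leq_mul2r (subset_leq_card S1sub) orbT.
have x1 : best s <= expansion H S1.
  have [h1 _] := hs j p p (enum_rank c) (ltn_ord j) (ltn_ord p) (ltn_ord p)
    (ltn_ord (enum_rank c)).
  by rewrite S1E -phif_set; apply: h1; rewrite validf_set -S1E S1nz.
exists S1 => //; left; split=> // hr.
have [j2 [c2 [p0 [p1 [hsz2 hc2 hcut2]]]]] := mode2 fn_orth hk proj_le_k osc uns
  (r := fun j => rep (shift2 R k j)) (fun j => repP (shift2 R k j)) ctrP.
set S2 := [set v | _] in hsz2 hc2 hcut2.
have S2nz : S2 != set0 by apply/set0Pn; exists c2.
have S2E : S2 = [set v | cand n k (normf k Fn) (projf k Fn om) (shift2 R k j2)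
    (@bump2 R m) p0 p1 (enum_rank c2) (enum_rank v : 'I_n)].
  by rewrite candE.
have x2 : best s <= expansion H S2.
  have [_ h1] := hs j2 p0 p1 (enum_rank c2) (ltn_ord j2) (ltn_ord p0) (ltn_ord p1)
    (ltn_ord (enum_rank c2)).
  by rewrite S2E -phif_set; apply: h1; rewrite validf_set -S2E S2nz.
apply: bound_of_modes => //.
  by apply: le_trans x1 _; exact: expansion_lam.
by apply: le_trans x2 _; exact: expansion_lam.
Qed.

End Encoded.

Definition size_poly : {poly nat} := 'X *+ 2 + ('X *+ 32) ^+ 4.
Definition time_poly : {poly nat} := (cost_poly main_cmd + 'X ^+ 2) \Po size_poly.

Lemma size_polyE x : size_poly.[x] = (2 * x + (32 * x) ^ 4)%N.
Proof.
have mE (a b : nat) : a *+ b = (a * b)%N.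
  by elim: b => [|b IH]; rewrite ?mulr0n ?muln0 // mulrS IH mulnS.
have eE (a b : nat) : a ^+ b = (a ^ b)%N.
  by elim: b => [|b IH]; rewrite ?expr0 ?expn0 // exprS IH expnS.
by rewrite /size_poly hornerD horner_exp !hornerMn hornerX eE !mE ![(x * _)%N]mulnC.
Qed.

Lemma time_polyE x (Y := size_poly.[x]) :
  time_poly.[x] = (cost Y main_cmd + Y * Y)%N.
Proof. by rewrite /time_poly horner_comp hornerD horner_exp hornerX cost_polyE. Qed.

Lemma width_pow k : (0 < k)%N -> (2 ^ (4 * up_log 2 (16 * k)) <= (32 * k) ^ 4)%N.
Proof.
move=> hk; rewrite mulnC expnM leq_exp2r //.
have h : (1 < 16 * k)%N by lia.
have h1 := up_log_gtn (isT : 1 < 2)%N h.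
have h2 : (0 < up_log 2 (16 * k))%N by rewrite up_log_gt0.
by rewrite -(prednK h2) expnS; lia.
Qed.

Section Final.
Variables (R : realType) (V : finType) (H : hypergraph R V).
Variables (k : nat) (f : 'I_k -> V -> R) (xi : R).
Hypothesis k_gt0 : (0 < k)%N.
Hypothesis orth : orthonormal_w H f.
Hypothesis xi_bound : \big[Num.max/0]_(s < k) discrepancy H (f s) <= xi.
Let m := (4 * up_log 2 (16 * k))%N.
Let T := time_poly.[input_size H k].

Lemma vertex_exists : exists v0 : V, true.
Proof.
case: (pickP (@predT V)) => [v _|h]; first by exists v.
have := orth (Ordinal k_gt0) (Ordinal k_gt0); rewrite eqxx /inner_w big_pred0 //.
by move/eqP; rewrite eq_sym oner_eq0.
Qed.

Lemma size_bound :
  (#|V| + #|edges H| + 2 ^ m <= size_poly.[input_size H k])%N.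
Proof.
have [v0 _] := vertex_exists.
have V0 : (0 < #|V|)%N by apply/card_gt0P; exists v0.
rewrite size_polyE /input_size; set x := (3 + _ + _ + _)%N.
have kx : (k <= x)%N by rewrite /x; nia.
have nx : (#|V| <= x)%N by rewrite /x; nia.
have ex : (#|edges H| <= x)%N by rewrite /x; lia.
apply: leq_add; first by lia.
apply: leq_trans (width_pow k_gt0) _; rewrite leq_exp2r //.
by rewrite leq_mul2l kx orbT.
Qed.

Lemma coins_enough : (m * k <= T)%N.
Proof.
rewrite /T time_polyE; apply: leq_trans (leq_addl _ _).
have hP : (2 ^ m <= size_poly.[input_size H k])%N.
  by apply: leq_trans size_bound; rewrite leq_addl.
apply: leq_mul; apply: leq_trans hP; first by apply: ltnW; apply: ltn_expl.
exact: leqPk.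
Qed.

Lemma good_prob v0 :
  2^-1 <= Ex T (fun om => (good H f v0 om xi)%:R) :> R.
Proof.
have orth' := fn_orth orth.
have h1 := Ex_markov (@far_mass_ge0 R V H k (fn f)) (Ex_far_mass orth' k_gt0 coins_enough).
have h2 := Ex_markov (@star_energy_ge0 R V H k (fn f) (ctr v0))
  (Ex_star_energy orth' (ctrP (H := H) v0) coins_enough (fn_discrepancy xi_bound)).
set A := fun l => (_ < far_mass H k (fn f) l)%R%:R in h1.
set B := fun l => (_ < star_energy H k (fn f) _ l)%R%:R in h2.
suff : 1 <= Ex T (fun om => (good H f v0 om xi)%:R) + Ex T A + Ex T B by lra.
rewrite -!ExD -[leLHS](Ex_cst T); apply: Ex_le => l _.
rewrite /good /A /B; cbv zeta.
have -> : 4 * (#|V|%:R / 4) = #|V|%:R :> R by field.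
rewrite !ltNge; case: (_ <= #|V|%:R) => /=; last by rewrite add0r lerDl.
by case: (_ <= 4 * _); rewrite /= ?addr0 ?add0r.
Qed.

Lemma good_event : exists S : T.-tuple bool -> {set V},
  (forall om : T.-tuple bool, computes H f main_cmd T om (S om)) /\
  2^-1 <= coin_prob R (fun om : T.-tuple bool =>
    [&& S om != set0, #|S om|%:R <= 24 * #|V|%:R / k%:R :> R &
      expansion H (S om) <= bound H k xi]).
Proof.
have [v0 _] := vertex_exists.
have run (om : T.-tuple bool) : exists S : {set V},
    computes H f main_cmd T om S /\
    (good H f v0 om xi -> [&& S != set0, #|S|%:R <= 24 * #|V|%:R / k%:R :> R &
      expansion H S <= bound H k xi]).
  have hsz : (m * k <= size om)%N by rewrite size_tuple; exact: coins_enough.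
  have [t [s [he ht [ho ha hs]]]] :=
    main_spec k_gt0 hsz size_bound (start_input H f v0 om).
  have [S hS hb] := result_bound orth xi_bound k_gt0 ho ha hs.
  exists S; split=> //; exists t, s; split=> //.
  by apply: leq_trans ht _; rewrite /T time_polyE leq_addr.
have [S hS] := fin_all_exists run.
exists S; split=> [om|]; first by have [] := hS om.
apply: le_trans (good_prob v0) _.
rewrite -coin_probE /coin_prob ler_pM2r ?invr_gt0 ?exprn_gt0 // ler_nat.
apply: subset_leq_card; apply/subsetP => om hom.
by have [_ h] := hS om; exact: h hom.
Qed.

End Final.

Theorem mainTheorem9 (R : realType) :
  exists (C c : R) (prog : cmd) (p : {poly nat}),
    0 < C /\ 0 < c /\
    forall (V : finType) (H : hypergraph R V) (k : nat)
           (f : 'I_k -> V -> R) (xi : R),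
      (0 < k)%N ->
      orthonormal_w H f ->
      \big[Num.max/0]_(s < k) discrepancy H (f s) <= xi ->
      let T := p.[input_size H k] in
      let r : R := (max_edge_size H)%:R in
      let K : R := k%:R in
      exists S : T.-tuple bool -> {set V},
        (forall omega : T.-tuple bool,
           computes H f prog T omega (S omega)) /\
        c <= coin_prob R (fun omega : T.-tuple bool =>
               [&& S omega != set0,
                   #|S omega|%:R <= 24 * #|V|%:R / K &
                   expansion H (S omega) <=
                     C * Num.min (Num.sqrt (r * log2 K))
                                 (K * log2 K * log2 (log2 K)
                                    * Num.sqrt (log2 r))
                       * Num.sqrt xi]).
Proof.
exists (2 * 100 ^+ 2), 2^-1, main_cmd, time_poly.
split; first by rewrite mulr_gt0 // exprn_gt0.
split; first by rewrite invr_gt0.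
by move=> V H k f xi hk orth hxi T r K; exact: good_event hk orth hxi.
Qed.
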